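(* Let $X$ be the Rosenblatt Ornstein-Uhlenbeck process with periodic mean (as defined in the context) and let $\tilde h(t)=e^{-\alpha t}\int_{-\infty}^te^{\alpha s}L(s)ds$. Assume that $\tilde h\notin\operatorname{span}(\varphi_1,\dots,\varphi_p)$, and let $\varphi_{p+1}$ be a bounded 1-periodic function which is orthogonal in $L^2([0,1])$ to all $\varphi_i$, $i=1,\dots,p$, but not orthogonal to $\tilde h$. For integers $n\ge1$ define $$\bar\alpha_n:=-\frac{\int_0^n\varphi_{p+1}(t)dX_t}{\int_0^n\varphi_{p+1}(t)X_tdt},\qquad \bar\mu_{i,n}:=\frac1n\Big(\int_0^n\varphi_i(t)dX_t+\bar\alpha_n\int_0^n\varphi_i(t)X_tdt\Big),\quad i=1,\dots,p.$$ Then $(\bar\alpha_n,\bar\mu_{1,n},\dots,\bar\mu_{p,n})$ is a consistent estimator of $(\alpha,\mu_1,\dots,\mu_p)$ as $n\to\infty$.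
   Context: Rosenblatt process. Fix $H\in(\frac12,1)$, put $H'=\frac{H+1}{2}$, and let $(B_t)_{t\ge0}$ be a standard Brownian motion. For $0<s<t$ let $K^{H'}(t,s)=c_{H'}s^{\frac12-H'}\int_s^t(u-s)^{H'-\frac32}u^{H'-\frac12}du$ with a constant $c_{H'}>0$. The Rosenblatt process is $$Z^H_t=d(H)\int_0^t\int_0^t\Big(\int_{y_1\vee y_2}^t\frac{\partial K^{H'}}{\partial u}(u,y_1)\frac{\partial K^{H'}}{\partial u}(u,y_2)\,du\Big)dB_{y_1}dB_{y_2},\quad t\ge0,$$ a multiple Wiener-Ito integral of order 2, where the constant $d(H)>0$ is such that $\mathbf E(Z^H_t)^2=t^{2H}$. For deterministic $g$ the Wiener integral is $\int_0^Tg(s)dZ^H_s:=d(H)\int_0^T\int_0^T\big(\int_{y_1\vee y_2}^Tg(u)\frac{\partial K^{H'}}{\partial u}(u,y_1)\frac{\partial K^{H'}}{\partial u}(u,y_2)du\big)dB_{y_1}dB_{y_2}$. Model. Let $\alpha>0$, $p\ge1$, $\mu_1,\dots,\mu_p\in\mathbb R$, let $\varphi_1,\dots,\varphi_p:\mathbb R\to\mathbb R$ be bounded measurable 1-periodic functions, orthonormal in $L^2([0,1])$, and $L=\sum_{i=1}^p\mu_i\varphi_i$. $X$ is the solution of $X_t=\int_0^t(L(s)-\alpha X_s)ds+Z^H_t$, $t\ge0$, i.e. $X_t=e^{-\alpha t}\big(\int_0^te^{\alpha s}L(s)ds+\int_0^te^{\alpha s}dZ^H_s\big)$. For deterministic bounded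 $g$, $\int_0^tg(s)dX_s:=\int_0^tg(s)(L(s)-\alpha X_s)ds+\int_0^tg(s)dZ^H_s$. *)

(* Defs.v *)
From HB Require Import structures.
From mathcomp Require Import all_boot all_order all_algebra.
From mathcomp Require Import all_classical all_reals all_analysis.
Set Implicit Arguments.
Unset Strict Implicit.
Unset Printing Implicit Defensive.
Import Order.TTheory GRing.Theory Num.Theory.
Import numFieldNormedType.Exports.
Local Open Scope classical_set_scope.
Local Open Scope ring_scope.

(* Processes are indexed by all of [R]; only times
   [t >= 0] are ever constrained or used. *)

(* [normal_prob m s] is the normal law of mean [m] and standard deviation [s]. *)
Record brownian_motion (R : realType) (d : measure_display)
    (T : measurableType d) (P : probability T R)
    (B : R -> {RV P >-> R}) : Prop := BrownianMotion {
  bm_start : {ae P, forall w, B 0 w = 0} ;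
  bm_indep : forall (n : nat) (t : nat -> R) (A : nat -> set R),
    0 <= t 0%N -> {homo t : i j / (i <= j)%N >-> i <= j} ->
    (forall i, measurable (A i)) ->
    P (\bigcap_(i in `I_n) [set w | A i (B (t i.+1) w - B (t i) w)]) =
    (\prod_(i < n) P [set w | A i (B (t i.+1) w - B (t i) w)%R])%E ;
  bm_gauss : forall (s t : R) (A : set R), 0 <= s -> s < t -> measurable A ->
    P [set w | A (B t w - B s w)] = normal_prob 0 (Num.sqrt (t - s)) A ;
  bm_paths : {ae P, forall w,
    {within `[0, +oo[, continuous (fun t : R => B t w)}} }.

(* Coefficients on the diagonal blocks are ignored by [offdiag_fun] and
   [offdiag_int]: the sums run over [i != j]. *)
Record offdiag_step (R : realType) := OffdiagStep {
  os_size : nat ;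
  os_time : nat -> R ;
  os_coef : nat -> nat -> R ;
  os_time_ge0 : 0 <= os_time 0%N ;
  os_time_homo : {homo os_time : i j / (i <= j)%N >-> i <= j} }.

Definition offdiag_fun (R : realType) (s : offdiag_step R) (y : R * R) : R :=
  \sum_(i < os_size s) \sum_(j < os_size s | j != i)
    os_coef s i j * \1_`]os_time s i, os_time s i.+1] y.1
                  * \1_`]os_time s j, os_time s j.+1] y.2.

Definition offdiag_int (R : realType) (d : measure_display)
    (T : measurableType d) (P : probability T R) (B : R -> {RV P >-> R})
    (s : offdiag_step R) (w : T) : R :=
  \sum_(i < os_size s) \sum_(j < os_size s | j != i)
    os_coef s i j * (B (os_time s i.+1) w - B (os_time s i) w)
                  * (B (os_time s j.+1) w - B (os_time s j) w).

(* [Y] is a version of the multiple Wiener-Ito integral of order 2 of [f]: the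
   L^2(P)-limit of the integrals of off-diagonal step functions converging to
   [f] in L^2(dy1 dy2).  Such step functions live on the positive quadrant, so
   [f] must vanish almost everywhere outside of it. *)
Definition is_double_wiener_ito (R : realType) (d : measure_display)
    (T : measurableType d) (P : probability T R) (B : R -> {RV P >-> R})
    (f : R * R -> R) (Y : {RV P >-> R}) : Prop :=
  measurable_fun [set: R * R] f /\
  exists s : nat -> offdiag_step R,
    ((\int[(@lebesgue_measure R \x @lebesgue_measure R)%E]_y
        ((offdiag_fun (s n) y - f y) ^+ 2)%:E)%E @[n --> \oo] --> 0%E) /\
    (('E_P[fun w => ((offdiag_int B (s n) w - Y w) ^+ 2)%R])%E
        @[n --> \oo] --> 0%E).

Definition volterra_kernel (R : realType) (H' c t s : R) : R :=
  c * s `^ (2^-1 - H') *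
  \int[lebesgue_measure]_(u in `[s, t])
     ((u - s) `^ (H' - 3 / 2) * u `^ (H' - 2^-1)).

Definition volterra_kernel_du (R : realType) (H' c u y : R) : R :=
  derive1 (fun v : R => volterra_kernel H' c v y) u.

(* Integrand of the double integral defining [\int_0^t g dZ^H], without the
   constant [d(H)]; it is extended by 0 outside of [0, t]^2. *)
Definition rosenblatt_kernel (R : realType) (H c : R) (g : R -> R) (t : R)
    (y : R * R) : R :=
  let H' := (H + 1) / 2 in
  \1_(`[0, t] `*` `[0, t]) y *
  \int[lebesgue_measure]_(u in `]Num.max y.1 y.2, t])
     (g u * volterra_kernel_du H' c u y.1 * volterra_kernel_du H' c u y.2).

(* [Y] is a version of [\int_0^t g dZ^H]; the constant is [dH = d(H)]. *)
Definition is_rosenblatt_integral (R : realType) (d : measure_display)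
    (T : measurableType d) (P : probability T R) (B : R -> {RV P >-> R})
    (H c dH : R) (g : R -> R) (t : R) (Y : {RV P >-> R}) : Prop :=
  exists J : {RV P >-> R},
    is_double_wiener_ito B (rosenblatt_kernel H c g t) J /\
    {ae P, forall w, Y w = dH * J w}.

Record rosenblatt_process (R : realType) (d : measure_display)
    (T : measurableType d) (P : probability T R) (B : R -> {RV P >-> R})
    (H c dH : R) (Z : R -> {RV P >-> R}) : Prop := RosenblattProcess {
  rp_chaos : forall t : R, 0 <= t ->
    is_rosenblatt_integral B H c dH (cst 1) t (Z t) ;
  rp_norm : forall t : R, 0 <= t ->
    ('E_P[fun w => (Z t w ^+ 2)%R])%E = (t `^ (2 * H))%:E }.

Definition periodic_mean (R : realType) (p : nat) (mu : 'I_p -> R)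
    (phi : 'I_p -> R -> R) (t : R) : R := \sum_(i < p) mu i * phi i t.

(* Continuity of the paths together with [rou_sde] amounts to working with the
   continuous modification of [Z].  Joint measurability makes the pathwise
   integrals of [X] random variables without assuming [P] complete. *)
Record rosenblatt_OU (R : realType) (d : measure_display)
    (T : measurableType d) (P : probability T R) (B : R -> {RV P >-> R})
    (H c dH : R) (Z : R -> {RV P >-> R}) (alpha : R) (L : R -> R)
    (X : R -> {RV P >-> R}) : Prop := RosenblattOU {
  rou_measurable :
    measurable_fun ([set t : R | 0 <= t] `*` [set: T]) (fun z : R * T => X z.1 z.2) ;
  rou_paths : {ae P, forall w,
    {within `[0, +oo[, continuous (fun t : R => X t w)}} ;
  rou_sde : {ae P, forall w, forall t : R, 0 <= t ->
    X t w = \int[lebesgue_measure]_(s in `[0, t]) (L s - alpha * X s w)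
            + Z t w} ;
  rou_explicit : forall t : R, 0 <= t -> exists Y : {RV P >-> R},
    is_rosenblatt_integral B H c dH (fun s => expR (alpha * s)) t Y /\
    {ae P, forall w,
      X t w = expR (- alpha * t) *
        (\int[lebesgue_measure]_(s in `[0, t]) (expR (alpha * s) * L s)
         + Y w)} }.

(* [I] is a version of [\int_0^t g dX]. *)
Definition is_dX_integral (R : realType) (d : measure_display)
    (T : measurableType d) (P : probability T R) (B : R -> {RV P >-> R})
    (H c dH alpha : R) (L : R -> R) (X : R -> {RV P >-> R})
    (g : R -> R) (t : R) (I : {RV P >-> R}) : Prop :=
  exists Y : {RV P >-> R}, is_rosenblatt_integral B H c dH g t Y /\
    {ae P, forall w,
      I w = \int[lebesgue_measure]_(s in `[0, t])
              (g s * (L s - alpha * X s w)) + Y w}.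

Definition h_tilde (R : realType) (alpha : R) (L : R -> R) (t : R) : R :=
  expR (- alpha * t) *
  \int[lebesgue_measure]_(s in `]-oo, t]) (expR (alpha * s) * L s).

Definition dot01 (R : realType) (f g : R -> R) : R :=
  \int[lebesgue_measure]_(t in `[0, 1]) (f t * g t).

(* Membership in the span as elements of L^2([0,1]), i.e. up to null sets. *)
Definition in_span01 (R : realType) (p : nat) (phi : 'I_p -> R -> R)
    (f : R -> R) : Prop :=
  exists a : 'I_p -> R,
    ae_eq lebesgue_measure [set` `[0, 1]] f (fun t => \sum_(i < p) a i * phi i t).

(* [Ipsi n] stands for [\int_0^n psi dX] and [Iphi i n] for
   [\int_0^n phi_i dX]. *)
Definition alpha_bar (R : realType) (d : measure_display)
    (T : measurableType d) (X : R -> T -> R) (psi : R -> R)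
    (Ipsi : nat -> T -> R) (n : nat) (w : T) : R :=
  - (Ipsi n w /
     \int[lebesgue_measure]_(t in `[0, n%:R]) (psi t * X t w)).

Definition mu_bar (R : realType) (d : measure_display)
    (T : measurableType d) (p : nat) (X : R -> T -> R)
    (phi : 'I_p -> R -> R) (psi : R -> R) (Iphi : 'I_p -> nat -> T -> R)
    (Ipsi : nat -> T -> R) (i : 'I_p) (n : nat) (w : T) : R :=
  n%:R^-1 * (Iphi i n w + alpha_bar X psi Ipsi n w *
     \int[lebesgue_measure]_(t in `[0, n%:R]) (phi i t * X t w)).

Definition param_vector (R : realType) (p : nat) (alpha : R) (mu : 'I_p -> R) :
    'rV[R]_p.+1 :=
  \row_(i < p.+1) oapp mu alpha (unlift ord0 i).

(* Weak consistency: convergence in probability to the parameter vector. *)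
Definition consistent (R : realType) (d : measure_display)
    (T : measurableType d) (P : probability T R) (k : nat)
    (est : nat -> T -> 'rV[R]_k.+1) (theta : 'rV[R]_k.+1) : Prop :=
  forall eps : R, 0 < eps ->
    P [set w | eps <= `|est n w - theta|] @[n --> \oo] --> 0%E.

(* Main.v *)
(** For step functions, and by density for all kernels, the double integral satisfies
    [E (J f) (J g) = kappa ^ 2 * (<f, g> + <f, g \o swap>)] for a constant [kappa].
    The derivative of the Volterra kernel is nonnegative, so the kernel of
    [\int_0^t g dZ^H] is dominated by [sup |g|] times that of [Z^H_t]; hence [E (\int_0^t g dZ^H) ^ 2 <= sup |g| ^ 2 * t ^ (2 H)].
    For the same reason the centred process [U = X - E X] has nonnegative covariances, whence
    [E (\int_0^n g U) ^ 2 <= sup |g| ^ 2 * E (\int_0^n U) ^ 2], and the equation gives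
    [alpha * \int_0^n U = Z^H_n - U_n].  Both are [O (n ^ (2 H)) = o (n ^ 2)], so in probability
    [n^-1 \int_0^n g X --> <g, h>], where [h] is the periodic regime of [E X], and
    [n^-1 \int_0^n g dX --> <g, L> - alpha <g, h>].  The claim follows by inserting [psi], for
    which [<psi, L> = 0], and [phi_i], for which [<phi_i, L> = mu_i]. *)

Require Import Defs.
From HB Require Import structures.
From mathcomp Require Import all_boot all_order all_algebra.
From mathcomp Require Import all_classical all_reals all_analysis.
From mathcomp Require Import measurable_realfun zify ring lra.
Import Order.TTheory GRing.Theory Num.Theory.
Import numFieldNormedType.Exports.
Import HBNNSimple.
Local Open Scope classical_set_scope.
Local Open Scope ring_scope.

(** The normalisation of [Z] stands in for the L^2 norm of its kernel: when an integral is compared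
    with [Z t], the constants [dH], [c] and kappa occur on both sides and cancel. Independence of
    Brownian increments is given for events; the product rule for expectations is reached by turning
    indicators into general functions one factor at a time. As the diagonal is left out, an
    increment enters the product of two terms of step integrals at most twice, so means and
    variances determine the isometry. Time integrals of U are treated by Fubini on Lebesgue measure
    times [P]. The comparison with [g = 1] replaces an estimate of the covariance function of U,
    because for [g = 1] the equation expresses the integral by values at the end point. Equations
    for paths hold almost surely and [X] is controlled only at times [t >= 0]. Hence the cut-offs to
    [[0, N]], the transfers between almost surely equal functions, and a notion of convergence in
    probability that tolerates null sets. *)

(** * Square-integrable functions and their inner product *)

Section square_integrable.
Context {d : measure_display} {T : measurableType d} {R : realType}.
Context (mu : {measure set T -> \bar R}).

Definition sqintegrable (f : T -> R) : Prop :=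
  measurable_fun setT f /\ mu.-integrable setT (EFin \o (fun x => f x ^+ 2)).

Definition dotL2 (f g : T -> R) : R := \int[mu]_x (f x * g x).

Lemma integrable_mul_sq (f g : T -> R) : sqintegrable f -> sqintegrable g ->
  mu.-integrable setT (EFin \o (fun x => f x * g x)).
Proof.
move=> [mf if2] [mg ig2].
apply: (le_integrable measurableT _ _ (integrableD measurableT if2 ig2)).
  by apply/measurable_EFinP; exact: measurable_funM.
move=> x _ /=; rewrite lee_fin [leRHS] ger0_norm ?addr_ge0 ?sqr_ge0// normrM.
rewrite -[f x ^+ 2]real_normK ?num_real// -[g x ^+ 2]real_normK ?num_real//.
have := sqr_ge0 (`|f x| - `|g x|); have := normr_ge0 (f x); have := normr_ge0 (g x).
by nra.
Qed.

Lemma sqintegrableD (f g : T -> R) : sqintegrable f -> sqintegrable g ->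
  sqintegrable (fun x => f x + g x).
Proof.
move=> Lf Lg; split; first exact: measurable_funD Lf.1 Lg.1.
apply: (eq_integrable measurableT (fun x => (f x ^+ 2)%:E + 2%:E * (f x * g x)%:E + (g x ^+ 2)%:E)%E).
  by move=> x _ /=; rewrite -EFinM -!EFinD; congr EFin; ring.
apply: integrableD => //; last exact: Lg.2.
apply: integrableD => //; first exact: Lf.2.
by apply: integrableZl => //; exact: integrable_mul_sq.
Qed.

Lemma sqintegrableZ (a : R) (f : T -> R) : sqintegrable f ->
  sqintegrable (fun x => a * f x).
Proof.
move=> [mf if2]; split; first exact: measurable_funM.
apply: (eq_integrable measurableT (fun x => (a ^+ 2)%:E * (f x ^+ 2)%:E)%E).
  by move=> x _ /=; rewrite -EFinM exprMn.
exact: integrableZl.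
Qed.

Lemma sqintegrableB (f g : T -> R) : sqintegrable f -> sqintegrable g ->
  sqintegrable (fun x => f x - g x).
Proof.
move=> Lf Lg; have := sqintegrableD _ _ Lf (sqintegrableZ (-1) _ Lg).
by under eq_fun do rewrite mulN1r.
Qed.

Lemma sqintegrable0 : sqintegrable (fun=> 0).
Proof.
split=> //; apply: (eq_integrable measurableT (cst 0%E)); last exact: integrable0.
by move=> x _ /=; rewrite expr0n.
Qed.

Lemma sqintegrable_sum (I : Type) (r : seq I) (P : pred I) (f : I -> T -> R) :
  (forall i, P i -> sqintegrable (f i)) -> sqintegrable (fun x => \sum_(i <- r | P i) f i x).
Proof.
move=> Lf; elim: r => [|i r ih].
  by under eq_fun do rewrite big_nil; exact: sqintegrable0.
have [Pi|Pi] := boolP (P i); under eq_fun do rewrite big_cons ?Pi ?(negPf Pi).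
  exact: sqintegrableD (Lf _ Pi) ih.
exact: ih.
Qed.

Lemma dotL2C (f g : T -> R) : dotL2 f g = dotL2 g f.
Proof. by apply: eq_Rintegral => x _; rewrite mulrC. Qed.

Lemma dotL2Dl (f g h : T -> R) : sqintegrable f -> sqintegrable g -> sqintegrable h ->
  dotL2 (fun x => f x + g x) h = dotL2 f h + dotL2 g h.
Proof.
move=> Lf Lg Lh; rewrite /dotL2; under eq_Rintegral => x _ do rewrite mulrDl.
by rewrite RintegralD//; exact: integrable_mul_sq.
Qed.

Lemma dotL2Zl (a : R) (f h : T -> R) : sqintegrable f -> sqintegrable h ->
  dotL2 (fun x => a * f x) h = a * dotL2 f h.
Proof.
move=> Lf Lh; rewrite /dotL2; under eq_Rintegral => x _ do rewrite -mulrA.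
by rewrite RintegralZl//; exact: integrable_mul_sq.
Qed.

Lemma dotL2Bl (f g h : T -> R) : sqintegrable f -> sqintegrable g -> sqintegrable h ->
  dotL2 (fun x => f x - g x) h = dotL2 f h - dotL2 g h.
Proof.
move=> Lf Lg Lh; rewrite /dotL2; under eq_Rintegral => x _ do rewrite mulrBl.
by rewrite RintegralB//; exact: integrable_mul_sq.
Qed.

Lemma dotL2Br (f g h : T -> R) : sqintegrable f -> sqintegrable g -> sqintegrable h ->
  dotL2 h (fun x => f x - g x) = dotL2 h f - dotL2 h g.
Proof. by move=> Lf Lg Lh; rewrite dotL2C dotL2Bl// !(dotL2C h). Qed.

Lemma dotL2_suml (I : Type) (r : seq I) (P : pred I) (f : I -> T -> R) (h : T -> R) :
  (forall i, P i -> sqintegrable (f i)) -> sqintegrable h ->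
  dotL2 (fun x => \sum_(i <- r | P i) f i x) h = \sum_(i <- r | P i) dotL2 (f i) h.
Proof.
move=> Lf Lh; elim: r => [|i r ih].
  rewrite big_nil /dotL2; under eq_Rintegral => x _ do rewrite big_nil mul0r.
  by rewrite /Rintegral integral0.
have [Pi|Pi] := boolP (P i); rewrite big_cons ?Pi ?(negPf Pi); last first.
  by rewrite -ih; apply: eq_Rintegral => x _; rewrite big_cons (negPf Pi).
rewrite -ih -dotL2Dl//; [|exact: Lf|exact: sqintegrable_sum].
by apply: eq_Rintegral => x _; rewrite big_cons Pi.
Qed.

Lemma dotL2_ge0 (f : T -> R) : 0 <= dotL2 f f.
Proof. by apply: Rintegral_ge0 => x _; rewrite -expr2 sqr_ge0. Qed.

Lemma EFin_dotL2 (f g : T -> R) : sqintegrable f -> sqintegrable g ->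
  (dotL2 f g)%:E = (\int[mu]_x (f x * g x)%:E)%E.
Proof.
by move=> Lf Lg; rewrite fineK//; apply: integrable_fin_num => //; exact: integrable_mul_sq.
Qed.

Lemma dotL2_sq (f : T -> R) : sqintegrable f ->
  (\int[mu]_x (f x ^+ 2)%:E)%E = (dotL2 f f)%:E.
Proof. by move=> Lf; rewrite EFin_dotL2//; apply: eq_integral => x _; rewrite expr2. Qed.

(* AM-GM form, which avoids square roots. *)
Lemma dotL2_amgm (e : R) (f g : T -> R) : 0 < e -> sqintegrable f -> sqintegrable g ->
  2 * `|dotL2 f g| <= e * dotL2 f f + e^-1 * dotL2 g g.
Proof.
move=> e0 Lf Lg.
have Lef a : sqintegrable (fun x => a * f x) by exact: sqintegrableZ.
have Leg a : sqintegrable (fun x => a * g x) by exact: sqintegrableZ.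
have key a : 0 <= e ^+ 2 * dotL2 f f + a ^+ 2 * dotL2 g g + 2 * (e * a) * dotL2 f g.
  have := dotL2_ge0 (fun x => e * f x + a * g x).
  have Ls : sqintegrable (fun x => e * f x + a * g x) by exact: sqintegrableD.
  rewrite dotL2Dl// !dotL2Zl//.
  rewrite [dotL2 f _]dotL2C [dotL2 g _]dotL2C !dotL2Dl// !dotL2Zl//.
  by rewrite (dotL2C g f); move=> /le_trans; apply; rewrite le_eqVlt; apply/orP; left; apply/eqP; ring.
rewrite -(ler_pM2l e0) mulrDr [e * (e^-1 * _)]mulrA mulfV ?gt_eqF// mul1r [e * (e * _)]mulrA -expr2.
have := key 1; have := key (-1).
case: (ger0P (dotL2 f g)) => _; rewrite ?expr1n ?sqrrN ?expr1n; nra.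
Qed.

Lemma dotL2_CauchySchwarz (f g : T -> R) : sqintegrable f -> sqintegrable g ->
  dotL2 f g ^+ 2 <= dotL2 f f * dotL2 g g.
Proof.
move=> Lf Lg.
have := dotL2_ge0 f; rewrite le_eqVlt => /predU1P[f0|f0].
  suff -> : dotL2 f g = 0 by rewrite expr0n/= mulr_ge0// dotL2_ge0.
  apply/eqP; rewrite -normr_eq0 eq_le normr_ge0 andbT; apply/ler_addgt0Pl => e e0.
  have g0 := dotL2_ge0 g.
  have d0 : 0 < dotL2 g g + 1 by lra.
  (* For [f] of norm 0 the AM-GM bound holds with any weight on [f]. This weight brings the
     remaining term below [e]; the [+ 1] guards against a vanishing [g]. *)
  have t0 : 0 < (dotL2 g g + 1) / e by rewrite divr_gt0.
  have := dotL2_amgm _ _ _ t0 Lf Lg; rewrite -f0 mulr0 add0r invf_div => h.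
  rewrite addr0; have : e / (dotL2 g g + 1) * dotL2 g g <= e.
    rewrite mulrAC ler_pdivrMr// ler_pM2l//; lra.
  by have := normr_ge0 (dotL2 f g); lra.
have g0 := dotL2_ge0 g.
(* Up to the factor [a], [w] is the component of [g] orthogonal to [f]; its square norm is
   [a * (a * dotL2 g g - b ^+ 2)]. *)
pose a := dotL2 f f; pose b := dotL2 f g; pose w x := a * g x - b * f x.
have Lw : sqintegrable w by apply: sqintegrableB; exact: sqintegrableZ.
have wE h : sqintegrable h -> dotL2 w h = a * dotL2 g h - b * dotL2 f h.
  by move=> Lh; rewrite dotL2Bl ?dotL2Zl//; exact: sqintegrableZ.
have := dotL2_ge0 w; rewrite wE// [dotL2 g w]dotL2C [dotL2 f w]dotL2C !wE//.
rewrite (dotL2C g f) -/a -/b => h.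
rewrite -subr_ge0 -(pmulr_rge0 _ f0); apply: le_trans h _.
by rewrite le_eqVlt; apply/orP; left; apply/eqP; rewrite -/a; ring.
Qed.

Lemma sqintegrable_lty (f : T -> R) : measurable_fun setT f ->
  (\int[mu]_x (f x ^+ 2)%:E < +oo)%E -> sqintegrable f.
Proof.
move=> mf foo; split => //; apply/integrableP; split.
  by apply/measurable_EFinP; exact: measurable_funX.
by under eq_integral do rewrite /= ger0_norm ?sqr_ge0//.
Qed.

Lemma le_sqintegrable (f g : T -> R) : measurable_fun setT f ->
  (forall x, `|f x| <= `|g x|) -> sqintegrable g -> sqintegrable f.
Proof.
move=> mf fg [mg ig]; split => //; apply: (le_integrable measurableT _ _ ig).
  by apply/measurable_EFinP; exact: measurable_funX.
by move=> x _ /=; rewrite lee_fin !ger0_norm ?sqr_ge0// -real_normK ?num_real// -[leRHS]real_normK ?num_real// ler_pXn2r ?nnegrE.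
Qed.

Lemma ae_dotL2 (f f' g g' : T -> R) : sqintegrable f -> sqintegrable f' ->
  sqintegrable g -> sqintegrable g' ->
  {ae mu, forall x, f x = f' x} -> {ae mu, forall x, g x = g' x} ->
  dotL2 f g = dotL2 f' g'.
Proof.
move=> [mf _] [mf' _] [mg _] [mg' _] ff' gg'; congr fine; apply: ae_eq_integral => //.
- by apply/measurable_EFinP; exact: measurable_funM.
- by apply/measurable_EFinP; exact: measurable_funM.
- by move: ff' gg'; apply: filterS2 => x -> ->.
Qed.

Lemma ae_sqintegrable (f g : T -> R) : sqintegrable f -> measurable_fun setT g ->
  {ae mu, forall x, f x = g x} -> sqintegrable g.
Proof.
move=> [mf if2] mg fg; apply: sqintegrable_lty => //.
rewrite (ae_eq_integral (EFin \o (fun x => f x ^+ 2)))//.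
- by have := integrable_lty measurableT if2.
- by apply/measurable_EFinP; exact: measurable_funX.
- by apply/measurable_EFinP; exact: measurable_funX.
- by move: fg; apply: filterS => x /= ->.
Qed.

Lemma ae_filterS (A D : T -> Prop) : (forall x, A x -> D x) ->
  {ae mu, forall x, A x} -> {ae mu, forall x, D x}.
Proof. by move=> AD; apply: filterS. Qed.

Definition cvgL2 (u : nat -> T -> R) (f : T -> R) : Prop :=
  (\int[mu]_x ((u n x - f x) ^+ 2)%:E)%E @[n --> \oo] --> 0%E.

(** An extended integral that tends to 0 is finite from some rank on. For such an [n], [f] is the
    difference of [u n] and [u n - f], both square integrable. *)
Lemma cvgL2_sqintegrable (u : nat -> T -> R) (f : T -> R) :
  measurable_fun setT f -> (forall n, sqintegrable (u n)) -> cvgL2 u f ->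
  sqintegrable f.
Proof.
move=> mf Lu uf.
have [[n _ /(_ n (leqnn n)) /= h] _] := (fine_cvgP _ _).1 uf.
have Lunf : sqintegrable (fun x => u n x - f x).
  apply: sqintegrable_lty; last by move: h; rewrite fin_numElt => /andP[].
  by apply: measurable_funB => //; exact: (Lu n).1.
have := sqintegrableB _ _ (Lu n) Lunf; congr sqintegrable.
by apply/funext => x; rewrite opprB addrCA subrr addr0.
Qed.

Lemma cvgL2_dotL2_sub (u : nat -> T -> R) (f : T -> R) :
  measurable_fun setT f -> (forall n, sqintegrable (u n)) -> cvgL2 u f ->
  dotL2 (fun x => u n x - f x) (fun x => u n x - f x) @[n --> \oo] --> 0.
Proof.
move=> mf Lu uf; have Lf := cvgL2_sqintegrable _ _ mf Lu uf.
move: uf; rewrite /cvgL2.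
under eq_fun => n do rewrite (dotL2_sq _ (sqintegrableB _ _ (Lu n) Lf)).
by move=> /fine_cvgP[_].
Qed.

Lemma cvgL2_dotL2 (u v : nat -> T -> R) (f g : T -> R) :
  measurable_fun setT f -> measurable_fun setT g ->
  (forall n, sqintegrable (u n)) -> (forall n, sqintegrable (v n)) ->
  cvgL2 u f -> cvgL2 v g -> dotL2 (u n) (v n) @[n --> \oo] --> dotL2 f g.
Proof.
move=> mf mg Lu Lv uf vg.
have Lf := cvgL2_sqintegrable _ _ mf Lu uf; have Lg := cvgL2_sqintegrable _ _ mg Lv vg.
have cu := cvgL2_dotL2_sub _ _ mf Lu uf; have cv := cvgL2_dotL2_sub _ _ mg Lv vg.
pose a n := dotL2 (fun x => u n x - f x) (fun x => u n x - f x).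
pose b n := dotL2 (fun x => v n x - g x) (fun x => v n x - g x).
apply/cvgrPdist_le => e e0.
(* The weight [t] makes [t * (dotL2 f f + dotL2 g g)] at most [e], whereas its inverse multiplies
   only the vanishing quantities [a n] and [b n]. *)
pose M := dotL2 f f + dotL2 g g + 1.
have M0 : 0 < M by rewrite /M ltr_wpDl// addr_ge0// dotL2_ge0.
pose t := e / M.
have t0 : 0 < t by rewrite divr_gt0.
have tM : t * M = e by rewrite /t divfK ?gt_eqF.
have small (c : nat -> R) (eps : R) : c @ \oo --> 0 -> 0 < eps -> \forall n \near \oo, c n <= eps.
  move=> c0 eps0; move/cvgr0_norm_le : c0 => /(_ _ eps0).
  by apply: filterS => k; exact: le_trans (ler_norm _).
near=> n.
have Luf : sqintegrable (fun x => u n x - f x) by exact: sqintegrableB.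
have Lvg : sqintegrable (fun x => v n x - g x) by exact: sqintegrableB.
have -> : dotL2 f g - dotL2 (u n) (v n) = - (dotL2 (fun x => u n x - f x) (fun x => v n x - g x)
   + dotL2 f (fun x => v n x - g x) + dotL2 (fun x => u n x - f x) g).
  by rewrite !dotL2Bl ?dotL2Br//; ring.
rewrite normrN.
have h1 := dotL2_amgm _ _ _ ltr01 Luf Lvg.
have h2 := dotL2_amgm _ _ _ t0 Lf Lvg.
have h3 := dotL2_amgm _ _ _ t0 Lg Luf.
rewrite -/(a n) -/(b n) in h1 h2 h3.
have an : a n <= e / 4 by near: n; exact: small cu (divr_gt0 e0 _).
have bn : b n <= e / 4 by near: n; exact: small cv (divr_gt0 e0 _).
have an' : t^-1 * a n <= e / 4.
  by rewrite ler_pdivrMl//; near: n; exact: small cu (mulr_gt0 t0 (divr_gt0 e0 _)).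
have bn' : t^-1 * b n <= e / 4.
  by rewrite ler_pdivrMl//; near: n; exact: small cv (mulr_gt0 t0 (divr_gt0 e0 _)).
apply: (le_trans (ler_normD _ _)); apply: (le_trans (lerD (ler_normD _ _) (lexx _))).
rewrite [dotL2 (fun x => u n x - f x) g]dotL2C.
rewrite invr1 !mul1r in h1.
have : t * dotL2 f f + t * dotL2 g g <= e by rewrite -mulrDr -tM ler_pM2l// /M lerDl.
lra.
Unshelve. all: by end_near. Qed.

End square_integrable.

(** The hypothesis says that [nu] is the image under [xi] of the measure with density [w]; it is
    tested on sets and extended through increasing simple functions. It serves twice: with the
    product of the other factors as [w], to extend independence, and with a normal density, to
    compute moments of increments. *)
Lemma ge0_integral_density {d1 d2 : measure_display} {T1 : measurableType d1}
    {T2 : measurableType d2} {R : realType} (mu : {measure set T1 -> \bar R})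
    (nu : {measure set T2 -> \bar R}) (xi : T1 -> T2) (w : T1 -> R) (f : T2 -> \bar R) :
  measurable_fun setT xi -> measurable_fun setT w -> (forall x, 0 <= w x) ->
  (forall A, measurable A -> nu A = \int[mu]_x (\1_A (xi x) * w x)%:E)%E ->
  measurable_fun setT f -> (forall y, (0 <= f y)%E) ->
  (\int[nu]_y f y = \int[mu]_x (f (xi x) * (w x)%:E))%E.
Proof.
move=> mxi mw w0 nuE mf f0; pose h := nnsfun_approx measurableT mf.
have mhxi n : measurable_fun setT (fun x => (h n (xi x))%:E).
  by apply/measurable_EFinP; apply: measurableT_comp.
have -> : (\int[nu]_y f y = limn (fun n => \int[nu]_y (h n y)%:E))%E.
  rewrite -monotone_convergence//.
  - apply: eq_integral => y _; apply/esym/cvg_lim => //.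
    exact: cvg_nnsfun_approx.
  - by move=> n; apply/measurable_EFinP.
  - by move=> n y _; rewrite lee_fin.
  - by move=> y _ a b ab; rewrite lee_fin; exact/lefP/nd_nnsfun_approx.
have -> : (\int[mu]_x (f (xi x) * (w x)%:E) =
           limn (fun n => \int[mu]_x ((h n (xi x))%:E * (w x)%:E)))%E.
  rewrite -monotone_convergence//.
  - apply: eq_integral => x _; apply/esym/cvg_lim => //.
    by apply: cvgeZr => //; exact: cvg_nnsfun_approx.
  - by move=> n; apply: emeasurable_funM => //; exact/measurable_EFinP.
  - by move=> n y _; rewrite -EFinM lee_fin mulr_ge0.
  - move=> y _ a b ab; rewrite lee_wpmul2r ?lee_fin//.
    exact/lefP/nd_nnsfun_approx.
congr (limn _); apply/funext => n.
have hE y : (h n y)%:E = (\sum_(z \in range (h n)) (z * \1_(h n @^-1` [set z]) y)%:E)%E.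
  by rewrite fimfunE -fsumEFin.
under eq_integral do rewrite hE.
rewrite ge0_integral_fsum//; last 2 first.
- by move=> z; apply/measurable_EFinP; exact: measurable_funM.
- by move=> z y _; exact: nnfun_muleindic_ge0.
have mind z : measurable_fun setT (fun x => \1_(h n @^-1` [set z]) (xi x) : R).
  have mA : measurable_fun setT (\1_(h n @^-1` [set z]) : T2 -> R) by [].
  exact: measurableT_comp mA mxi.
transitivity (\int[mu]_x (\sum_(z \in range (h n))
    (z * \1_(h n @^-1` [set z]) (xi x))%:E * (w x)%:E))%E; last first.
  apply: eq_integral => x _; rewrite hE ge0_mule_fsuml// => z.
  exact: nnfun_muleindic_ge0.
rewrite ge0_integral_fsum//; last 2 first.
- move=> z; apply: emeasurable_funM; apply/measurable_EFinP => //.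
  exact: measurable_funM.
- by move=> z y _; apply: mule_ge0; [exact: nnfun_muleindic_ge0|rewrite lee_fin].
apply: eq_fsbigr => z; rewrite inE => -[y _ hyz].
have z0 : 0 <= z by rewrite -hyz.
under eq_integral do rewrite EFinM.
rewrite ge0_integralZl//; last by apply/measurable_EFinP.
rewrite integral_indic// setIT nuE// -ge0_integralZl//.
- by apply: eq_integral => x _; rewrite -!EFinM mulrA.
- by apply/measurable_EFinP; exact: measurable_funM.
- by move=> x _; rewrite lee_fin mulr_ge0.
Qed.

(** * Expectation of a product of independent variables *)

Section product_expectation.
Context {d : measure_display} {T : measurableType d} {R : realType}.
Context (P : probability T R) (n : nat) (xi : nat -> {mfun T >-> R}).
Context (xi_indep : forall A : nat -> set R, (forall i, measurable (A i)) ->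
  P (\bigcap_(i in `I_n) [set w | A i (xi i w)]) = (\prod_(i < n) P [set w | A i (xi i w)])%E).

Let subst1 (G : nat -> R -> R) (k : nat) (g : R -> R) (i : nat) : R -> R :=
  if i == k then g else G i.

Let prod_subst1 (G : nat -> R -> R) (k : 'I_n) (g : R -> R) (x : T) :
  \prod_(i < n) subst1 G k g i (xi i x) =
  g (xi k x) * \prod_(i < n | i != k) G i (xi i x).
Proof.
rewrite (bigD1 k)//= /subst1 eqxx; congr (_ * _).
by apply: eq_bigr => i ik; rewrite (negPf (ik : (i != k :> nat))).
Qed.

Let prod_int_subst1 (G : nat -> R -> R) (k : 'I_n) (g : R -> R) :
  \prod_(i < n) (\int[P]_x subst1 G k g i (xi i x)) =
  (\int[P]_x g (xi k x)) * \prod_(i < n | i != k) \int[P]_x G i (xi i x).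
Proof.
rewrite (bigD1 k)//= /subst1 eqxx; congr (_ * _).
by apply: eq_bigr => i ik; rewrite (negPf (ik : (i != k :> nat))).
Qed.

Let subst1_id (G : nat -> R -> R) (k : nat) : subst1 G k (G k) = G.
Proof. by apply/funext => i; rewrite /subst1; case: eqP => [->|]. Qed.

Let measurable_xi (G : nat -> R -> R) i : measurable_fun setT (G i) ->
  measurable_fun setT (fun x => G i (xi i x)).
Proof. by move=> mG; exact: measurableT_comp. Qed.

(** Induction on the number [k] of leading factors that may be arbitrary, the others being
    indicators; [k = 0] is independence itself. For the step, freeze all factors but the [k]-th. On
    indicators of sets [A] in that place the induction hypothesis gives a constant multiple of the
    law of [xi k], and [ge0_integral_density] passes from [A] to [G k]. *)
Lemma ge0_expectation_prod (G : nat -> R -> R) :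
  (forall i, measurable_fun setT (G i)) -> (forall i y, 0 <= G i y) ->
  (forall i, P.-integrable setT (fun x => (G i (xi i x))%:E)) ->
  (\int[P]_x (\prod_(i < n) G i (xi i x))%:E)%E =
  (\prod_(i < n) \int[P]_x G i (xi i x))%:E.
Proof.
suff H k : (k <= n)%N -> forall G : nat -> R -> R,
  (forall i, measurable_fun setT (G i)) -> (forall i y, 0 <= G i y) ->
  (forall i, P.-integrable setT (fun x => (G i (xi i x))%:E)) ->
  (forall i, (k <= i)%N -> exists2 A, measurable A & G i = \1_A) ->
  (\int[P]_x (\prod_(i < n) G i (xi i x))%:E)%E =
  (\prod_(i < n) \int[P]_x G i (xi i x))%:E.
  move=> mG G0 iG.
  (* Beyond [n] the factors do not occur in the product; indicators there make the requirement of
     the induction true at [k = n]. *)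
  pose G' i := if (i < n)%N then G i else \1_setT.
  have := H n (leqnn n) G'.
  under eq_integral do under eq_bigr do rewrite /G' ltn_ord.
  under [in X in _ = X%:E]eq_bigr do rewrite /G' ltn_ord.
  apply => [i|i y|i|i ni]; rewrite /G'; first by case: ifP.
  - by case: ifP.
  - case: ifP => // _; rewrite (_ : (fun _ => _) = EFin \o cst 1)//.
      exact: finite_measure_integrable_cst.
    by apply/funext => x; rewrite indicE in_setT.
  - by rewrite ltnNge ni; exists setT.
elim: k => [_ {}G mG G0 iG ind|k ih kn {}G mG G0 iG ind].
  have /choice[A HA] i : exists A, measurable A /\ G i = \1_A.
    by have [A mA ->] := ind i (leq0n i); exists A.
  have mA i := (HA i).1; have GE i := (HA i).2.
  have mAxi i : measurable [set w | A i (xi i w)].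
    by rewrite -[X in measurable X]setTI; exact: (measurable_funP (xi i)).
  have -> : (\int[P]_x (\prod_(i < n) G i (xi i x))%:E)%E =
            (\int[P]_x (\1_(\bigcap_(i in `I_n) [set w | A i (xi i w)]) x)%:E)%E.
    apply: eq_integral => x _; congr EFin; rewrite indicE.
    have [/set_mem h|h] := boolP (x \in _).
      by apply: big1 => i _; rewrite GE indicE mem_set//; apply: h => /=.
    have [i Hi] : exists i : 'I_n, ~ A i (xi i x).
      apply: contrapT => /forallNP h'; move/negP: h; apply; rewrite inE => i /= ni.
      by have := h' (Ordinal ni) => /contrapT.
    by rewrite (bigD1 i)//= GE indicE memNset// mul0r.
  rewrite integral_indic//; last first.
    by apply: bigcap_measurableType => i _; exact: mAxi.
  rewrite setIT; transitivity (\prod_(i < n) P [set w | A i (xi i w)])%E; first exact: xi_indep.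
  rewrite (eq_bigr (fun i : 'I_n => (\int[P]_x G i (xi i x))%:E)) => [|i _].
    by rewrite prodEFin.
  rewrite GE /Rintegral (_ : (fun x => (\1_(A i) (xi i x))%:E) =
     (fun x => (\1_[set w | A i (xi i w)] x)%:E))//.
  by rewrite integral_indic// setIT fineK// fin_num_measure.
pose ko := Ordinal kn.
pose w x := \prod_(i < n | i != ko) G i (xi i x).
have w0 x : 0 <= w x by apply: prodr_ge0.
have mw : measurable_fun setT w.
  rewrite (_ : w = fun x => \prod_(i < n) (if i != ko then G i (xi i x) else 1)).
    by apply: measurable_prod => i _; case: (i != ko) => //; exact: measurable_xi.
  by apply/funext => x; rewrite /w big_mkcond.
pose c := \prod_(i < n | i != ko) \int[P]_x G i (xi i x).
have c0 : 0 <= c by apply: prodr_ge0 => i _; exact: Rintegral_ge0.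
(* The law of [xi k] times [c], the product of the expectations of the other factors. *)
pose nu := mscale (NngNum c0) (distribution P (xi k)).
have nuE A : measurable A -> nu A = (\int[P]_x (\1_A (xi k x) * w x)%:E)%E.
  move=> mA; have := ih (ltnW kn) (subst1 G k \1_A).
  under eq_integral do rewrite (prod_subst1 G ko).
  rewrite (prod_int_subst1 G ko) => ->.
  - rewrite /nu /mscale/= EFinM muleC; congr (_ * _)%E.
    rewrite fineK.
      rewrite (_ : (fun x => (\1_A (xi k x))%:E) =
         (fun x => (\1_[set w | A (xi k w)] x)%:E))// integral_indic ?setIT//.
      by rewrite -[X in measurable X]setTI; exact: (measurable_funP (xi k)).
    apply: integrable_fin_num => //.
    rewrite (_ : (fun x => (\1_A (xi k x))%:E) =
         (fun x => (\1_[set w | A (xi k w)] x)%:E))//; apply: integrable_indic.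
    by rewrite -[X in measurable X]setTI; exact: (measurable_funP (xi k)).
  - by move=> i; rewrite /subst1; case: ifP.
  - by move=> i y; rewrite /subst1; case: ifP.
  - move=> i; rewrite /subst1; case: eqP => // ->.
    rewrite (_ : (fun x => (\1_A (xi k x))%:E) =
         (fun x => (\1_[set w | A (xi k w)] x)%:E))//; apply: integrable_indic.
    by rewrite -[X in measurable X]setTI; exact: (measurable_funP (xi k)).
  - move=> i ki; rewrite /subst1; case: eqP => [_|/eqP ik]; first by exists A.
    by apply: ind; rewrite ltn_neqAle eq_sym ik.
have mGk : measurable_fun setT (EFin \o G k) by apply/measurable_EFinP.
have := ge0_integral_density P nu (xi k) w (EFin \o G k) (measurable_funP (xi k)) mw w0 nuE mGk
  (fun y => G0 k y : (0 <= (EFin \o G k) y)%E).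
rewrite ge0_integral_mscale//; last by move=> y _; rewrite lee_fin.
have -> : (\int[distribution P (xi k)]_y (EFin \o G k) y = \int[P]_x (G k (xi k x))%:E)%E.
  by apply: ge0_integral_distribution => // y; rewrite lee_fin.
rewrite /= -/c => h.
rewrite -[in LHS](subst1_id G k) -[in RHS](subst1_id G k).
under eq_integral do rewrite (prod_subst1 G ko) -/(w _) EFinM.
rewrite -h (prod_int_subst1 G ko) muleC EFinM fineK//.
exact: integrable_fin_num.
Qed.

Lemma integrable_expectation_prod (G : nat -> R -> R) :
  (forall i, measurable_fun setT (G i)) ->
  (forall i, P.-integrable setT (fun x => (G i (xi i x))%:E)) ->
  P.-integrable setT (fun x => (\prod_(i < n) G i (xi i x))%:E).
Proof.
move=> mG iG; apply/integrableP; split.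
  by apply/measurable_EFinP; apply: measurable_prod => i _; exact: measurable_xi.
under eq_integral do rewrite /= normr_prod.
rewrite (ge0_expectation_prod (fun i y => `|G i y|)) ?ltry// => i.
  exact: measurableT_comp.
exact: (integrable_norm (iG i)).
Qed.

(** The same induction, where [k] now bounds the indices of the factors that may change sign. The
    last of them is split into positive and negative part, and the induction hypothesis applies to
    each. *)
Lemma expectation_prod (G : nat -> R -> R) :
  (forall i, measurable_fun setT (G i)) ->
  (forall i, P.-integrable setT (fun x => (G i (xi i x))%:E)) ->
  \int[P]_x (\prod_(i < n) G i (xi i x)) = \prod_(i < n) \int[P]_x G i (xi i x).
Proof.
suff H k : (k <= n)%N -> forall G : nat -> R -> R,
  (forall i, measurable_fun setT (G i)) ->
  (forall i, P.-integrable setT (fun x => (G i (xi i x))%:E)) ->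
  (forall i, (k <= i)%N -> forall y, 0 <= G i y) ->
  \int[P]_x (\prod_(i < n) G i (xi i x)) = \prod_(i < n) \int[P]_x G i (xi i x).
  move=> mG iG.
  pose G' i := if (i < n)%N then G i else cst 1.
  have := H n (leqnn n) G'.
  under eq_Rintegral do under eq_bigr do rewrite /G' ltn_ord.
  under [in X in _ = X]eq_bigr do rewrite /G' ltn_ord.
  apply => [i|i|i ni]; rewrite /G'; first by case: ifP.
  - by case: ifP => // _; exact: finite_measure_integrable_cst.
  - by rewrite ltnNge ni.
elim: k => [_ {}G mG iG G0|k ih kn {}G mG iG G0].
  by rewrite /Rintegral ge0_expectation_prod// => i y; exact: G0.
pose ko := Ordinal kn.
pose p y := Num.max (G k y) 0; pose m y := Num.max (- G k y) 0.
have pm y : G k y = p y - m y.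
  by rewrite /p /m; case: (leP (G k y) 0); case: (leP (- G k y) 0) => *; lra.
have mp : measurable_fun setT p by exact: measurable_maxr.
have mm : measurable_fun setT m.
  by apply: measurable_maxr => //; exact: measurableT_comp.
have ip : P.-integrable setT (fun x => (p (xi k x))%:E).
  apply: le_integrable (iG k) => //; first by apply/measurable_EFinP; exact: measurableT_comp.
  by move=> x _ /=; rewrite lee_fin /p; case: (leP (G k (xi k x)) 0) => ?; rewrite ?normr0.
have im : P.-integrable setT (fun x => (m (xi k x))%:E).
  apply: le_integrable (iG k) => //; first by apply/measurable_EFinP; exact: measurableT_comp.
  by move=> x _ /=; rewrite lee_fin /m; case: (leP (- G k (xi k x)) 0) => ?; rewrite ?normr0 ?normrN.
have step g : measurable_fun setT g -> P.-integrable setT (fun x => (g (xi k x))%:E) ->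
    (forall y, 0 <= g y) ->
    P.-integrable setT (fun x => (g (xi k x) * \prod_(i < n | i != ko) G i (xi i x))%:E) /\
    \int[P]_x (g (xi k x) * \prod_(i < n | i != ko) G i (xi i x)) =
    (\int[P]_x g (xi k x)) * \prod_(i < n | i != ko) \int[P]_x G i (xi i x).
  move=> mg ig g0.
  have ms i : measurable_fun setT (subst1 G k g i) by rewrite /subst1; case: ifP.
  have iS i : P.-integrable setT (fun x => (subst1 G k g i (xi i x))%:E).
    by rewrite /subst1; case: eqP => // ->.
  split.
    have := integrable_expectation_prod _ ms iS.
    by under eq_fun do rewrite (prod_subst1 G ko).
  rewrite -(prod_int_subst1 G ko) -(ih (ltnW kn))//.
    by apply: eq_Rintegral => x _; rewrite (prod_subst1 G ko).
  move=> i ki y; rewrite /subst1; case: eqP => // /eqP ik.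
  by apply: G0; rewrite ltn_neqAle eq_sym ik.
have [ip' ep] := step p mp ip (fun y => ltac:(by rewrite /p le_max lexx orbT)).
have [im' em] := step m mm im (fun y => ltac:(by rewrite /m le_max lexx orbT)).
rewrite -[in LHS](subst1_id G k) -[in RHS](subst1_id G k).
rewrite (prod_int_subst1 G ko).
under eq_Rintegral do rewrite (prod_subst1 G ko) pm mulrBl.
rewrite RintegralB// ep em -mulrBl; congr (_ * _).
by under [RHS]eq_Rintegral do rewrite pm; rewrite RintegralB.
Qed.

End product_expectation.

(** * Second moments of centred normal laws *)

Section normal_moments.
Context {R : realType}.
Local Notation mu := (@lebesgue_measure R).

(** With [z = x ^+ 2 / s ^+ 2] the exponentials are exp (- z / 2) and exp (- z / 8), and the claim
    becomes z exp (- 3 z / 8) <= 4, which follows from exp y >= 1 + y. Doubling the standard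
    deviation gives a dominating function that is again a multiple of a probability density, so the
    second moment is finite. *)
Lemma normal_pdf_sq_le (s x : R) : 0 < s ->
  x ^+ 2 * normal_pdf 0 s x <=
  4 * s ^+ 2 * normal_peak s / normal_peak (2 * s) * normal_pdf 0 (2 * s) x.
Proof.
move=> s0; have s2 : 0 < 2 * s by lra.
rewrite !normal_pdfE ?gt_eqF//.
have p0 := normal_peak_gt0 (lt0r_neq0 s0); have p20 := normal_peak_gt0 (lt0r_neq0 s2).
set a := normal_peak s in p0 *; set b := normal_peak (2 * s) in p20 *.
have -> : 4 * s ^+ 2 * a / b * (b * normal_fun 0 (2 * s) x) =
  a * (4 * s ^+ 2 * normal_fun 0 (2 * s) x) by field; rewrite gt_eqF.
rewrite mulrCA ler_pM2l//.
rewrite /normal_fun !subr0; set z := x ^+ 2 / s ^+ 2.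
have z0 : 0 <= z by rewrite divr_ge0 ?sqr_ge0.
have ss0 : s ^+ 2 != 0 by rewrite sqrf_eq0 gt_eqF.
have -> : x ^+ 2 = s ^+ 2 * z by rewrite /z mulrC divfK.
rewrite -(mulrA (s ^+ 2)) (mulrC 4) -(mulrA (s ^+ 2) 4); apply: ler_wpM2l; first exact: sqr_ge0.
have -> : - (s ^+ 2 * z) / (s ^+ 2 *+ 2) = - (z / 8) + (- (3 / 8 * z)).
  by rewrite -mulr_natr; field; rewrite gt_eqF.
have -> : - (s ^+ 2 * z) / ((2 * s) ^+ 2 *+ 2) = - (z / 8).
  by rewrite -mulr_natr; field; rewrite gt_eqF.
rewrite expRD mulrCA [4 * _]mulrC ler_pM2l ?expR_gt0//.
have := expR_ge1Dx (3 / 8 * z); rewrite expRN => h.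
by rewrite ler_pdivrMr ?expR_gt0//; lra.
Qed.

(* Equal to [1]; the value is not needed, as it cancels when second moments are compared. *)
Definition normal_var : R := fine (\int[mu]_y (y ^+ 2 * normal_pdf 0 1 y)%:E)%E.

Lemma integral_sq_normal_pdf_lty (s : R) : 0 < s ->
  (\int[mu]_y (y ^+ 2 * normal_pdf 0 s y)%:E < +oo)%E.
Proof.
move=> s0; have s2 : 0 < 2 * s by lra.
set c := 4 * s ^+ 2 * normal_peak s / normal_peak (2 * s).
have c0 : 0 <= c.
  rewrite /c; apply: divr_ge0; last exact: normal_peak_ge0.
  by apply: mulr_ge0; [apply: mulr_ge0 => //; exact: sqr_ge0|exact: normal_peak_ge0].
apply: (@le_lt_trans _ _ (\int[mu]_y (c%:E * (normal_pdf 0 (2 * s) y)%:E)))%E.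
  apply: ge0_le_integral => //.
  - by move=> x _; rewrite lee_fin mulr_ge0 ?sqr_ge0 ?normal_pdf_ge0.
  - apply/measurable_EFinP; apply: measurable_funM; last exact: measurable_normal_pdf.
    exact: measurable_funX.
  - apply/measurable_EFinP; apply: measurable_funM => //; exact: measurable_normal_pdf.
  - by move=> x _; rewrite -EFinM lee_fin; exact: normal_pdf_sq_le.
rewrite ge0_integralZl//; last 2 first.
- by apply/measurable_EFinP; exact: measurable_normal_pdf.
- by move=> x _; rewrite lee_fin normal_pdf_ge0.
by rewrite integral_normal_pdf mule1 ltry.
Qed.

Lemma integral_sq_normal_pdf (s : R) : 0 < s ->
  (\int[mu]_y (y ^+ 2 * normal_pdf 0 s y)%:E)%E = (normal_var * s ^+ 2)%:E.
Proof.
move=> s0; have sn0 : s != 0 by rewrite gt_eqF.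
have s20 : s ^+ 2 != 0 by rewrite sqrf_eq0.
have F'E : derive1 (fun x : R => x / s) = cst s^-1.
  by apply/funext => x; rewrite derive1E deriveM// derive_cst scaler0 add0r derive_id scaler1.
rewrite /normal_var mulrC EFinM fineK; last first.
  rewrite ge0_fin_numE ?integral_sq_normal_pdf_lty//.
  by apply: integral_ge0 => x _; rewrite lee_fin mulr_ge0 ?sqr_ge0 ?normal_pdf_ge0.
rewrite [X in _ = (_ * X)%E](@increasing_ge0_integration_by_substitutionT _ (fun x : R => x / s)); first last.
- by move=> x; rewrite mulr_ge0 ?sqr_ge0 ?normal_pdf_ge0.
- move=> x; apply: cvgM; first exact: exprn_continuous.
  exact: continuous_normal_pdf.
- by apply/gt0_cvgMly; rewrite ?invr_gt0//; exact: cvg_id.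
- by apply/gt0_cvgMlNy; rewrite ?invr_gt0//; exact: cvg_id.
- by [].
- by rewrite F'E; exact: is_cvg_cst.
- by rewrite F'E; exact: is_cvg_cst.
- by rewrite F'E => ?; exact: cvg_cst.
- by move=> x y xy; rewrite ltr_pM2r ?invr_gt0.
rewrite -ge0_integralZl//; first last.
- by rewrite lee_fin sqr_ge0.
- move=> x _; rewrite F'E lee_fin; apply: mulr_ge0; last by rewrite invr_ge0 ltW.
  by apply: mulr_ge0; [exact: sqr_ge0|exact: normal_pdf_ge0].
- apply/measurable_EFinP; rewrite F'E; apply: measurable_funM => //.
  apply: measurableT_comp => //; last exact: measurable_funM.
  apply: measurable_funM; last exact: measurable_normal_pdf.
  exact: measurable_funX.
apply: eq_integral => x _; rewrite F'E -EFinM; congr EFin; rewrite !fctE /=.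
rewrite !normal_pdfE ?oner_neq0// /normal_fun !subr0 /normal_peak !expr1n.
have -> : Num.sqrt (s ^+ 2 * pi *+ 2) = s * Num.sqrt (1 * pi *+ 2).
  by rewrite mul1r -mulrnAr sqrtrM ?sqr_ge0// sqrtr_sqr gtr0_norm.
have -> : - (x / s) ^+ 2 / (1 *+ 2) = - x ^+ 2 / (s ^+ 2 *+ 2).
  by rewrite -(mulr_natr (s ^+ 2)); field; rewrite sn0.
have pi0 : Num.sqrt (1 * pi *+ 2) != 0 :> R by rewrite gt_eqF// sqrtr_gt0 mul1r pmulrn_lgt0// pi_gt0.
by field; rewrite pi0 sn0.
Qed.

Lemma normal_pdf_even (s x : R) : s != 0 -> normal_pdf 0 s (- x) = normal_pdf 0 s x.
Proof. by move=> s0; rewrite !normal_pdfE// /normal_fun !subr0 sqrrN. Qed.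

(** Invariance of Lebesgue measure under reflection and evenness of the density. It later makes the
    positive and negative parts of an increment cancel in mean. *)
Lemma ge0_integral_opp_normal_pdf (s : R) (f : R -> R) : s != 0 ->
  measurable_fun setT f -> (forall x, 0 <= f x) ->
  (\int[mu]_x (f (- x) * normal_pdf 0 s x)%:E = \int[mu]_x (f x * normal_pdf 0 s x)%:E)%E.
Proof.
move=> s0 mf f0.
have mN : measurable_fun setT (-%R : R -> R) by exact: oppr_measurable.
rewrite [RHS](eq_measure_integral (pushforward mu (-%R : _ -> measurableTypeR R))); last first.
  by move=> /= B mB _; exact/esym/lebesgue_measureN.
transitivity (\int[mu]_(x in (-%R : measurableTypeR R -> measurableTypeR R) @^-1` setT)
   (((fun x => (f x * normal_pdf 0 s x)%:E) : measurableTypeR R -> \bar R) \o -%R) x)%E.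
  by apply: eq_integral => x _ /=; rewrite normal_pdf_even.
apply/esym; apply: ge0_integral_pushforward => //.
- by apply/measurable_EFinP; apply: measurable_funM => //; exact: measurable_normal_pdf.
- by move=> y _; rewrite lee_fin mulr_ge0// normal_pdf_ge0.
Qed.

End normal_moments.

(** * Moments of Brownian increments *)

Section brownian_increments.
Context {d : measure_display} {T : measurableType d} {R : realType}.
Context {P : probability T R} {B : R -> {RV P >-> R}} (hB : brownian_motion B).

Definition increment (t : nat -> R) (i : nat) : {mfun T >-> R} := B (t i.+1) \- B (t i).

Lemma increment_indep (n : nat) (t : nat -> R) (A : nat -> set R) :
  0 <= t 0%N -> {homo t : i j / (i <= j)%N >-> i <= j} ->
  (forall i, measurable (A i)) ->
  P (\bigcap_(i in `I_n) [set w | A i (increment t i w)]) =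
  (\prod_(i < n) P [set w | A i (increment t i w)])%E.
Proof. by move=> t0 ht mA; exact: (bm_indep hB). Qed.

Let ge0_integral_increment (s t : R) (f : R -> R) : 0 <= s -> s < t ->
  measurable_fun setT f -> (forall x, 0 <= f x) ->
  (\int[P]_w (f (B t w - B s w))%:E =
   \int[lebesgue_measure]_x (f x * normal_pdf 0 (Num.sqrt (t - s)) x)%:E)%E.
Proof.
move=> s0 st mf f0; pose X : {mfun T >-> R} := B t \- B s.
transitivity (\int[distribution P X]_x (f x)%:E)%E.
  by rewrite ge0_integral_distribution//; exact/measurable_EFinP.
rewrite (ge0_integral_density lebesgue_measure (distribution P X) id
  (normal_pdf 0 (Num.sqrt (t - s))) (EFin \o f))//=.
- exact: measurable_normal_pdf.
- by move=> x; exact: normal_pdf_ge0.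
- move=> A mA; rewrite [LHS](bm_gauss hB)// /normal_prob integral_mkcond.
  apply: eq_integral => x _.
  by rewrite patchE indicE; case: (x \in A); rewrite ?mul1r ?mul0r.
- by apply/measurable_EFinP.
Qed.

Lemma integral_sq_increment (s t : R) : 0 <= s -> s <= t ->
  (\int[P]_w ((B t w - B s w) ^+ 2)%:E)%E = (normal_var (R := R) * (t - s))%:E.
Proof.
move=> s0; rewrite le_eqVlt => /predU1P[->|st].
  rewrite subrr mulr0; apply: integral0_eq => w _.
  by rewrite subrr expr0n.
have m2 : measurable_fun setT (fun x : R => x ^+ 2) by exact: measurable_funX.
rewrite (ge0_integral_increment _ _ _ s0 st m2 (@sqr_ge0 _)).
by rewrite integral_sq_normal_pdf ?sqrtr_gt0 ?subr_gt0// sqr_sqrtr// subr_ge0 ltW.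
Qed.

Lemma sqintegrable_increment (s t : R) : 0 <= s -> s <= t ->
  P.-integrable setT (fun w => ((B t w - B s w) ^+ 2)%:E).
Proof.
move=> s0 st; apply/integrableP; split.
  by apply/measurable_EFinP; apply: measurable_funX; exact: measurable_funB.
under eq_integral do rewrite gee0_abs ?lee_fin ?sqr_ge0//.
by rewrite integral_sq_increment// ltry.
Qed.

Lemma integrable_increment (s t : R) : 0 <= s -> s <= t ->
  P.-integrable setT (fun w => (B t w - B s w)%:E).
Proof.
move=> s0 st.
have i2 : P.-integrable setT (fun w => (1 + (B t w - B s w) ^+ 2)%:E).
  apply: (integrableD measurableT (f := EFin \o cst 1) (g := fun w => ((B t w - B s w) ^+ 2)%:E)) => //.
    exact: finite_measure_integrable_cst.
  exact: sqintegrable_increment.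
apply: le_integrable i2 => //.
  by apply/measurable_EFinP; exact: measurable_funB.
move=> w _ /=; rewrite lee_fin [leRHS]ger0_norm ?addr_ge0 ?sqr_ge0//.
set x := B t w - B s w.
by rewrite -[x ^+ 2]real_normK ?num_real//; have := sqr_ge0 (`|x| - 1); nra.
Qed.

(** By symmetry of the density, the positive and the negative part of the increment have the same
    expectation. The case [s = t] is apart because [bm_gauss] speaks of [s < t]. *)
Lemma integral_increment (s t : R) : 0 <= s -> s <= t ->
  \int[P]_w (B t w - B s w) = 0.
Proof.
move=> s0; rewrite le_eqVlt => /predU1P[->|st].
  by under eq_Rintegral do rewrite subrr; rewrite /Rintegral integral0.
have sts : Num.sqrt (t - s) != 0 by rewrite gt_eqF// sqrtr_gt0 subr_gt0.
pose p (x : R) := Num.max x 0.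
have mp : measurable_fun setT p by exact: measurable_maxr.
have p0 x : 0 <= p x by rewrite /p le_max lexx orbT.
have pE x : x = p x - p (- x).
  by rewrite /p; case: (leP x 0); case: (leP (- x) 0) => *; lra.
have ple x : `|p x| <= `|x|.
  by rewrite /p; case: (leP x 0) => _; rewrite ?normr0.
have mX : measurable_fun setT (fun w => B t w - B s w) by exact: measurable_funB.
have ix := integrable_increment _ _ s0 (ltW st).
have ip : P.-integrable setT (fun w => (p (B t w - B s w))%:E).
  apply: le_integrable ix => //; first by apply/measurable_EFinP; exact: measurableT_comp.
  by move=> w _ /=; rewrite lee_fin.
have mX' : measurable_fun setT (fun w => - (B t w - B s w)) by exact: measurableT_comp.
have im : P.-integrable setT (fun w => (p (- (B t w - B s w)))%:E).
  apply: le_integrable ix => //; first by apply/measurable_EFinP; exact: measurableT_comp mp mX'.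
  by move=> w _ /=; rewrite lee_fin (le_trans (ple _))// normrN.
rewrite (@eq_Rintegral _ _ _ P setT
  (fun w => p (B t w - B s w) - p (- (B t w - B s w)))); last by move=> w _; exact: pE.
rewrite RintegralB// /Rintegral (ge0_integral_increment _ _ p)//.
rewrite (ge0_integral_increment _ _ (fun x => p (- x)))//; last exact: measurableT_comp.
by rewrite ge0_integral_opp_normal_pdf// subrr.
Qed.

End brownian_increments.

(** * Isometry for products of two increments on one grid *)

Section step_isometry.
Context {d : measure_display} {T : measurableType d} {R : realType}.
Context {P : probability T R} {B : R -> {RV P >-> R}} (hB : brownian_motion B).
Context (t : nat -> R) (t0 : 0 <= t 0%N) (ht : {homo t : i j / (i <= j)%N >-> i <= j}).
Local Notation xi := (increment (B := B) t).
Local Notation v := (fun i => normal_var (R := R) * (t i.+1 - t i)).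

Let tS i : t i <= t i.+1. Proof. exact: ht. Qed.

Let tge0 i : 0 <= t i. Proof. by rewrite (le_trans t0)// ht. Qed.

(** The exponent of [xi m] in the product of the increments of indices [i], [j], [k], [l]; it brings
    that product into the form of [expectation_prod]. *)
Let mult (i j k l m : nat) : nat := ((m == i) + (m == j) + (m == k) + (m == l))%N.

Let prod_delta (n i : nat) (x : nat -> R) : (i < n)%N ->
  \prod_(m < n) x m ^+ (nat_of_ord m == i) = x i.
Proof.
move=> ni; rewrite (bigD1 (Ordinal ni))//= eqxx expr1 big1 ?mulr1// => m mi.
by rewrite (negPf (mi : (m != i :> nat))) expr0.
Qed.

Let prod_mult (n i j k l : nat) (x : nat -> R) :
  (i < n)%N -> (j < n)%N -> (k < n)%N -> (l < n)%N ->
  \prod_(m < n) x m ^+ mult i j k l m = x i * x j * (x k * x l).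
Proof.
move=> ni nj nk nl; rewrite -(prod_delta n i x)// -(prod_delta n j x)//.
rewrite -(prod_delta n k x)// -(prod_delta n l x)// -!big_split/=.
by apply: eq_bigr => m _; rewrite -!exprD /mult !addnA.
Qed.

(** An index occurs at most once in each off-diagonal pair. This is what keeps moments of order 3
    and 4 out of the isometry. *)
Let mult_le2 i j k l m : i != j -> k != l -> (mult i j k l m <= 2)%N.
Proof.
move=> ij kl; rewrite /mult.
have : ((m == i) + (m == j) <= 1)%N by case: eqP => [->|]; [rewrite (negPf ij)|case: eqP].
have : ((m == k) + (m == l) <= 1)%N by case: eqP => [->|]; [rewrite (negPf kl)|case: eqP].
by lia.
Qed.

Let integrable_pow (e m : nat) : (e <= 2)%N -> P.-integrable setT (fun w => (xi m w ^+ e)%:E).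
Proof.
case: e => [|[|[|//]]] _.
- under eq_fun do rewrite expr0; exact: (finite_measure_integrable_cst P 1 measurableT).
- under eq_fun do rewrite expr1; exact: (integrable_increment hB).
- exact: (sqintegrable_increment hB).
Qed.

Let integral_pow (e m : nat) : (e <= 2)%N ->
  \int[P]_w (xi m w ^+ e) = if e == 0%N then 1 else if e == 1%N then 0 else v m.
Proof.
case: e => [|[|[|//]]] _ /=.
- under eq_Rintegral do rewrite expr0.
  by rewrite Rintegral_cst// mul1r; exact: (congr1 fine (probability_setT P)).
- under eq_Rintegral do rewrite expr1; exact: (integral_increment hB).
- by rewrite /Rintegral (integral_sq_increment hB).
Qed.

Lemma sqintegrable_increment2 (i j : nat) : i != j ->
  sqintegrable P (fun w => xi i w * xi j w).
Proof.
move=> ij; split; first exact: measurable_funM.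
pose n := (maxn i j).+1; pose G m (y : R) := y ^+ mult i j i j m.
have mG m : measurable_fun setT (G m) by exact: measurable_funX.
have iG m : P.-integrable setT (fun w => (G m (xi m w))%:E) by apply: integrable_pow; exact: mult_le2.
have h := integrable_expectation_prod P n xi (fun A => increment_indep hB n t A t0 ht) G mG iG.
apply: eq_integrable h => // w _; congr EFin.
by rewrite /G (prod_mult n i j i j (fun m => xi m w)) ?expr2// ltnS leq_max leqnn ?orbT.
Qed.

(** The expectation factorises over the grid. An index occurring exactly once contributes a mean,
    hence 0, so only the two pairings of [(i, j)] with [(k, l)] survive; in these both increments
    are squared. *)
Lemma dotL2_increment2 (i j k l : nat) : i != j -> k != l ->
  dotL2 P (fun w => xi i w * xi j w) (fun w => xi k w * xi l w) =
  ((i == k) && (j == l))%:R * (v i * v j) + ((i == l) && (j == k))%:R * (v i * v j).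
Proof.
move=> ij kl; pose n := (maxn (maxn i j) (maxn k l)).+1.
have [[ni nj] [nk nl]] : ((i < n)%N /\ (j < n)%N) /\ ((k < n)%N /\ (l < n)%N) by rewrite /n; lia.
pose G m (y : R) := y ^+ mult i j k l m.
have mG m : measurable_fun setT (G m) by exact: measurable_funX.
have iG m : P.-integrable setT (fun w => (G m (xi m w))%:E) by apply: integrable_pow; exact: mult_le2.
have h := expectation_prod P n xi (fun A => increment_indep hB n t A t0 ht) G mG iG.
transitivity (\int[P]_w \prod_(m < n) G m (xi m w)).
  by apply: eq_Rintegral => w _; rewrite /G (prod_mult n i j k l (fun m => xi m w)).
rewrite h.
have E (m : 'I_n) : \int[P]_w G m (xi m w) =
    if mult i j k l m == 0%N then 1 else if mult i j k l m == 1%N then 0 else v m.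
  by rewrite integral_pow// mult_le2.
have single (m : nat) : (m < n)%N -> mult i j k l m = 1%N -> \prod_(m < n) \int[P]_w G m (xi m w) = 0.
  by move=> nm m1; rewrite (bigD1 (Ordinal nm))//= (E (Ordinal nm)) m1 mul0r.
have ji : j != i by rewrite eq_sym.
have lk : l != k by rewrite eq_sym.
have double : (forall m, mult i j k l m = ((m == i) + (m == j)) * 2)%N ->
    \prod_(m < n) \int[P]_w G m (xi m w) = v i * v j.
  move=> m2; rewrite (eq_bigr (fun m : 'I_n => v m ^+ (m == i :> nat) * v m ^+ (m == j :> nat))).
    by rewrite big_split/= !(prod_delta n _ (fun m => v m)).
  move=> m _; rewrite E m2; have [->|mi] := eqVneq (m : nat) i.
    by rewrite (negPf ij) expr1 expr0 mulr1.
  by have [->|mj] := eqVneq (m : nat) j; rewrite /= ?expr0 ?expr1 ?mul1r.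
have [ik|ik] := eqVneq i k.
  have [jl|jl] := eqVneq j l.
    subst k l; rewrite (negPf ij) mul1r mul0r addr0; apply: double => m.
    by rewrite /mult; lia.
  subst k; rewrite (negPf ji) /= ?andbF !mul0r addr0; apply: (single _ nj).
  by rewrite /mult eqxx (negPf ji) (negPf jl).
have [il|il] := eqVneq i l.
  have [jk|jk] := eqVneq j k.
    subst k l; rewrite mul0r mul1r add0r; apply: double => m.
    by rewrite /mult; lia.
  subst l; rewrite !mul0r addr0; apply: (single _ nj).
  by rewrite /mult eqxx (negPf ji) (negPf jk).
rewrite !mul0r addr0; apply: (single _ ni).
by rewrite /mult eqxx (negPf ij) (negPf ik) (negPf il).
Qed.

Definition cell (i : nat) : set R := `]t i, t i.+1].

Definition rect (i j : nat) (y : R * R) : R := \1_(cell i) y.1 * \1_(cell j) y.2.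

Local Notation leb2 := ((@lebesgue_measure R \x @lebesgue_measure R)%E).

Let mcell i : measurable (cell i). Proof. exact: measurable_itv. Qed.

Let mcellI i j : measurable (cell i `&` cell j).
Proof. by apply: measurableI; exact: mcell. Qed.

Let lebesgue_cell (i k : nat) :
  (lebesgue_measure (cell i `&` cell k) = ((i == k)%:R * (t i.+1 - t i))%:E)%E.
Proof.
have [->|ik] := eqVneq i k.
  rewrite setIid /cell lebesgue_measure_itv/= lte_fin mul1r.
  by case: ltP => // h; congr EFin; have := tS k; lra.
rewrite mul0r (_ : _ `&` _ = set0) ?measure0// -subset0 => x [] /=.
rewrite /cell /= !in_itv/= => /andP[h1 h2] /andP[h3 h4].
move: ik; rewrite neq_ltn => /orP[] h; have := ht _ _ h; lra.
Qed.

Let rectM (i j k l : nat) (y : R * R) :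
  rect i j y * rect k l y = \1_((cell i `&` cell k) `*` (cell j `&` cell l)) y.
Proof.
by rewrite /rect !indicE in_setX !in_setI -!natrM !mulnb andbACA.
Qed.

Let integral_rectM (i j k l : nat) : (\int[leb2]_y (rect i j y * rect k l y)%:E)%E =
  (((i == k) && (j == l))%:R * ((t i.+1 - t i) * (t j.+1 - t j)))%:E.
Proof.
under eq_integral do rewrite rectM.
rewrite integral_indic//; last by apply: measurableX; exact: mcellI.
rewrite setIT.
transitivity (lebesgue_measure (cell i `&` cell k) * lebesgue_measure (cell j `&` cell l))%E.
  by apply: product_measure1E; exact: mcellI.
rewrite !lebesgue_cell -EFinM; congr EFin.
by case: eqP; case: eqP => _ _ /=; rewrite ?mul0r ?mulr0 ?mul1r.
Qed.

Lemma measurable_rect (i j : nat) : measurable_fun setT (rect i j).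
Proof.
apply: measurable_funM.
  by apply: measurableT_comp (measurable_fst); exact: measurable_indic.
by apply: measurableT_comp (measurable_snd); exact: measurable_indic.
Qed.

Lemma sqintegrable_rect (i j : nat) : sqintegrable leb2 (rect i j).
Proof.
apply: sqintegrable_lty; first exact: measurable_rect.
under eq_integral do rewrite expr2.
by rewrite integral_rectM ltry.
Qed.

Lemma dotL2_rect (i j k l : nat) : dotL2 leb2 (rect i j) (rect k l) =
  ((i == k) && (j == l))%:R * ((t i.+1 - t i) * (t j.+1 - t j)).
Proof. by rewrite /dotL2 /Rintegral integral_rectM. Qed.

(** Distinct cells are disjoint, so rectangles are orthogonal unless their indices agree. The
    crossed pairing is read off from the transposed rectangle [rect l k]; it is the origin of the
    swap in the isometry. *)
Lemma dotL2_increment2_rect (i j k l : nat) : i != j -> k != l ->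
  dotL2 P (fun w => xi i w * xi j w) (fun w => xi k w * xi l w) =
  normal_var (R := R) ^+ 2 *
  (dotL2 leb2 (rect i j) (rect k l) + dotL2 leb2 (rect i j) (rect l k)).
Proof. by move=> ij kl; rewrite dotL2_increment2// !dotL2_rect; ring. Qed.

End step_isometry.

(** * Common refinement of two step functions *)

Section common_refinement.
Context {R : realType}.

(** The indicator at [x] becomes the increment from [a] to [b] of the function r |-> 1[x <= r], the
    same shape as an increment of [B]. *)
Lemma indic_itv_oc (a b x : R) : a <= b ->
  \1_`]a, b] x = (x <= b)%R%:R - (x <= a)%R%:R :> R.
Proof.
move=> ab; rewrite indicE mem_setE in_itv/=.
case: (leP x a) => xa; last by rewrite subr0.
by rewrite (le_trans xa ab) subrr.
Qed.

Lemma telescope_grid (tau F : nat -> R) (N a b : nat) (G : R -> R) :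
  {homo tau : i j / (i <= j)%N >-> i <= j} -> (a <= b)%N -> (b <= N)%N ->
  G (tau b) - G (tau a) =
  \sum_(k < N) \1_`]tau a, tau b] (tau k.+1) * (G (tau k.+1) - G (tau k)).
Proof.
move=> ht ab bN.
transitivity (\sum_(k < N) ((a <= k < b)%N)%:R * (G (tau k.+1) - G (tau k))); last first.
  apply: eq_bigr => k _.
  (* Grid points may coincide. The increment then vanishes, and the two weights in front of it need
     not agree. *)
  have := ht _ _ (leqnSn k); rewrite le_eqVlt => /predU1P[->|kk]; first by rewrite subrr !mulr0.
  rewrite indicE mem_setE in_itv/=; congr ((nat_of_bool _)%:R * _); apply/andP/andP => -[h1 h2]; split.
  - exact: le_lt_trans (ht _ _ h1) kk.
  - exact: ht.
  - by rewrite leqNgt; apply/negP => h; have := ht _ _ h; rewrite leNgt h1.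
  - by rewrite ltnNge; apply/negP => h; have := ht _ _ h; rewrite leNgt (lt_le_trans kk h2).
rewrite -(telescope_sumr (fun k => G (tau k)) ab).
rewrite -(big_mkord xpredT (fun k => ((a <= k < b)%N)%:R * (G (tau k.+1) - G (tau k)))).
rewrite (big_cat_nat (leq0n a) (leq_trans ab bN))/= (big_cat_nat ab bN)/=.
rewrite [X in _ = X + _]big_nat_cond [X in _ = X + _]big1 ?add0r => [|k]; last first.
  rewrite andbT => /andP[_ ka]; by rewrite leqNgt ka mul0r.
rewrite [X in _ = _ + X]big_nat_cond [X in _ = _ + X]big1 ?addr0 => [|k]; last first.
  rewrite andbT => /andP[bk _]; by rewrite [(k < b)%N]ltnNge bk andbF mul0r.
by apply: eq_big_nat => k ->; rewrite mul1r.
Qed.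

(* With indicators of half-lines for [F] and [G] this is [offdiag_fun], with [B] it is
   [offdiag_int]: passing to a common grid is thus one computation for both. *)
Definition offdiag_bilin (s : offdiag_step R) (F G : R -> R) : R :=
  \sum_(i < os_size s) \sum_(j < os_size s | j != i)
    os_coef s i j * (F (os_time s i.+1) - F (os_time s i))
                  * (G (os_time s j.+1) - G (os_time s j)).

Lemma offdiag_funE (s : offdiag_step R) (y : R * R) :
  offdiag_fun s y = offdiag_bilin s (fun r => (y.1 <= r)%R%:R) (fun r => (y.2 <= r)%R%:R).
Proof.
apply: eq_bigr => i _; apply: eq_bigr => j _.
by rewrite !indic_itv_oc//; exact: os_time_homo.
Qed.

Definition refines (tau : nat -> R) (N : nat) (s : offdiag_step R) : Prop :=
  forall i, (i <= os_size s)%N -> exists2 a, (a <= N)%N & os_time s i = tau a.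

(** Cells are open on the left and closed on the right, so the value of the step function at the
    upper right corner of a fine rectangle is its value on the whole rectangle whenever the grid
    refines that of [s]. *)
Definition refine (tau : nat -> R) (N : nat) (tau0 : 0 <= tau 0%N)
    (htau : {homo tau : i j / (i <= j)%N >-> i <= j}) (s : offdiag_step R) : offdiag_step R :=
  @OffdiagStep R N tau (fun k l => offdiag_fun s (tau k.+1, tau l.+1)) tau0 htau.

Lemma refines_telescope (tau : nat -> R) (N : nat) (s : offdiag_step R) (i : nat) (F : R -> R) :
  {homo tau : i j / (i <= j)%N >-> i <= j} -> refines tau N s -> (i < os_size s)%N ->
  F (os_time s i.+1) - F (os_time s i) = \sum_(k < N)
    \1_`]os_time s i, os_time s i.+1] (tau k.+1) * (F (tau k.+1) - F (tau k)).
Proof.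
move=> htau st is_; have [a aN Ea] := st i (ltnW is_); have [b bN Eb] := st _ is_.
have [ab|/ltnW ba] := leqP a b; first by rewrite Ea Eb; exact: telescope_grid.
(* The positions [a] and [b] are known only to exist. If they come in the wrong order, monotonicity
   of both grids forces the two times to be equal. *)
have E : os_time s i = os_time s i.+1.
  by apply/eqP; rewrite eq_le os_time_homo//= Ea Eb htau.
rewrite -E subrr big1// => k _; rewrite indicE mem_setE in_itv/=.
by case: ltP => h; rewrite ?mul0r// leNgt h mul0r.
Qed.

Lemma cell_disjoint (s : offdiag_step R) (i j : nat) (x : R) : i != j ->
  \1_`]os_time s i, os_time s i.+1] x * \1_`]os_time s j, os_time s j.+1] x = 0 :> R.
Proof.
move=> ij; rewrite !indicE !mem_setE !in_itv/= -natrM mulnb; case: andP => //= -[/andP[h1 h2] /andP[h3 h4]].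
by move: ij; rewrite neq_ltn => /orP[] h; have := @os_time_homo R s _ _ h; lra.
Qed.

(** Each coarse increment is the sum of the fine increments inside its cell; expanding both factors
    and exchanging the sums gives the refined form. What needs an argument is the diagonal, excluded
    on both grids but not by the same condition. *)
Lemma offdiag_bilin_refine (tau : nat -> R) (N : nat) (tau0 : 0 <= tau 0%N)
    (htau : {homo tau : i j / (i <= j)%N >-> i <= j}) (s : offdiag_step R) (F G : R -> R) :
  refines tau N s ->
  offdiag_bilin (refine tau N tau0 htau s) F G = offdiag_bilin s F G.
Proof.
move=> st; pose D (F : R -> R) k := F (tau k.+1) - F (tau k).
pose c i k : R := \1_`]os_time s i, os_time s i.+1] (tau k.+1).
transitivity (\sum_(k < N) \sum_(l < N | l != k)
   \sum_(i < os_size s) \sum_(j < os_size s | j != i)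
     os_coef s i j * (c i k * D F k) * (c j l * D G l)).
  apply: eq_bigr => k _; apply: eq_bigr => l _ /=.
  rewrite /offdiag_fun !mulr_suml; apply: eq_bigr => i _.
  by rewrite !mulr_suml; apply: eq_bigr => j _; rewrite /c /D; ring.
(* The terms [l = k] may be added: [tau k.+1] cannot lie in two different cells of [s], so their
   coefficients vanish. *)
transitivity (\sum_(k < N) \sum_(l < N)
   \sum_(i < os_size s) \sum_(j < os_size s | j != i)
     os_coef s i j * (c i k * D F k) * (c j l * D G l)).
  apply: eq_bigr => k _; rewrite [RHS](bigD1 k)//= [X in _ = X + _]big1 ?add0r// => i _.
  apply: big1 => j ji; have := cell_disjoint s i j (tau k.+1); rewrite -/(c i k) -/(c j k) => h.
  have -> : os_coef s i j * (c i k * D F k) * (c j k * D G k) =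
    os_coef s i j * (c i k * c j k) * D F k * D G k by ring.
  by rewrite h ?mulr0 ?mul0r// eq_sym.
under eq_bigr do rewrite exchange_big/=.
rewrite exchange_big/=; apply: eq_bigr => i _.
under eq_bigr do rewrite exchange_big/=.
rewrite exchange_big/=; apply: eq_bigr => j _.
rewrite (refines_telescope _ _ _ _ F htau st)// (refines_telescope _ _ _ _ G htau st)//.
rewrite -mulrA mulr_suml mulr_sumr; apply: eq_bigr => k _.
by rewrite !mulr_sumr; apply: eq_bigr => l _; rewrite /c /D; ring.
Qed.

Lemma common_grid (s1 s2 : offdiag_step R) : exists (tau : nat -> R) (N : nat),
  [/\ 0 <= tau 0%N, {homo tau : i j / (i <= j)%N >-> i <= j},
      refines tau N s1 & refines tau N s2].
Proof.
pose times (s : offdiag_step R) := [seq os_time s i | i <- iota 0 (os_size s).+1].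
pose L := sort <=%R (times s1 ++ times s2).
have sL : sorted <=%R L by apply: sort_sorted; exact: le_total.
have memL x : (x \in L) = (x \in times s1 ++ times s2) by rewrite mem_sort.
have L0 x : x \in L -> 0 <= x.
  rewrite memL mem_cat => /orP[] /mapP[i _ ->];
  by apply: le_trans (os_time_ge0 _) _; exact: os_time_homo.
have szL : (0 < size L)%N by rewrite size_sort size_cat !size_map !size_iota.
(* The default is the last entry of the sorted list, so the grid stays constant at its largest time
   beyond the list and remains nondecreasing and nonnegative. *)
pose tau k := nth (last 0 L) L k.
have lastL : last 0 L \in L by move: szL; case: (L) => // x l _ /=; rewrite mem_last.
have tauL k : tau k \in L.
  rewrite /tau; have [h|h] := ltnP k (size L); first exact: mem_nth.
  by rewrite nth_default.
have lastE : last 0 L = nth (last 0 L) L (size L).-1 by rewrite nth_last; move: szL; case: (L).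
exists tau, (size L); split.
- exact: L0.
- move=> i j ij; rewrite /tau; have [jL|jL] := ltnP j (size L).
    by apply: (sorted_leq_nth le_trans lexx) => //; rewrite inE// (leq_ltn_trans ij).
  rewrite [leRHS]nth_default//; have [iL|iL] := ltnP i (size L); last by rewrite nth_default.
  rewrite [leRHS]lastE; apply: (sorted_leq_nth le_trans lexx) => //.
    by rewrite inE prednK.
  by rewrite -ltnS prednK.
- move=> i is1; have iL : os_time s1 i \in L.
    by rewrite memL mem_cat; apply/orP; left; apply/mapP; exists i; rewrite // mem_iota.
  by exists (index (os_time s1 i) L); [rewrite ltnW// index_mem|rewrite /tau nth_index].
- move=> i is2; have iL : os_time s2 i \in L.
    by rewrite memL mem_cat; apply/orP; right; apply/mapP; exists i; rewrite // mem_iota.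
  by exists (index (os_time s2 i) L); [rewrite ltnW// index_mem|rewrite /tau nth_index].
Qed.

End common_refinement.

(** * Isometry for integrals of off-diagonal step functions *)

Section dotL2_double_sum.
Context {d : measure_display} {T : measurableType d} {R : realType}.
Context (mu : {measure set T -> \bar R}).

Lemma dotL2_sumZ (I J : finType) (P : pred I) (Q : pred J) (a : I -> R) (b : J -> R)
    (e : I -> T -> R) (f : J -> T -> R) :
  (forall i, P i -> sqintegrable mu (e i)) -> (forall j, Q j -> sqintegrable mu (f j)) ->
  dotL2 mu (fun x => \sum_(i | P i) a i * e i x) (fun x => \sum_(j | Q j) b j * f j x) =
  \sum_(i | P i) \sum_(j | Q j) a i * b j * dotL2 mu (e i) (f j).
Proof.
move=> Le Lf.
have Lbf : sqintegrable mu (fun x => \sum_(j | Q j) b j * f j x).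
  by apply: sqintegrable_sum => j Qj; exact/sqintegrableZ/Lf.
rewrite dotL2_suml//; last by move=> i Pi; exact/sqintegrableZ/Le.
apply: eq_bigr => i Pi; rewrite dotL2Zl//; last exact: Le.
rewrite dotL2C dotL2_suml//; [|by move=> j Qj; exact/sqintegrableZ/Lf|exact: Le].
rewrite mulr_sumr; apply: eq_bigr => j Qj.
by rewrite dotL2Zl//; [rewrite dotL2C mulrA|exact: Lf|exact: Le].
Qed.

End dotL2_double_sum.

Section offdiag_isometry.
Context {d : measure_display} {T : measurableType d} {R : realType}.
Context {P : probability T R} {B : R -> {RV P >-> R}} (hB : brownian_motion B).
Local Notation leb2 := ((@lebesgue_measure R \x @lebesgue_measure R)%E).

Let offdiag_funS (s : offdiag_step R) (y : R * R) : offdiag_fun s y =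
  \sum_(p : 'I_(os_size s) * 'I_(os_size s) | p.2 != p.1)
     os_coef s p.1 p.2 * rect (os_time s) p.1 p.2 y.
Proof.
rewrite /offdiag_fun pair_big_dep/=; apply: eq_big => // p _.
by rewrite -mulrA.
Qed.

Let offdiag_intS (s : offdiag_step R) (w : T) : offdiag_int B s w =
  \sum_(p : 'I_(os_size s) * 'I_(os_size s) | p.2 != p.1)
     os_coef s p.1 p.2 * (increment (B := B) (os_time s) p.1 w * increment (B := B) (os_time s) p.2 w).
Proof.
rewrite /offdiag_int pair_big_dep/=; apply: eq_big => // p _.
by rewrite -mulrA.
Qed.

Lemma sqintegrable_offdiag_fun (s : offdiag_step R) : sqintegrable leb2 (offdiag_fun s).
Proof.
rewrite (funext (offdiag_funS s)).
apply: sqintegrable_sum => p _; apply: sqintegrableZ.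
exact: (sqintegrable_rect (os_time s) (os_time_homo s)).
Qed.

Lemma sqintegrable_offdiag_int (s : offdiag_step R) : sqintegrable P (offdiag_int B s).
Proof.
rewrite (funext (offdiag_intS s)).
apply: sqintegrable_sum => p pp; apply: sqintegrableZ.
by apply: (sqintegrable_increment2 hB _ (os_time_ge0 s) (os_time_homo s)); rewrite eq_sym.
Qed.

Definition swap (y : R * R) : R * R := (y.2, y.1).

(** On a common grid both sides are bilinear in the coefficients, which reduces the identity to
    single products of increments and single rectangles. Coefficients need not be symmetric, so the
    crossed term stays separate. *)
Lemma dotL2_offdiag (s1 s2 : offdiag_step R) :
  dotL2 P (offdiag_int B s1) (offdiag_int B s2) = normal_var (R := R) ^+ 2 *
  (dotL2 leb2 (offdiag_fun s1) (offdiag_fun s2) +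
   dotL2 leb2 (offdiag_fun s1) (offdiag_fun s2 \o swap)).
Proof.
have [tau [N [tau0 htau r1 r2]]] := common_grid s1 s2.
have fE s : refines tau N s -> offdiag_fun s = offdiag_fun (refine tau N tau0 htau s).
  by move=> r; apply/funext => y; rewrite !offdiag_funE offdiag_bilin_refine.
have iE s : refines tau N s -> offdiag_int B s = offdiag_int B (refine tau N tau0 htau s).
  move=> r; apply/funext => w.
  exact/esym/(offdiag_bilin_refine tau N tau0 htau s (fun u => B u w) (fun u => B u w) r).
rewrite (fE _ r1) (fE _ r2) (iE _ r1) (iE _ r2).
pose a s (p : 'I_N * 'I_N) := os_coef (refine tau N tau0 htau s) p.1 p.2.
have iS s : offdiag_int B (refine tau N tau0 htau s) = fun w =>
    \sum_(p : 'I_N * 'I_N | p.2 != p.1) a s p * (increment (B := B) tau p.1 w * increment (B := B) tau p.2 w).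
  by apply/funext => w; exact: (offdiag_intS (refine tau N tau0 htau s)).
have fS s : offdiag_fun (refine tau N tau0 htau s) = fun y =>
    \sum_(p : 'I_N * 'I_N | p.2 != p.1) a s p * rect tau p.1 p.2 y.
  by apply/funext => w; exact: (offdiag_funS (refine tau N tau0 htau s)).
have fS' s : offdiag_fun (refine tau N tau0 htau s) \o swap = fun y =>
    \sum_(p : 'I_N * 'I_N | p.2 != p.1) a s p * rect tau p.2 p.1 y.
  by rewrite fS; apply/funext => y; apply: eq_bigr => p _; rewrite /rect/= [X in _ * X]mulrC.
have Lr i j : sqintegrable leb2 (rect tau i j) by exact: sqintegrable_rect.
rewrite !iS fS' !fS !dotL2_sumZ//; last 2 first.
- by move=> p pp; apply: (sqintegrable_increment2 hB _ tau0 htau); rewrite eq_sym.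
- by move=> p pp; apply: (sqintegrable_increment2 hB _ tau0 htau); rewrite eq_sym.
rewrite -big_split mulr_sumr; apply: eq_bigr => p pp.
rewrite -big_split mulr_sumr; apply: eq_bigr => q qq /=.
rewrite (dotL2_increment2_rect hB _ tau0 htau); [|by rewrite eq_sym|by rewrite eq_sym].
by ring.
Qed.

End offdiag_isometry.

(** * Double Wiener-Ito integrals of general kernels *)

Section double_wiener_ito.
Context {d : measure_display} {T : measurableType d} {R : realType}.
Context {P : probability T R} {B : R -> {RV P >-> R}} (hB : brownian_motion B).
Local Notation leb2 := ((@lebesgue_measure R \x @lebesgue_measure R)%E).

Lemma measurable_swap : measurable_fun setT (@swap R).
Proof. exact: measurable_fun_pair. Qed.

Lemma ge0_integral_swap (h : R * R -> R) : measurable_fun setT h -> (forall y, 0 <= h y) ->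
  (\int[leb2]_y (h (swap y))%:E = \int[leb2]_y (h y)%:E)%E.
Proof.
move=> mh h0.
have mhs : measurable_fun setT (h \o @swap R) by exact: measurableT_comp measurable_swap.
rewrite (@fubini_tonelli1 _ _ _ _ R lebesgue_measure lebesgue_measure (EFin \o (h \o @swap R)))//; last 2 first.
- exact/measurable_EFinP.
- by move=> y; rewrite /= lee_fin h0.
rewrite (@fubini_tonelli2 _ _ _ _ R lebesgue_measure lebesgue_measure (EFin \o h))//.
- exact/measurable_EFinP.
Qed.

Lemma sqintegrable_swap (f : R * R -> R) : sqintegrable leb2 f -> sqintegrable leb2 (f \o @swap R).
Proof.
move=> Lf; apply: sqintegrable_lty; first exact: measurableT_comp Lf.1 measurable_swap.
rewrite (ge0_integral_swap (fun y => f y ^+ 2)) ?dotL2_sq ?ltry//.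
  by apply: measurable_funX; exact: Lf.1.
by move=> y; exact: sqr_ge0.
Qed.

Lemma cvgL2_swap (u : nat -> R * R -> R) (f : R * R -> R) :
  (forall n, measurable_fun setT (u n)) -> measurable_fun setT f ->
  cvgL2 leb2 u f -> cvgL2 leb2 (fun n => u n \o @swap R) (f \o @swap R).
Proof.
move=> mu mf uf; rewrite /cvgL2.
under eq_fun => n do rewrite (ge0_integral_swap (fun y => (u n y - f y) ^+ 2)
  (measurable_funX 2 (measurable_funB (mu n) mf)) (fun y => sqr_ge0 _)).
exact: uf.
Qed.

Lemma double_wiener_ito_cvg (f : R * R -> R) (Y : {RV P >-> R}) :
  is_double_wiener_ito B f Y -> exists s : nat -> offdiag_step R,
    cvgL2 leb2 (fun n => offdiag_fun (s n)) f /\ cvgL2 P (fun n => offdiag_int B (s n)) Y.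
Proof.
by move=> [mf [s [sf sY]]]; exists s; split => //; move: sY; rewrite unlock.
Qed.

Lemma double_wiener_ito_sqintegrable (f : R * R -> R) (Y : {RV P >-> R}) :
  is_double_wiener_ito B f Y -> sqintegrable leb2 f /\ sqintegrable P Y.
Proof.
move=> fY; have mf := fY.1; have [s [sf sY]] := double_wiener_ito_cvg _ _ fY.
split; [apply: cvgL2_sqintegrable sf => // n|apply: cvgL2_sqintegrable sY => // n].
  exact: sqintegrable_offdiag_fun.
exact: sqintegrable_offdiag_int.
Qed.

(** Both sides are continuous in L^2. The approximating sequences of [f] and [g] may be unrelated,
    since the step isometry holds for any two step functions; so the identity passes to the limit,
    and limits are unique. *)
Lemma double_wiener_ito_dotL2 (f g : R * R -> R) (Y Z : {RV P >-> R}) :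
  is_double_wiener_ito B f Y -> is_double_wiener_ito B g Z ->
  dotL2 P Y Z = normal_var (R := R) ^+ 2 * (dotL2 leb2 f g + dotL2 leb2 f (g \o @swap R)).
Proof.
move=> fY gZ; have mf := fY.1; have mg := gZ.1.
have [s [sf sY]] := double_wiener_ito_cvg _ _ fY.
have [r [rg rZ]] := double_wiener_ito_cvg _ _ gZ.
have Lf n := sqintegrable_offdiag_fun (s n); have Lg n := sqintegrable_offdiag_fun (r n).
have LY n := sqintegrable_offdiag_int hB (s n); have LZ n := sqintegrable_offdiag_int hB (r n).
have c1 : dotL2 leb2 (offdiag_fun (s n)) (offdiag_fun (r n)) @[n --> \oo] --> dotL2 leb2 f g.
  exact: cvgL2_dotL2.
have c2 : dotL2 leb2 (offdiag_fun (s n)) (offdiag_fun (r n) \o @swap R) @[n --> \oo] -->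
    dotL2 leb2 f (g \o @swap R).
  apply: cvgL2_dotL2 => //.
  - exact: measurableT_comp mg measurable_swap.
  - by move=> n; exact: sqintegrable_swap (Lg n).
  - by apply: cvgL2_swap => // n; exact: (Lg n).1.
have c3 := cvgL2_dotL2 _ _ _ _ _ (measurable_funP Y) (measurable_funP Z) LY LZ sY rZ.
have : (fun n => dotL2 P (offdiag_int B (s n)) (offdiag_int B (r n))) @ \oo -->
  normal_var (R := R) ^+ 2 * (dotL2 leb2 f g + dotL2 leb2 f (g \o @swap R)).
  under eq_fun do rewrite (dotL2_offdiag hB).
  by apply: cvgM; [exact: cvg_cst|exact: cvgD c1 c2].
by move=> c5; apply: (cvg_unique _ c3 c5).
Qed.

(** For a symmetric kernel the swapped inner product repeats the first one, so the second moment is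
    2 kappa ^ 2 times the square norm of the kernel, which is monotone under domination. *)
Lemma le_double_wiener_ito (M : R) (f g : R * R -> R) (Y Z : {RV P >-> R}) :
  is_double_wiener_ito B f Y -> is_double_wiener_ito B g Z ->
  f \o @swap R = f -> g \o @swap R = g ->
  {ae leb2, forall y, `|f y| <= M * g y} ->
  dotL2 P Y Y <= M ^+ 2 * dotL2 P Z Z.
Proof.
move=> fY gZ fs gs fg.
have [Lf _] := double_wiener_ito_sqintegrable _ _ fY.
have [Lg _] := double_wiener_ito_sqintegrable _ _ gZ.
rewrite (double_wiener_ito_dotL2 _ _ _ _ fY fY) (double_wiener_ito_dotL2 _ _ _ _ gZ gZ) fs gs.
rewrite mulrCA; apply: ler_wpM2l; first exact: sqr_ge0.
suff : dotL2 leb2 f f <= M ^+ 2 * dotL2 leb2 g g by lra.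
have LMg := sqintegrableZ _ M _ Lg.
have -> : M ^+ 2 * dotL2 leb2 g g = dotL2 leb2 (fun y => M * g y) (fun y => M * g y).
  by rewrite dotL2Zl// (dotL2C leb2 _ (fun y => M * g y)) dotL2Zl// mulrA.
rewrite -lee_fin -!dotL2_sq//; apply: ae_ge0_le_integral => //.
- by move=> y _; rewrite lee_fin sqr_ge0.
- by apply/measurable_EFinP; apply: measurable_funX; exact: Lf.1.
- by move=> y _; rewrite lee_fin sqr_ge0.
- by apply/measurable_EFinP; apply: measurable_funX; exact: LMg.1.
- move: fg; apply: ae_filterS => y h _; rewrite lee_fin -[leLHS]real_normK ?num_real//.
  by rewrite ler_pXn2r ?nnegrE// (le_trans _ h).
Qed.

Lemma double_wiener_ito_dotL2_ge0 (f g : R * R -> R) (Y Z : {RV P >-> R}) :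
  is_double_wiener_ito B f Y -> is_double_wiener_ito B g Z ->
  g \o @swap R = g ->
  {ae leb2, forall y, 0 <= f y} -> {ae leb2, forall y, 0 <= g y} ->
  0 <= dotL2 P Y Z.
Proof.
move=> fY gZ gs f0 g0.
have [Lf _] := double_wiener_ito_sqintegrable _ _ fY.
have [Lg _] := double_wiener_ito_sqintegrable _ _ gZ.
rewrite (double_wiener_ito_dotL2 _ _ _ _ fY gZ) gs mulr_ge0 ?sqr_ge0//.
suff : 0 <= dotL2 leb2 f g by move=> h; rewrite addr_ge0.
(* The signs are known only almost everywhere; with absolute values the integrand is nonnegative at
   every point. *)
have -> : dotL2 leb2 f g = dotL2 leb2 (fun y => `|f y|) (fun y => `|g y|).
  apply: ae_dotL2 => //.
  - apply: (le_sqintegrable _ _ _ _ _ Lf); last by move=> y; rewrite normr_id.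
    by apply: measurableT_comp => //; exact: Lf.1.
  - apply: (le_sqintegrable _ _ _ _ _ Lg); last by move=> y; rewrite normr_id.
    by apply: measurableT_comp => //; exact: Lg.1.
  - by move: f0; apply: ae_filterS => y f0; rewrite ger0_norm.
  - by move: g0; apply: ae_filterS => y g0; rewrite ger0_norm.
by apply: Rintegral_ge0 => y _; rewrite mulr_ge0.
Qed.

End double_wiener_ito.

(** * Integrability of power singularities *)

Section power_singularity.
Context {R : realType}.
Local Notation mu := (@lebesgue_measure R).

Lemma is_derive_powR_shift (a y u : R) : y < u ->
  is_derive u 1 (fun v => (v - y) `^ a) (a * (u - y) `^ (a - 1)).
Proof.
move=> yu; have yu' : 0 < u - y by rewrite subr_gt0.
have dl : is_derive u 1 (fun v : R => v - y) 1.
  by have := is_deriveB (is_derive_id u 1) (is_derive_cst y u 1); rewrite subr0.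
have := @is_derive1_comp _ (@powR R ^~ a) (fun v => v - y) u _ _ (is_derive1_powR a yu') dl.
by rewrite mulr1.
Qed.

Lemma continuous_powR_shift (a y u : R) : y < u ->
  {for u, continuous (fun v => (v - y) `^ a)}.
Proof.
move=> yu; apply/differentiable_continuous/derivable1_diffP.
by have [] := is_derive_powR_shift a y u yu.
Qed.

Lemma measurable_powR_shift (a y : R) (D : set R) : measurable_fun D (fun v => (v - y) `^ a).
Proof.
apply: measurable_funTS; apply: (measurableT_comp (measurable_powR a)).
exact: measurable_funB.
Qed.

(** The fundamental theorem applies on an interval that stays away from the singularity [y]. The
    bound does not depend on [s], so it survives [s] tending to [y]. *)
Lemma integral_powR_shift_le (e y s t : R) : -1 < e -> y < s -> s < t ->
  (\int[mu]_(u in `[s, t]) ((u - y) `^ e)%:E <= ((t - y) `^ (e + 1) / (e + 1))%:E)%E.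
Proof.
move=> e1 ys st; have e10 : 0 < e + 1 by lra.
pose F u := (u - y) `^ (e + 1) / (e + 1).
have dF u : y < u -> is_derive u 1 F ((u - y) `^ e).
  move=> yu; have := is_deriveM (is_derive_powR_shift (e + 1) y u yu) (is_derive_cst (e + 1)^-1 u 1).
  by rewrite scaler0 add0r addrK /= -[X in is_derive _ _ _ X]/(_ * _) mulrA mulVf ?mul1r// gt_eqF.
have cF u : y < u -> {for u, continuous F}.
  move=> yu; apply/differentiable_continuous/derivable1_diffP.
  by have [] := dF u yu.
rewrite (@continuous_FTC2 _ _ F)//.
- rewrite -EFinB lee_fin /F lerBlDr lerDl divr_ge0 ?powR_ge0// ltW//.
- apply: continuous_in_subspaceT => u; rewrite mem_setE in_itv/= => /andP[su _].
  by apply: continuous_powR_shift; exact: lt_le_trans su.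
- split.
  + move=> u; rewrite in_itv/= => /andP[su _].
    by have [] := dF u (lt_trans ys su).
  + by apply: cvg_at_right_filter; exact: cF.
  + by apply: cvg_at_left_filter; apply: cF; exact: lt_trans st.
- move=> u; rewrite in_itv/= => /andP[su _].
  by rewrite derive1E; have [_ ->] := dF u (lt_trans ys su).
Qed.

(** Monotone convergence along intervals increasing to []y, t]], with the bound of
    [integral_powR_shift_le] at every stage. The point [y] itself is negligible. *)
Lemma integrable_powR_shift (e y t : R) : -1 < e ->
  mu.-integrable `[y, t] (EFin \o (fun u => (u - y) `^ e)).
Proof.
move=> e1; apply/integrableP; split.
  by apply/measurable_EFinP; exact: measurable_powR_shift.
under eq_integral do rewrite /= ger0_norm ?powR_ge0//.
rewrite -integral_itv_obnd_cbnd; last first.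
  by apply/measurable_EFinP; exact: measurable_powR_shift.
pose F n : set R := `[y + n.+1%:R^-1, t]%classic.
have -> : `]y, t]%classic = \bigcup_n F n.
  apply/seteqP; split=> [x /=|x [n _]]; rewrite /F /= !in_itv/=.
    move=> /andP[yx xt]; have [n h] := ltr_add_invr yx.
    by exists n => //=; rewrite in_itv/= (ltW h) xt.
  by move=> /andP[h ->]; rewrite andbT (lt_le_trans _ h)// ltrDl invr_gt0.
have ndF : nondecreasing_seq F.
  move=> n m nm; rewrite subsetEset => x; rewrite /F /= !in_itv/= => /andP[h ->]; rewrite andbT.
  by rewrite (le_trans _ h)// lerD2l lef_pV2 ?posrE// ler_nat.
have cF : (\int[mu]_(u in F i) ((u - y) `^ e)%:E @[i --> \oo] -->
    \int[mu]_(u in \bigcup_i F i) ((u - y) `^ e)%:E)%E.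
  apply: ge0_nondecreasing_set_cvg_integral => //.
  - by move=> i; exact: measurable_itv.
  - by move=> i; apply/measurable_EFinP; exact: measurable_powR_shift.
  - by move=> i x _; rewrite lee_fin powR_ge0.
apply: (@le_lt_trans _ _ ((t - y) `^ (e + 1) / (e + 1))%:E); last exact: ltry.
rewrite -(cvg_lim _ cF)//; apply: lime_le; first by apply/cvg_ex; eexists; exact: cF.
apply: nearW => n.
have [h|h] := ltP (y + n.+1%:R^-1) t.
  by apply: integral_powR_shift_le => //; rewrite ltrDl invr_gt0.
apply: (@le_trans _ _ 0%E); last first.
  by rewrite lee_fin divr_ge0 ?powR_ge0//; lra.
rewrite le_eqVlt; apply/orP; left; apply/eqP.
rewrite /F; move: h; rewrite le_eqVlt => /predU1P[->|h].
  by rewrite set_itv1 integral_set1.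
by rewrite set_itv_ge ?integral_set0// bnd_simp -ltNge.
Qed.

End power_singularity.

(** * Sign and domination of the Rosenblatt kernel *)

Section rosenblatt_kernel.
Context {R : realType} (H c : R) (hH0 : 2^-1 < H) (hH1 : H < 1) (hc : 0 < c).
Local Notation mu := (@lebesgue_measure R).
Local Notation H' := ((H + 1) / 2).
Local Notation e := (H' - 3 / 2).
Local Notation b := (H' - 2^-1).

Let e1 : -1 < e. Proof. have h := hH0; lra. Qed.
Let b0 : 0 < b. Proof. have h := hH0; lra. Qed.

Let measurable_integrand (y : R) (D : set R) :
  measurable_fun D (fun u => (u - y) `^ e * u `^ b).
Proof.
apply: measurable_funM; first exact: measurable_powR_shift.
by apply: measurable_funTS; exact: measurable_powR.
Qed.

Let integrable_integrand (y t : R) : 0 <= y ->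
  mu.-integrable `[y, t] (EFin \o (fun u => (u - y) `^ e * u `^ b)).
Proof.
move=> y0.
have it : mu.-integrable `[y, t] (fun u => ((t `^ b)%:E * ((u - y) `^ e)%:E)%E).
  by apply: integrableZl => //; exact: integrable_powR_shift.
apply: le_integrable it => //; first by apply/measurable_EFinP; exact: measurable_integrand.
move=> u; rewrite /= in_itv/= => /andP[yu ut]; rewrite lee_fin !normrM mulrC ler_wpM2r//.
by rewrite !ger0_norm ?powR_ge0//; apply: ge0_ler_powR; rewrite ?nnegrE ?(ltW b0)//; lra.
Qed.

(** The kernel depends on its time only through the upper end of an integral, and the integrand is
    continuous at [u] because [u] lies to the right of the singularity [y]. The closed form shows
    the sign and the order of the singularity. *)
Lemma volterra_kernel_duE (y u : R) : 0 < y -> y < u ->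
  volterra_kernel_du H' c u y = c * y `^ (2^-1 - H') * ((u - y) `^ e * u `^ b).
Proof.
move=> y0 yu; rewrite /volterra_kernel_du /volterra_kernel.
set k := c * _; set f := fun u => _ `^ e * _.
have cf : {for u, continuous f}.
  apply: cvgM; first exact: continuous_powR_shift.
  have := continuous_powR_shift b 0 u (lt_trans y0 yu).
  by rewrite /prop_for /continuous_at; under eq_fun do rewrite subr0; rewrite subr0.
have uu : u < u + 1 by rewrite ltrDl.
have [dF F'] : derivable (fun t : R => \int[mu]_(x in `[y, t]) f x) u 1 /\
    derive1 (fun t : R => \int[mu]_(x in `[y, t]) f x) u = f u.
  by apply: (continuous_FTC1_closed uu) => //; exact: integrable_integrand (ltW y0).
have dkF := is_deriveZ k (DeriveDef dF (esym (derive1E _ _))).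
by rewrite derive1E (@derive_val _ _ _ _ _ _ _ dkF) -/(f u) -F'.
Qed.

(** For [y1 < y2] only the factor with [y2] is singular on the domain; the other one is at most its
    value at [y2], the exponent being negative. On the diagonal the exponents would add up to
    [H - 2 < -1], where the integral diverges. *)
Lemma integrable_kernel_prod (y1 y2 t : R) : 0 < y1 -> 0 < y2 -> y1 != y2 ->
  mu.-integrable `]Num.max y1 y2, t]
    (EFin \o (fun u => volterra_kernel_du H' c u y1 * volterra_kernel_du H' c u y2)).
Proof.
wlog y12 : y1 y2 / y1 < y2 => [hw y10 y20|y10 y20 _].
  rewrite neq_lt => /orP[y12|y21]; first by apply: hw => //; rewrite lt_eqF.
  rewrite maxC; have y21n : y2 != y1 by rewrite lt_eqF.
  have -> : (fun u => volterra_kernel_du H' c u y1 * volterra_kernel_du H' c u y2) =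
            (fun u => volterra_kernel_du H' c u y2 * volterra_kernel_du H' c u y1).
    by apply/funext => u; exact: mulrC.
  exact: hw.
rewrite max_r ?ltW//.
pose k y := c * y `^ (2^-1 - H').
have k0 y : 0 <= k y by rewrite mulr_ge0 ?powR_ge0// ltW.
pose K := k y1 * k y2; have K0 : 0 <= K by exact: mulr_ge0.
pose h u := K * ((u - y1) `^ e * (u - y2) `^ e * u `^ b * u `^ b).
suff ih : mu.-integrable `]y2, t] (EFin \o h).
  apply: eq_integrable ih => // u; rewrite mem_setE in_itv/= => /andP[yu _]; congr EFin.
  by rewrite !volterra_kernel_duE// ?(lt_trans y12)// /h /K /k; ring.
pose C := K * ((y2 - y1) `^ e * t `^ b * t `^ b).
have it : mu.-integrable `]y2, t] (fun u => (C%:E * ((u - y2) `^ e)%:E)%E).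
  have i0 := integrable_powR_shift e y2 t e1.
  apply: integrableZl => //; apply: integrableS i0 => //.
  by apply: subset_itv; rewrite bnd_simp.
apply: le_integrable it => //.
  apply/measurable_EFinP; apply: measurable_funM => //.
  by do 2 (apply: measurable_funM; last by apply: measurable_funTS; exact: measurable_powR);
    apply: measurable_funM; exact: measurable_powR_shift.
move=> u; rewrite /= in_itv/= => /andP[yu ut]; rewrite lee_fin /h /C.
have h1 : (u - y1) `^ e <= (y2 - y1) `^ e.
  have eN : e = - (3 / 2 - H') by lra.
  rewrite eN !powRN lef_pV2 ?posrE ?powR_gt0 ?subr_gt0//; last by rewrite (lt_trans y12).
  apply: ge0_ler_powR; rewrite ?nnegrE; [have hH := hH1|..]; lra.
have h2 : u `^ b <= t `^ b.
  by apply: ge0_ler_powR; rewrite ?nnegrE ?(ltW b0)//; lra.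
rewrite ger0_norm; last first.
  by apply: mulr_ge0 => //; do 3 (apply: mulr_ge0; last exact: powR_ge0); exact: powR_ge0.
rewrite ger0_norm; last first.
  apply: mulr_ge0; last exact: powR_ge0.
  by apply: mulr_ge0 => //; do 2 (apply: mulr_ge0; last exact: powR_ge0); exact: powR_ge0.
rewrite -[leRHS]mulrA; apply: ler_wpM2l => //.
rewrite -!mulrA [X in _ * X]mulrC; apply: ler_pM; rewrite ?mulr_ge0 ?powR_ge0//.
rewrite mulrA; apply: ler_wpM2r; first exact: powR_ge0.
by apply: ler_pM; rewrite ?powR_ge0.
Qed.

Lemma volterra_kernel_du_ge0 (y u : R) : 0 < y -> y < u -> 0 <= volterra_kernel_du H' c u y.
Proof.
by move=> y0 yu; rewrite volterra_kernel_duE// !mulr_ge0 ?powR_ge0// ltW.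
Qed.

Lemma rosenblatt_kernel_swap (g : R -> R) (t : R) :
  rosenblatt_kernel H c g t \o @swap R = rosenblatt_kernel H c g t.
Proof.
apply/funext => -[y1 y2]; rewrite /rosenblatt_kernel /swap /= maxC.
rewrite (_ : \1__ (y2, y1) = \1_(`[0, t] `*` `[0, t]) (y1, y2)); last first.
  by rewrite !indicE !in_setX andbC.
apply: (congr1 (fun x => \1_(`[0, t] `*` `[0, t]) (y1, y2) * x)).
by apply: eq_Rintegral => u _; exact: mulrAC.
Qed.

(** The points at which the inner integral converges and the formula for the derivative of the
    Volterra kernel applies. Convergence matters, since a real-valued integral takes a default value
    otherwise. *)
Let regular (y : R * R) : Prop := [/\ y.1 != y.2, 0 < y.1 & 0 < y.2].

Lemma rosenblatt_kernel_bound_at (M t : R) (g : R -> R) (y : R * R) :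
  measurable_fun setT g -> (forall u, 0 < u <= t -> `|g u| <= M) -> regular y ->
  `|rosenblatt_kernel H c g t y| <= M * rosenblatt_kernel H c (cst 1) t y.
Proof.
move=> mg gM [y12 y10 y20]; rewrite /rosenblatt_kernel normrM [`|\1__ _|]ger0_norm// mulrCA.
apply: ler_wpM2l => //.
set D := [set` _]; pose k u := volterra_kernel_du H' c u y.1 * volterra_kernel_du H' c u y.2.
have mD : measurable D by exact: measurable_itv.
have ik : mu.-integrable D (EFin \o k) by exact: integrable_kernel_prod.
have Dy u : D u -> [/\ y.1 < u, y.2 < u & u <= t].
  by rewrite /D /= in_itv/= gt_max => /andP[/andP[-> ->] ->].
have k0 u : D u -> 0 <= k u.
  by move=> /Dy[h1 h2 _]; rewrite mulr_ge0// volterra_kernel_du_ge0.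
have gMD u : D u -> `|g u| <= M by move=> /Dy[h1 _ ut]; rewrite gM// ut (lt_trans y10).
under [X in `|X|]eq_Rintegral do rewrite -mulrA -/(k _).
under [X in _ * X]eq_Rintegral do rewrite mul1r -/(k _).
have iMk : mu.-integrable D (fun u => (M%:E * (k u)%:E)%E) by exact: integrableZl.
have mk : measurable_fun D k by apply/measurable_EFinP; exact: measurable_int ik.
have igk : mu.-integrable D (EFin \o (fun u => g u * k u)).
  apply: le_integrable iMk => //.
    by apply/measurable_EFinP; apply: measurable_funM => //; exact: measurable_funTS.
  by move=> u Du; rewrite /= lee_fin !normrM ler_wpM2r// (le_trans (gMD _ Du) (ler_norm _)).
have hle : `|\int[mu]_(u in D) (g u * k u)| <= \int[mu]_(u in D) `|g u * k u|.
  exact: le_normr_Rintegral.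
apply: (le_trans hle).
have inorm : mu.-integrable D (EFin \o (fun u => `|g u * k u|)) by exact: integrable_norm.
rewrite -RintegralZl//; apply: le_Rintegral => //.
by move=> u Du; rewrite normrM (ger0_norm (k0 _ Du)) ler_wpM2r ?k0// gMD.
Qed.

Lemma rosenblatt_kernel_ge0_at (t : R) (g : R -> R) (y : R * R) :
  (forall u, 0 <= g u) -> regular y -> 0 <= rosenblatt_kernel H c g t y.
Proof.
move=> g0 [_ y10 y20]; rewrite /rosenblatt_kernel mulr_ge0//.
apply: Rintegral_ge0 => u; rewrite /= in_itv/= gt_max => /andP[/andP[h1 h2] _].
by rewrite !mulr_ge0// volterra_kernel_du_ge0.
Qed.

Local Notation leb2 := ((@lebesgue_measure R \x @lebesgue_measure R)%E).

Let measurable_diag : measurable [set y : R * R | y.1 = y.2].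
Proof.
rewrite (_ : [set y : R * R | y.1 = y.2] = (fun y => y.1 - y.2) @^-1` [set 0]).
  rewrite -[X in measurable X]setTI.
  by apply: (measurable_funB measurable_fst measurable_snd).
by apply/seteqP; split => y /=; [move=> ->; rewrite subrr|move/eqP; rewrite subr_eq0 => /eqP].
Qed.

Let diag_null : leb2 [set y : R * R | y.1 = y.2] = 0%E.
Proof.
rewrite /product_measure1 integral0_eq// => x _ /=.
rewrite (_ : xsection _ _ = [set x]) ?lebesgue_measure_set1//.
by apply/seteqP; split => z; rewrite /xsection /= inE.
Qed.

Let axis1_null : leb2 ([set (0%R : R)] `*` setT) = 0%E.
Proof.
transitivity (lebesgue_measure [set (0%R : R)] * lebesgue_measure [set: R])%E.
  exact: product_measure1E.
by rewrite lebesgue_measure_set1 mul0e.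
Qed.

Let axis2_null : leb2 (setT `*` [set (0%R : R)]) = 0%E.
Proof.
transitivity (lebesgue_measure [set: R] * lebesgue_measure [set (0%R : R)])%E.
  exact: product_measure1E.
by rewrite lebesgue_measure_set1 mule0.
Qed.

(** Outside [[0, t]^2] the kernel is cut off by its indicator. Inside, the exceptional points lie on
    the diagonal or on an axis, three null sets. *)
Let ae_regular (t : R) : {ae leb2, forall y,
  regular y \/ \1_(`[0, t] `*` `[0, t]) y = 0 :> R}.
Proof.
have m1 : measurable ([set (0 : R)] `*` [set: R]) by exact: measurableX.
have m2 : measurable ([set: R] `*` [set (0 : R)]) by exact: measurableX.
exists ([set y : R * R | y.1 = y.2] `|` ([set 0] `*` setT) `|` (setT `*` [set 0])).
split.
- apply: measurableU => //; exact: measurableU.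
- rewrite measureU0//; last exact: measurableU.
  rewrite measureU0//; exact: diag_null.
move=> [y1 y2] /= /not_orP[] /= nreg /eqP; rewrite indicE pnatr_eq0 eqb0 negbK in_setX /= => /andP[].
rewrite !mem_setE !in_itv/= => /andP[h1 _] /andP[h2 _].
apply: contrapT => /not_orP[/not_orP[d a1] a2]; apply: nreg; split => /=.
- by apply/eqP.
- by rewrite lt_neqAle h1 andbT; apply/eqP => h; apply: a1; split.
- by rewrite lt_neqAle h2 andbT; apply/eqP => h; apply: a2; split.
Qed.

Lemma rosenblatt_kernel_bound (M t : R) (g : R -> R) :
  measurable_fun setT g -> (forall u, 0 < u <= t -> `|g u| <= M) ->
  {ae leb2, forall y, `|rosenblatt_kernel H c g t y| <= M * rosenblatt_kernel H c (cst 1) t y}.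
Proof.
move=> mg gM; apply: ae_filterS (ae_regular t) => y [ry|y0].
  exact: rosenblatt_kernel_bound_at.
by rewrite /rosenblatt_kernel y0 !mul0r mulr0 normr0.
Qed.

Lemma rosenblatt_kernel_ge0 (t : R) (g : R -> R) : (forall u, 0 <= g u) ->
  {ae leb2, forall y, 0 <= rosenblatt_kernel H c g t y}.
Proof.
move=> g0; apply: ae_filterS (ae_regular t) => y [ry|y0].
  exact: rosenblatt_kernel_ge0_at.
by rewrite /rosenblatt_kernel y0 mul0r.
Qed.

End rosenblatt_kernel.

(** * Time integrals of a square-integrable random field *)

Section time_integral.
Context {d1 d2 : measure_display} {S : measurableType d1} {T : measurableType d2} {R : realType}.
Context (nu : {sigma_finite_measure set S -> \bar R}) (P : probability T R).
Context (U : S * T -> R) (LU : sqintegrable (nu \x P)%E U).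
Context (LUs : forall s, sqintegrable P (fun w => U (s, w))).

Definition time_integral (g : S -> R) (w : T) : R := \int[nu]_s (g s * U (s, w)).

Lemma sqintegrable_tensor (g : S -> R) (Y : T -> R) : sqintegrable nu g -> sqintegrable P Y ->
  sqintegrable (nu \x P)%E (fun z => g z.1 * Y z.2).
Proof.
move=> Lg LY.
have mgY : measurable_fun setT (fun z : S * T => g z.1 * Y z.2).
  apply: measurable_funM; first exact: measurableT_comp Lg.1 measurable_fst.
  exact: measurableT_comp LY.1 measurable_snd.
apply: sqintegrable_lty => //.
rewrite (fubini_tonelli1 (EFin \o (fun z : S * T => (g z.1 * Y z.2) ^+ 2)))//; last 2 first.
- by apply/measurable_EFinP; exact: measurable_funX.
- by move=> z; rewrite /= lee_fin sqr_ge0.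
rewrite /fubini_F /=.
under eq_integral => s _ do under eq_integral => w _ do rewrite exprMn EFinM.
under eq_integral => s _.
  rewrite ge0_integralZl//; [|by apply/measurable_EFinP; apply: measurable_funX; exact: LY.1|
    by move=> w _; rewrite lee_fin sqr_ge0|by rewrite lee_fin sqr_ge0].
  rewrite (dotL2_sq _ _ LY) muleC; over.
rewrite /= ge0_integralZl//; last 3 first.
- by apply/measurable_EFinP; apply: measurable_funX; exact: Lg.1.
- by move=> w _; rewrite lee_fin sqr_ge0.
- by rewrite lee_fin dotL2_ge0.
by rewrite dotL2_sq// -EFinM ltry.
Qed.

Lemma integrable_tensor (g : S -> R) (Y : T -> R) : sqintegrable nu g -> sqintegrable P Y ->
  (nu \x P)%E.-integrable setT (fun z => (g z.1 * Y z.2 * U z)%:E).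
Proof. by move=> Lg LY; apply: integrable_mul_sq => //; exact: sqintegrable_tensor. Qed.

Lemma sqintegrable_cst (r : R) : sqintegrable P (cst r).
Proof.
split => //; apply: (eq_integrable measurableT (EFin \o cst (r ^+ 2))) => //.
exact: finite_measure_integrable_cst.
Qed.

Let integrable_gU (g : S -> R) : sqintegrable nu g ->
  (nu \x P)%E.-integrable setT (fun z => (g z.1 * U z)%:E).
Proof.
move=> Lg; apply: eq_integrable (integrable_tensor g (cst 1) Lg (sqintegrable_cst 1)) => //.
by move=> z _; rewrite /= mulr1.
Qed.

Lemma measurable_time_integral (g : S -> R) : sqintegrable nu g ->
  measurable_fun setT (time_integral g).
Proof.
move=> Lg; have := measurable_fubini_G (integrable_gU g Lg).
by move=> h; apply: measurableT_comp h.
Qed.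

Let ae_sqintegrable_section : {ae P, forall w, sqintegrable nu (fun s => U (s, w))}.
Proof.
have := ae_integrable2 LU.2; apply: ae_filterS => w; split; last by [].
exact: measurableT_comp LU.1 (measurable_pair2 w).
Qed.

(** Cauchy-Schwarz in time, for almost every [w], bounds the square by the square norm of [g] times
    that of the path; the latter has finite expectation by Tonelli. *)
Lemma sqintegrable_time_integral (g : S -> R) : sqintegrable nu g ->
  sqintegrable P (time_integral g).
Proof.
move=> Lg; have mV := measurable_time_integral g Lg.
apply: sqintegrable_lty => //.
have mU2 : measurable_fun setT (EFin \o (fun z => U z ^+ 2)).
  by apply/measurable_EFinP; apply: measurable_funX; exact: LU.1.
have U20 z : (0 <= ((U z ^+ 2)%:E : \bar R))%E by rewrite lee_fin sqr_ge0.
apply: (@le_lt_trans _ _ (\int[P]_w ((dotL2 nu g g)%:E * \int[nu]_s (U (s, w) ^+ 2)%:E))%E).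
  apply: ae_ge0_le_integral => //.
  - by move=> w _; rewrite lee_fin sqr_ge0.
  - by apply/measurable_EFinP; exact: measurable_funX.
  - move=> w _; rewrite mule_ge0 ?lee_fin ?dotL2_ge0//.
    by apply: integral_ge0 => s _; rewrite lee_fin sqr_ge0.
  - by apply: measurable_funeM; exact: (measurable_fun_fubini_tonelli_G _ mU2 U20).
  - apply: ae_filterS ae_sqintegrable_section => w Lw _.
    by rewrite dotL2_sq// -EFinM lee_fin; exact: dotL2_CauchySchwarz.
rewrite ge0_integralZl//; last 3 first.
- exact: (measurable_fun_fubini_tonelli_G _ mU2 U20).
- by move=> w _; apply: integral_ge0 => s _; rewrite lee_fin sqr_ge0.
- by rewrite lee_fin dotL2_ge0.
have := fubini_tonelli2 _ mU2 U20; rewrite /fubini_G/= => <-.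
by rewrite dotL2_sq// -EFinM ltry.
Qed.

(** Fubini for [g s * Y w * U (s, w)], integrable on the product space as a product of two
    square-integrable functions. *)
Lemma integrable_time_dotL2 (g : S -> R) (Y : T -> R) : sqintegrable nu g -> sqintegrable P Y ->
  nu.-integrable setT (EFin \o (fun s => g s * dotL2 P Y (fun w => U (s, w)))) /\
  dotL2 P Y (time_integral g) = \int[nu]_s (g s * dotL2 P Y (fun w => U (s, w))).
Proof.
move=> Lg LY; have ip := integrable_tensor g Y Lg LY.
have E s : (\int[P]_w (g s * Y w * U (s, w))%:E = (g s * dotL2 P Y (fun w => U (s, w)))%:E)%E.
  rewrite EFinM EFin_dotL2// -integralZl//; last exact: integrable_mul_sq.
  by apply: eq_integral => w _; rewrite -EFinM mulrA.
split.
  by apply: eq_integrable (integrable_fubini_F ip) => // s _; rewrite /fubini_F /= E.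
congr fine; transitivity (\int[P]_w \int[nu]_s (g s * Y w * U (s, w))%:E)%E; last first.
  have := Fubini ip => /= <-; by apply: eq_integral => s _; rewrite E.
apply: ae_eq_integral => //.
- apply/measurable_EFinP; apply: measurable_funM; first exact: LY.1.
  exact: measurable_time_integral.
- exact: (measurable_fubini_G ip).
apply: ae_filterS ae_sqintegrable_section => w Lw _.
rewrite EFinM /time_integral -/(dotL2 nu g (fun s => U (s, w))) EFin_dotL2// -integralZl//; last exact: integrable_mul_sq.
by apply: eq_integral => s _; rewrite -EFinM mulrA (mulrC (Y w)).
Qed.

(** The second moment is the double integral of g(s) g(t) against the covariance, and with
    nonnegative covariances [g] may be dominated in each variable. The two variables are treated in
    turn: first against a fixed [U (s, _)], then against the time integral itself. This yields one
    factor [M] each. *)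
Lemma le_dotL2_time_integral (M : R) (g h : S -> R) : 0 <= M ->
  sqintegrable nu g -> sqintegrable nu h -> (forall s, `|g s| <= M * h s) ->
  (forall s t, 0 <= dotL2 P (fun w => U (s, w)) (fun w => U (t, w))) ->
  dotL2 P (time_integral g) (time_integral g) <=
  M ^+ 2 * dotL2 P (time_integral h) (time_integral h).
Proof.
move=> M0 Lg Lh gh U0.
have LV := sqintegrable_time_integral.
have [ig Eg] := integrable_time_dotL2 _ _ Lg (LV _ Lg).
have [ih Eh] := integrable_time_dotL2 _ _ Lh (LV _ Lh).
have a_le s : `|dotL2 P (time_integral g) (fun w => U (s, w))| <=
              M * dotL2 P (time_integral h) (fun w => U (s, w)).
  rewrite dotL2C [in leRHS]dotL2C.
  have [igs ->] := integrable_time_dotL2 _ _ Lg (LUs s).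
  have [ihs ->] := integrable_time_dotL2 _ _ Lh (LUs s).
  apply: (le_trans (le_normr_Rintegral measurableT igs)).
  rewrite -RintegralZl//; apply: le_Rintegral => //.
  - exact: (integrable_norm igs).
  - exact: (integrableZl measurableT M ihs).
  - move=> t _; rewrite normrM (ger0_norm (U0 _ _)) mulrA ler_wpM2r//.
apply: (le_trans (ler_norm _)); rewrite Eg.
apply: (le_trans (le_normr_Rintegral measurableT ig)).
rewrite Eh -RintegralZl//; apply: le_Rintegral => //.
- exact: (integrable_norm ig).
- exact: (integrableZl measurableT (M ^+ 2) ih).
move=> s _; rewrite normrM expr2 mulrACA; apply: ler_pM => //.
Qed.

End time_integral.

(** * Integrals over intervals, translation and periodicity *)

Section real_line_integrals.
Context {R : realType}.
Local Notation mu := (@lebesgue_measure R).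

Lemma integrable_itv_bounded (a b M : R) (f : R -> R) :
  measurable_fun `[a, b] f -> (forall x, a <= x <= b -> `|f x| <= M) ->
  mu.-integrable `[a, b] (EFin \o f).
Proof.
move=> mf fM; apply: measurable_bounded_integrable => //.
  have := lebesgue_measure_itv `[a, b]; rewrite /= => ->.
  by case: ifP => _; rewrite ltry.
exists M; split; first exact: num_real.
move=> y My x /=; rewrite in_itv/= => xab; exact: le_trans (fM _ xab) (ltW My).
Qed.

Lemma Rintegral_itv_cat (a b c : R) (f : R -> R) : a <= b -> b <= c ->
  mu.-integrable `[a, c] (EFin \o f) ->
  \int[mu]_(x in `[a, c]) f x = \int[mu]_(x in `[a, b]) f x + \int[mu]_(x in `[b, c]) f x.
Proof.
move=> ab bc fi; have := @Rintegral_itvB _ f (BLeft a) (BRight c) b fi.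
rewrite !bnd_simp => /(_ ab bc) h.
have fbc : mu.-integrable `]b, c] (EFin \o f).
  apply: integrableS fi => //; by apply: subset_itv; rewrite !bnd_simp.
by rewrite -(Rintegral_itv_obnd_cbnd fbc) -h addrC subrK.
Qed.

Lemma lebesgue_measure_shift (a : R) (A : set R) : measurable A ->
  pushforward mu ((fun x => x + a) : measurableTypeR R -> measurableTypeR R) A = mu A.
Proof.
have mS : measurable_fun [set: measurableTypeR R]
    ((fun x => x + a) : measurableTypeR R -> measurableTypeR R).
  have h : measurable_fun [set: R] (fun x : R => x + a) by exact: measurable_funD.
  exact: h.
move=> mA; apply/esym/lebesgue_measure_unique => //= _ [[r s]] _ <-.
rewrite /pushforward (_ : _ @^-1` _ = `]r - a, s - a]%classic).
  by rewrite !lebesgue_measure_itv/= !lte_fin ltrD2r -!EFinB (_ : s - a - (r - a) = s - r)//; ring.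
by apply/seteqP; split => x /=; rewrite !in_itv/= lerBrDr ltrBlDr.
Qed.

Lemma Rintegral_shift (a : R) (D : set R) (f : R -> R) :
  measurable D -> measurable_fun D f ->
  mu.-integrable ((fun x => x + a) @^-1` D) (EFin \o (fun x => f (x + a))) ->
  \int[mu]_(y in D) f y = \int[mu]_(x in (fun x => x + a) @^-1` D) f (x + a).
Proof.
move=> mD mf fi.
have mS : measurable_fun [set: measurableTypeR R]
    ((fun x => x + a) : measurableTypeR R -> measurableTypeR R).
  have h : measurable_fun [set: R] (fun x : R => x + a) by exact: measurable_funD.
  exact: h.
have mfD : measurable_fun setT (f \_ D) by apply/(measurable_restrictT _ _).1.
transitivity (\int[mu]_(y in D) (f \_ D) y).
  by apply: eq_Rintegral => y yD; rewrite patchE yD.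
transitivity (\int[mu]_(x in (fun x => x + a) @^-1` D) (f \_ D) (x + a)); last first.
  by apply: eq_Rintegral => y /set_mem yD; rewrite patchE mem_set.
congr fine.
rewrite [LHS](eq_measure_integral (pushforward mu ((fun x => x + a) : measurableTypeR R -> measurableTypeR R))).
  apply: (integral_pushforward mS); [by apply/measurable_EFinP| |exact: mD].
  apply: eq_integrable fi; last by move=> y /set_mem yD; rewrite /= patchE mem_set.
  by rewrite -[X in measurable X]setTI; exact: mS.
by move=> A mA _; exact/esym/lebesgue_measure_shift.
Qed.

Lemma Rintegral_periodic (f : R -> R) (n : nat) : periodic f 1 ->
  (forall n : nat, mu.-integrable `[0, n%:R] (EFin \o f)) ->
  \int[mu]_(x in `[0, n%:R]) f x = n%:R * \int[mu]_(x in `[0, 1]) f x.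
Proof.
move=> fper fi; elim: n => [|n ih]; first by rewrite set_itv1 Rintegral_set1 mul0r.
have n1 : n%:R <= n.+1%:R :> R by rewrite ler_nat.
rewrite (Rintegral_itv_cat 0 n%:R)// ih.
rewrite -[n.+1]addn1 natrD mulrDl mul1r; congr (_ + _).
have E : (fun x => x + n%:R) @^-1` `[n%:R, n%:R + 1] = `[0, 1]%classic :> set R.
  by apply/seteqP; split => x /=; rewrite !in_itv/= lerDr [x + _]addrC lerD2l.
have fn x : f (x + n%:R) = f x by rewrite -[n%:R]/(1 *+ n) periodicn.
rewrite (Rintegral_shift n%:R)// ?E.
- by apply: eq_Rintegral => x _; rewrite fn.
- have : mu.-integrable `[n%:R, n%:R + 1] (EFin \o f).
    by apply: integrableS (fi n.+1) => //; apply: subset_itv; rewrite bnd_simp ?ler0n// -natr1.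
  by move=> /measurable_int/measurable_EFinP.
- by apply: eq_integrable (fi 1) => // x _; rewrite /= fn.
Qed.

Lemma integrable_setU (A D : set R) (f : R -> R) : measurable A -> measurable D ->
  [disjoint A & D] ->
  mu.-integrable A (EFin \o f) -> mu.-integrable D (EFin \o f) ->
  mu.-integrable (A `|` D) (EFin \o f).
Proof.
move=> mA mD AD /integrableP[mfA fA] /integrableP[mfD fD].
have mf : measurable_fun (A `|` D) (EFin \o f) by rewrite measurable_funU.
apply/integrableP; split => //.
rewrite ge0_integral_setU//; first by rewrite lte_add_pinfty.
exact: measurableT_comp.
Qed.

End real_line_integrals.

(** * Integrals of exponentials *)

Section exponential_integrals.
Context {R : realType} (alpha : R) (alpha0 : 0 < alpha).
Local Notation mu := (@lebesgue_measure R).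

Lemma continuous_expRM (k : R) : continuous (fun x : R => expR (k * x)).
Proof.
move=> x; apply: continuous_comp; last exact: continuous_expR.
exact: mulrl_continuous.
Qed.

Lemma measurable_expRM (k : R) (D : set R) : measurable_fun D (fun x : R => expR (k * x)).
Proof.
by apply: measurable_funTS; apply: continuous_measurable_fun; exact: continuous_expRM.
Qed.

Lemma integrable_expRM (k a b : R) : mu.-integrable `[a, b] (EFin \o (fun x => expR (k * x))).
Proof.
apply: continuous_compact_integrable; first exact: segment_compact.
by apply: continuous_subspaceT; exact: continuous_expRM.
Qed.

Lemma Rintegral_expRN (a b : R) : a <= b ->
  \int[mu]_(x in `[a, b]) expR (- alpha * x) = (expR (- alpha * a) - expR (- alpha * b)) / alpha.
Proof.
rewrite le_eqVlt => /predU1P[->|ab].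
  by rewrite set_itv1 Rintegral_set1 subrr mul0r.
pose F (x : R) : R := - expR (- alpha * x) / alpha.
have dF (x : R) : is_derive x 1 F (expR (- alpha * x)).
  have h1 : is_derive x 1 (fun x => - alpha * x) (- alpha).
    by have := is_deriveZ (- alpha) (is_derive_id x 1); rewrite /= scaler1.
  have h2 := @is_derive1_comp _ (@expR R) (fun x => - alpha * x) x _ _ (is_derive_expR _) h1.
  have := is_deriveZ (- alpha^-1) h2.
  have -> : - alpha^-1 *: (expR (- alpha * x) * - alpha) = expR (- alpha * x).
    by rewrite /GRing.scale/=; field; rewrite gt_eqF.
  suff -> : F = - alpha^-1 \*: (@expR R \o (fun x => - alpha * x)) by [].
  apply/funext => z; rewrite /F -[RHS]/(- alpha^-1 * expR (- alpha * z)).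
  by rewrite !mulNr (mulrC (expR _)).
have cF x : {for x, continuous F}.
  by apply/differentiable_continuous/derivable1_diffP; have [] := dF x.
rewrite /Rintegral (@continuous_FTC2 _ _ F)//.
- by rewrite /= /F; field; rewrite gt_eqF.
- by apply: continuous_subspaceT; exact: continuous_expRM.
- split.
  + by move=> x _; have [] := dF x.
  + by apply: cvg_at_right_filter; exact: cF.
  + by apply: cvg_at_left_filter; exact: cF.
- by move=> x _; rewrite derive1E; have [_ ->] := dF x.
Qed.

(** Reflection turns the half-line up to 0 into the domain of the exponential law, whose density is
    [alpha] times the integrand. The remaining piece up to [t] is bounded. *)
Lemma integrable_expR_Ny (t : R) : mu.-integrable `]-oo, t] (EFin \o (fun x => expR (alpha * x))).
Proof.
have h0 : mu.-integrable `]-oo, 0] (EFin \o (fun x => expR (alpha * x))).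
  apply/integrableP; split; first by apply/measurable_EFinP; exact: measurable_expRM.
  under eq_integral do rewrite /= ger0_norm ?expR_ge0//.
  pose f x := (expR (- alpha * x))%:E.
  have mf : measurable_fun setT f by apply/measurable_EFinP; exact: measurable_expRM.
  have f0 x : (0 <= f x)%E by rewrite lee_fin expR_ge0.
  have := ge0_integration_by_substitution0 mf f0.
  rewrite /f; under [X in _ = X]eq_integral do rewrite mulrNN.
  move=> <-; apply: (@le_lt_trans _ _ (\int[mu]_(x in `[0%R, +oo[) (alpha^-1 * exponential_pdf alpha x)%:E)%E).
    apply: ge0_le_integral => //.
    - by apply: (measurable_funS _ _ mf).
    - apply/measurable_EFinP; apply: measurable_funM => //.
      by apply: measurable_funTS; exact: measurable_exponential_pdf.
    - move=> x; rewrite /= in_itv/= andbT => x0; rewrite lee_fin exponential_pdfE//.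
      by rewrite mulrA mulVf ?gt_eqF// mul1r.
  apply: integrable_lty => //.
  apply: (integrableS measurableT) => //.
  have h : mu.-integrable setT (fun x => (alpha^-1)%:E * (exponential_pdf alpha x)%:E)%E.
    by apply: integrableZl => //; exact: integrable_exponential_pdf.
  by apply: eq_integrable h => // x _; rewrite -EFinM.
have [t0|t0] := leP t 0.
  by apply: integrableS h0 => //; apply: subset_itv; rewrite ?bnd_simp.
have -> : `]-oo, t]%classic = `]-oo, 0] `|` `]0, t] :> set R.
  by rewrite -itv_bndbnd_setU// bnd_simp ltW.
apply: integrable_setU => //.
  rewrite disj_set2E; apply/eqP; rewrite -subset0 => x [] /=; rewrite !in_itv/=.
  by move=> x0 /andP[]; rewrite ltNge x0.
by apply: integrableS (integrable_expRM alpha 0 t) => //; apply: subset_itv; rewrite bnd_simp.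
Qed.

End exponential_integrals.

(** * The deterministic part of the solution *)

Section ou_mean.
Context {R : realType} (alpha : R) (alpha0 : 0 < alpha).
Context (L : R -> R) (mL : measurable_fun setT L) (ML : R) (LM : forall x, `|L x| <= ML).
Local Notation mu := (@lebesgue_measure R).

(** The part of the explicit solution without noise. Subtracting it from [X t] leaves exp (- alpha
    t) times a Rosenblatt integral. *)
Definition ou_mean (t : R) : R :=
  expR (- alpha * t) * \int[mu]_(s in `[0, t]) (expR (alpha * s) * L s).

Let ML0 : 0 <= ML. Proof. exact: le_trans (normr_ge0 _) (LM 0). Qed.

Lemma measurable_expRL (k : R) (D : set R) : measurable_fun D (fun s => expR (k * s) * L s).
Proof.
by apply: measurable_funM; [exact: measurable_expRM|exact: measurable_funTS].
Qed.

Lemma integrable_expRL (a b : R) : mu.-integrable `[a, b] (EFin \o (fun s => expR (alpha * s) * L s)).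
Proof.
apply: (integrable_itv_bounded _ _ (expR (alpha * b) * ML)); first exact: measurable_expRL.
move=> x /andP[_ xb]; rewrite normrM ger0_norm ?expR_ge0//.
by apply: ler_pM => //; rewrite ?expR_ge0// ler_expR ler_pM2l.
Qed.

Lemma ou_mean_le (t : R) : 0 <= t -> `|ou_mean t| <= ML * t.
Proof.
move=> t0; rewrite /ou_mean normrM ger0_norm ?expR_ge0//.
have h : `|\int[mu]_(s in `[0, t]) (expR (alpha * s) * L s)| <= expR (alpha * t) * ML * t.
  apply: (le_trans (le_normr_Rintegral _ (integrable_expRL 0 t))) => //.
  apply: (@le_trans _ _ (\int[mu]_(s in `[0, t]) (expR (alpha * t) * ML))).
    apply: le_Rintegral => //.
    - exact: (integrable_norm (integrable_expRL 0 t)).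
    - by apply: (integrable_itv_bounded _ _ `|expR (alpha * t) * ML|).
    - move=> s; rewrite /= in_itv/= => /andP[_ st]; rewrite normrM ger0_norm ?expR_ge0//.
      by apply: ler_pM => //; rewrite ?expR_ge0// ler_expR ler_pM2l.
  rewrite Rintegral_cst//= lebesgue_measure_itv/= lte_fin.
  move: t0; rewrite le_eqVlt => /predU1P[<-|t0]; first by rewrite ltxx mulr0.
  by rewrite t0 -EFinB/= subr0.
apply: (le_trans (ler_wpM2l (expR_ge0 _) h)).
by rewrite !mulrA -expRD mulNr addrC subrr expR0 mul1r.
Qed.

Section fubini.
Context (N : R) (N0 : 0 <= N).

(** The triangle 0 <= s <= t <= N, with [z = (t, s)]. *)
Let A : set (R * R) := [set z | [/\ 0 <= z.2, z.2 <= z.1 & z.1 <= N]].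

Let mA : measurable A.
Proof.
rewrite (_ : A = ((fun z : R * R => z.1 - z.2) @^-1` `[0, +oo[) `&` (`[0, N] `*` `[0, N])).
  apply: measurableI; last by apply: measurableX.
  rewrite -[X in measurable X]setTI.
  by apply: (measurable_funB measurable_fst measurable_snd).
apply/seteqP; split => -[t s]; rewrite /A /= !in_itv/= andbT subr_ge0.
  by move=> [s0 st tN]; rewrite st s0 tN (le_trans st tN) (le_trans s0 st).
by move=> [st [/andP[_ tN] /andP[s0 _]]].
Qed.

Let phi (z : R * R) : R := \1_A z * (expR (alpha * (z.2 - z.1)) * L z.2).

Let mphi : measurable_fun setT phi.
Proof.
apply: measurable_funM; first exact: measurable_indic.
apply: measurable_funM; last exact: measurableT_comp mL measurable_snd.
apply: measurableT_comp => //; apply: measurable_funM => //.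
exact: measurable_funB.
Qed.

Local Notation leb2 := ((@lebesgue_measure R \x @lebesgue_measure R)%E).

Let iphi : leb2.-integrable setT (EFin \o phi).
Proof.
have mS : measurable (`[0, N]%classic `*` `[0, N]%classic : set (R * R)) by apply: measurableX.
have iS : leb2.-integrable setT (fun z : R * R => (ML%:E * (\1_(`[0, N] `*` `[0, N]) z)%:E)%E).
  apply: integrableZl => //; apply/integrableP; split; first exact/measurable_EFinP.
  under eq_integral do rewrite gee0_abs ?lee_fin//.
  rewrite integral_indic// setIT.
  apply: (@le_lt_trans _ _ (lebesgue_measure `[0%R, N]%classic * lebesgue_measure `[0%R, N]%classic)%E).
    by rewrite le_eqVlt; apply/orP; left; apply/eqP; exact: product_measure1E.
  rewrite !lebesgue_measure_itv/=; case: ifP => _; last by rewrite mule0.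
  by rewrite -EFinB -EFinM ltry.
apply: le_integrable iS => //; first exact/measurable_EFinP.
move=> [t s] _; rewrite /= lee_fin /phi !normrM (ger0_norm ML0) mulrC.
rewrite (ger0_norm (expR_ge0 _)) /=; have [/set_mem [s0 st tN]|h] := boolP ((t, s) \in A).
  rewrite !indicE (mem_set (_ : A (t, s)))// mem_set/=; last first.
    by split; rewrite /= in_itv/= ?s0 ?tN ?(le_trans st tN)// (le_trans s0 st).
  rewrite normr1 !mulr1 -[leRHS]mul1r; apply: ler_pM; rewrite ?expR_ge0//.
  by rewrite -expR0 ler_expR pmulr_rle0// subr_le0.
by rewrite !indicE (negbTE h) normr0 mulr0 mulr_ge0.
Qed.

Let phiF (t : R) : (\int[mu]_s (phi (t, s))%:E)%E = ((ou_mean \_ `[0, N]) t)%:E.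
Proof.
rewrite patchE; case: ifPn => [|tN]; last first.
  rewrite integral0_eq// => s _; rewrite /phi indicE memNset ?mul0r// => -[/= s0 st tN'].
  by move/negP: tN; apply; rewrite mem_setE in_itv/= tN' (le_trans s0 st).
rewrite mem_setE in_itv/= => /andP[t0 tN].
have ie : mu.-integrable `[0, t] (EFin \o (fun s => expR (- alpha * t) * (expR (alpha * s) * L s))).
  have h : mu.-integrable `[0, t] (fun s => ((expR (- alpha * t))%:E * (expR (alpha * s) * L s)%:E)%E).
    by apply: integrableZl => //; exact: integrable_expRL.
  by apply: eq_integrable h => // s _; rewrite -EFinM.
rewrite /ou_mean -RintegralZl//; last exact: integrable_expRL.
rewrite fineK; last exact: integrable_fin_num.
rewrite [RHS]integral_mkcond; apply: eq_integral => s _.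
rewrite patchE /phi indicE mem_setE in_itv/=.
have -> : ((t, s) \in A) = (0 <= s <= t).
  apply/idP/idP => [/set_mem [s0 st _]|/andP[s0 st]]; first by rewrite s0 st.
  by apply/mem_set; split.
case: (0 <= s <= t); last by rewrite mul0r.
by rewrite mul1r mulrA -expRD; congr (expR _ * _)%:E; rewrite /=; ring.
Qed.

Let phiG (s : R) : (\int[mu]_t (phi (t, s))%:E)%E =
  (((fun s => alpha^-1 * L s - alpha^-1 * expR (- alpha * N) * (expR (alpha * s) * L s)) \_ `[0, N]) s)%:E.
Proof.
rewrite patchE; case: ifPn => [|sN]; last first.
  rewrite integral0_eq// => t _; rewrite /phi indicE memNset ?mul0r// => -[/= s0 st tN'].
  by move/negP: sN; apply; rewrite mem_setE in_itv/= s0 (le_trans st tN').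
rewrite mem_setE in_itv/= => /andP[s0 sN].
have -> : alpha^-1 * L s - alpha^-1 * expR (- alpha * N) * (expR (alpha * s) * L s) =
  (expR (alpha * s) * L s) * \int[mu]_(t in `[s, N]) expR (- alpha * t).
  rewrite Rintegral_expRN// mulrBl mulrBr; congr (_ - _); last by ring.
  have E : expR (alpha * s) * expR (- alpha * s) = 1 by rewrite -expRD mulNr subrr expR0.
  transitivity ((expR (alpha * s) * expR (- alpha * s)) * (alpha^-1 * L s)); last by ring.
  by rewrite E mul1r.
rewrite -RintegralZl//; last exact: integrable_expRM.
rewrite fineK; last first.
  apply: integrable_fin_num => //.
  have h : mu.-integrable `[s, N] (fun t => ((expR (alpha * s) * L s)%:E * (expR (- alpha * t))%:E)%E).
    by apply: integrableZl => //; exact: integrable_expRM.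
  by apply: eq_integrable h => // t _; rewrite -EFinM.
rewrite [RHS]integral_mkcond; apply: eq_integral => t _.
rewrite patchE /phi indicE mem_setE in_itv/=.
have -> : ((t, s) \in A) = (s <= t <= N).
  apply/idP/idP => [/set_mem [_ st tN]|/andP[st tN]]; first by rewrite st tN.
  by apply/mem_set; split.
case: (s <= t <= N); last by rewrite mul0r.
rewrite mul1r mulrAC -expRD; congr (expR _ * _)%:E; rewrite /=; ring.
Qed.

Lemma measurable_ou_mean : measurable_fun setT (ou_mean \_ `[0, N]).
Proof.
apply/measurable_EFinP; have := measurable_fubini_F iphi.
rewrite /fubini_F /= (_ : (fun x => _) = EFin \o (ou_mean \_ `[0, N]))//.
by apply/funext => t; exact: phiF.
Qed.

Lemma integrable_ou_mean : mu.-integrable `[0, N] (EFin \o ou_mean).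
Proof.
apply: (integrable_itv_bounded _ _ (ML * N)).
  by apply/(measurable_restrictT _ _).2 => //; exact: measurable_ou_mean.
move=> x /andP[x0 xN]; apply: le_trans (ou_mean_le _ x0) _.
by rewrite ler_wpM2l.
Qed.

Lemma integrable_L : mu.-integrable `[0, N] (EFin \o L).
Proof.
apply: (integrable_itv_bounded _ _ ML) => //; exact: measurable_funTS.
Qed.

(** The equation of the process without noise. As [L] is merely bounded and measurable, it is
    obtained in integrated form, by exchanging the integrals over the triangle: integrating exp (-
    alpha t) over [[s, N]] gives two terms, which integrate against exp (alpha s) L(s) to the
    integral of [L] and to [ou_mean N], both over [alpha]. *)
Lemma ou_mean_ode : alpha * \int[mu]_(t in `[0, N]) ou_mean t =
  \int[mu]_(t in `[0, N]) L t - ou_mean N.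
Proof.
have e1 : \int[mu]_(t in `[0, N]) ou_mean t = fine (\int[mu]_t \int[mu]_s (phi (t, s))%:E)%E.
  by rewrite Rintegral_mkcond; congr fine; apply: eq_integral => t _; rewrite phiF.
rewrite e1 (Fubini iphi)/=.
under eq_integral do rewrite phiG.
rewrite -/(Rintegral _ _ _) -Rintegral_mkcond.
have i1 : mu.-integrable `[0, N] (EFin \o (fun s => alpha^-1 * L s)).
  have h : mu.-integrable `[0, N] (fun s => ((alpha^-1)%:E * (L s)%:E)%E).
    by apply: integrableZl => //; exact: integrable_L.
  by apply: eq_integrable h => // s _; rewrite -EFinM.
pose k := alpha^-1 * expR (- alpha * N).
have i2 : mu.-integrable `[0, N] (EFin \o (fun s => k * (expR (alpha * s) * L s))).
  have h : mu.-integrable `[0, N] (fun s => (k%:E * (expR (alpha * s) * L s)%:E)%E).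
    by apply: integrableZl => //; exact: integrable_expRL.
  by apply: eq_integrable h => // s _; rewrite -EFinM.
rewrite RintegralB// !RintegralZl//; [|exact: integrable_expRL|exact: integrable_L].
by rewrite mulrBr !mulrA mulfV ?gt_eqF// !mul1r.
Qed.

End fubini.
End ou_mean.

(** * The periodic regime and time averages *)

Section h_tilde.
Context {R : realType} (alpha : R) (alpha0 : 0 < alpha).
Context (L : R -> R) (mL : measurable_fun setT L) (ML : R) (LM : forall x, `|L x| <= ML).
Context (Lper : periodic L 1).
Local Notation mu := (@lebesgue_measure R).
Local Notation h := (h_tilde alpha L).
Local Notation m := (ou_mean alpha L).

Lemma integrable_expRL_Ny (t : R) : mu.-integrable `]-oo, t] (EFin \o (fun s => expR (alpha * s) * L s)).
Proof.
have hi : mu.-integrable `]-oo, t] (fun s => (ML%:E * (expR (alpha * s))%:E)%E).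
  by apply: integrableZl => //; exact: integrable_expR_Ny.
apply: le_integrable hi => //; first by apply/measurable_EFinP; exact: measurable_expRL.
move=> s _; rewrite /= lee_fin !normrM mulrC ler_wpM2r//.
exact: le_trans (LM s) (ler_norm _).
Qed.

(** The integral defining [h_tilde] is split at 0. The two functions differ by a transient that
    decays exponentially. *)
Lemma h_tildeE (t : R) : 0 <= t -> h t = m t + expR (- alpha * t) * h 0.
Proof.
move=> t0; rewrite /h_tilde /ou_mean mulr0 expR0 mul1r -mulrDr; congr (_ * _).
have := @Rintegral_itvB _ _ -oo%O (BRight t) 0 (integrable_expRL_Ny t) isT.
rewrite bnd_simp => /(_ t0) E.
rewrite addrC -[X in _ = _ + X]Rintegral_itv_obnd_cbnd.
  by rewrite -E addrC subrK.
by apply: integrableS (integrable_expRL alpha alpha0 L mL ML LM 0 t) => //; apply: subset_itv; rewrite bnd_simp.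
Qed.

Lemma h_tilde_periodic : periodic h 1.
Proof.
move=> t; rewrite /h_tilde.
have E : (fun x => x + 1) @^-1` `]-oo, t + 1] = `]-oo, t]%classic :> set R.
  by apply/seteqP; split => x /=; rewrite !in_itv/= lerD2r.
have sE s : expR (alpha * (s + 1)) * L (s + 1) = expR alpha * (expR (alpha * s) * L s).
  by rewrite Lper mulrDr mulr1 expRD; ring.
have hi : mu.-integrable `]-oo, t] (EFin \o (fun s => expR (alpha * (s + 1)) * L (s + 1))).
  have hi : mu.-integrable `]-oo, t] (fun s => ((expR alpha)%:E * (expR (alpha * s) * L s)%:E)%E).
    by apply: integrableZl => //; exact: integrable_expRL_Ny.
  by apply: eq_integrable hi => // s _; rewrite /= sE -EFinM.
rewrite (Rintegral_shift 1)// ?E//; last exact: measurable_expRL.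
under eq_Rintegral do rewrite sE.
rewrite RintegralZl//; last exact: integrable_expRL_Ny.
by rewrite mulrA -expRD; congr (expR _ * _); ring.
Qed.

Context (g : R -> R) (mg : measurable_fun setT g) (Mg : R) (gM : forall x, `|g x| <= Mg).
Context (gper : periodic g 1).

Lemma integrable_mul_ou_mean (N : R) : 0 <= N ->
  mu.-integrable `[0, N] (EFin \o (fun t => g t * m t)).
Proof.
move=> N0; apply: (integrable_itv_bounded _ _ (Mg * (ML * N))).
  apply: measurable_funM; first exact: measurable_funTS.
  by have /measurable_int/measurable_EFinP := integrable_ou_mean alpha alpha0 L mL ML LM N.
move=> x /andP[x0 xN]; rewrite normrM; apply: ler_pM => //.
apply: le_trans (ou_mean_le alpha alpha0 L mL ML LM _ x0) _.
by rewrite ler_wpM2l// (le_trans _ (LM 0)).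
Qed.

Let integrable_tail (N : R) : 0 <= N ->
  mu.-integrable `[0, N] (EFin \o (fun t => g t * (expR (- alpha * t) * h 0))).
Proof.
move=> N0; apply: (integrable_itv_bounded _ _ (Mg * `|h 0|)).
  apply: measurable_funM; first exact: measurable_funTS.
  by apply: measurable_funM => //; exact: measurable_expRM.
move=> x /andP[x0 _]; rewrite !normrM; apply: ler_pM => //.
rewrite ler_piMl// ger0_norm ?expR_ge0// -expR0 ler_expR mulNr oppr_le0.
by rewrite mulr_ge0// ltW.
Qed.

Lemma integrable_mul_h_tilde (N : R) : 0 <= N -> mu.-integrable `[0, N] (EFin \o (fun t => g t * h t)).
Proof.
move=> N0.
have hi : mu.-integrable `[0, N] (fun t => (g t * m t)%:E + (g t * (expR (- alpha * t) * h 0))%:E)%E.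
  by apply: integrableD => //; [exact: integrable_mul_ou_mean|exact: integrable_tail].
apply: eq_integrable hi => // t; rewrite mem_setE in_itv/= => /andP[t0 _].
by rewrite -EFinD -mulrDr -h_tildeE.
Qed.

(** With [h] in place of the mean the average over [n] full periods equals the limit exactly. The
    error made is the integral of the transient, bounded uniformly in [n], and is divided by [n]. *)
Lemma cvg_mean_mul_ou_mean :
  (n%:R^-1 * \int[mu]_(t in `[0, n%:R]) (g t * m t)) @[n --> \oo] --> dot01 g h.
Proof.
have Mg0 : 0 <= Mg by exact: le_trans (normr_ge0 _) (gM 0).
(* The integral of [Mg * |h 0| * exp (- alpha t)] over the whole half-line. *)
pose C := Mg * `|h 0| / alpha.
have C0 : 0 <= C by apply: divr_ge0; [exact: mulr_ge0|exact: ltW].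
have tail (n : nat) : `|\int[mu]_(t in `[0, n%:R]) (g t * (expR (- alpha * t) * h 0))| <= C.
  have it := integrable_tail n%:R (ler0n _ _).
  apply: (le_trans (le_normr_Rintegral _ it)) => //.
  have ie : mu.-integrable `[0, n%:R] (EFin \o (fun t => Mg * `|h 0| * expR (- alpha * t))).
    have hi : mu.-integrable `[0, n%:R] (fun t => ((Mg * `|h 0|)%:E * (expR (- alpha * t))%:E)%E).
      by apply: integrableZl => //; exact: integrable_expRM.
    by apply: eq_integrable hi => // t _; rewrite -EFinM.
  apply: (@le_trans _ _ (\int[mu]_(t in `[0, n%:R]) (Mg * `|h 0| * expR (- alpha * t)))).
    apply: le_Rintegral => //; first exact: (integrable_norm it).
    move=> t _; rewrite !normrM (ger0_norm (expR_ge0 _)) -mulrA ler_pM// ?mulr_ge0 ?expR_ge0//.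
    by rewrite mulrC.
  rewrite RintegralZl//; last exact: integrable_expRM.
  rewrite Rintegral_expRN// mulr0 expR0 /C -!mulrA ler_wpM2l// ler_wpM2l//.
  by rewrite ler_piMl ?invr_ge0 ?(ltW alpha0)// lerBlDr lerDl expR_ge0.
have E (n : nat) : (0 < n)%N -> n%:R^-1 * \int[mu]_(t in `[0, n%:R]) (g t * m t) =
    dot01 g h - n%:R^-1 * \int[mu]_(t in `[0, n%:R]) (g t * (expR (- alpha * t) * h 0)).
  move=> n0; have nR : n%:R != 0 :> R by rewrite pnatr_eq0 -lt0n.
  have per : periodic (fun t => g t * h t) 1 by move=> t; rewrite gper h_tilde_periodic.
  have P1 := Rintegral_periodic _ n per (fun n => integrable_mul_h_tilde n%:R (ler0n _ _)).
  have -> : dot01 g h = n%:R^-1 * \int[mu]_(t in `[0, n%:R]) (g t * h t) by rewrite P1 mulKf.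
  rewrite -mulrBr; congr (_ * _).
  transitivity (\int[mu]_(t in `[0, n%:R]) (g t * h t - g t * (expR (- alpha * t) * h 0))); last first.
    by apply: RintegralB => //; [exact: integrable_mul_h_tilde|exact: integrable_tail].
  apply: eq_Rintegral => t; rewrite mem_setE in_itv/= => /andP[t0 _].
  by rewrite -mulrBr h_tildeE// addrK.
apply/cvgrPdist_le => e e0; near=> n.
have n0 : (0 < n)%N by near: n; exact: nbhs_infty_gt.
rewrite E// opprB addrC subrK normrM normfV normr_nat ler_pdivrMl ?ltr0n//.
apply: (le_trans (tail n)); rewrite -ler_pdivrMr//.
near: n; exact: nbhs_infty_ger.
Unshelve. all: by end_near. Qed.

End h_tilde.

(** * Bounded functions cut off to an interval *)

Section restrict_itv.
Context {R : realType} (a b M : R) (f : R -> R).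
Context (mf : measurable_fun `[a, b] f) (fM : forall x, a <= x <= b -> `|f x| <= M).
Local Notation mu := (@lebesgue_measure R).

Lemma integrable_restrict_bounded : mu.-integrable setT (EFin \o (f \_ `[a, b])).
Proof.
rewrite -restrict_EFin; have h := integrable_itv_bounded a b M f mf fM.
exact: (integrable_mkcond _ _).1 h.
Qed.

Lemma sqintegrable_restrict_bounded : sqintegrable mu (f \_ `[a, b]).
Proof.
split; first exact/(measurable_restrictT _ _).1.
have h : mu.-integrable `[a, b] (EFin \o (fun x => f x ^+ 2)).
  apply: (integrable_itv_bounded a b (M ^+ 2)); first exact: measurable_funX.
  move=> x ab; rewrite normrX; apply: lerXn2r; rewrite ?nnegrE// ?fM//.
  exact: le_trans (normr_ge0 _) (fM x ab).
have h' : mu.-integrable setT ((EFin \o (fun x => f x ^+ 2)) \_ `[a, b]) by exact: (integrable_mkcond _ _).1 h.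
apply: eq_integrable h' => // x _; rewrite /= !patchE.
by case: ifP => //=; rewrite expr0n.
Qed.

Lemma integrable_bounded_mul (h : R -> R) : mu.-integrable `[a, b] (EFin \o h) ->
  mu.-integrable `[a, b] (EFin \o (fun x => f x * h x)).
Proof.
move=> ih; have mh : measurable_fun `[a, b] h by apply/measurable_EFinP; exact: measurable_int ih.
have iMh : mu.-integrable `[a, b] (fun x => (M%:E * (h x)%:E)%E) by exact: integrableZl.
apply: le_integrable iMh => //; first by apply/measurable_EFinP; exact: measurable_funM.
move=> x; rewrite /= in_itv/= => xab; rewrite lee_fin !normrM ler_wpM2r//.
exact: le_trans (fM x xab) (ler_norm _).
Qed.

End restrict_itv.

(** Parallelogram identity, in which the square norm of the sum is dropped. *)
Lemma dotL2_sub_le {d : measure_display} {T : measurableType d} {R : realType}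
    (P : {measure set T -> \bar R}) (f g : T -> R) : sqintegrable P f -> sqintegrable P g ->
  dotL2 P (fun x => f x - g x) (fun x => f x - g x) <= 2 * dotL2 P f f + 2 * dotL2 P g g.
Proof.
move=> Lf Lg; have LD := sqintegrableD P _ _ Lf Lg; have LB := sqintegrableB P _ _ Lf Lg.
have e1 : dotL2 P (fun x => f x - g x) (fun x => f x - g x) =
    dotL2 P f (fun x => f x - g x) - dotL2 P g (fun x => f x - g x) by exact: dotL2Bl.
have e2 : dotL2 P f (fun x => f x - g x) = dotL2 P f f - dotL2 P f g by exact: dotL2Br.
have e3 : dotL2 P g (fun x => f x - g x) = dotL2 P g f - dotL2 P g g by exact: dotL2Br.
have e4 : dotL2 P (fun x => f x + g x) (fun x => f x + g x) =
    dotL2 P f (fun x => f x + g x) + dotL2 P g (fun x => f x + g x) by exact: dotL2Dl.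
have e5 : dotL2 P f (fun x => f x + g x) = dotL2 P f f + dotL2 P g f.
  by rewrite dotL2C; exact: dotL2Dl.
have e6 : dotL2 P g (fun x => f x + g x) = dotL2 P f g + dotL2 P g g.
  by rewrite dotL2C; exact: dotL2Dl.
have := dotL2_ge0 P (fun x => f x + g x); lra.
Qed.

(** * Moments of integrals against the Rosenblatt process *)

Section rosenblatt_integral.
Context {d : measure_display} {T : measurableType d} {R : realType}.
Context {P : probability T R} {B : R -> {RV P >-> R}} (hB : brownian_motion B).
Context {H c dH : R} (hH0 : 2^-1 < H) (hH1 : H < 1) (hc : 0 < c).
Context {Z : R -> {RV P >-> R}} (hZ : rosenblatt_process B H c dH Z).

Lemma ae_scale_dotL2 (k : R) (Y Y' : {RV P >-> R}) (J J' : {RV P >-> R}) :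
  sqintegrable P J -> sqintegrable P J' ->
  {ae P, forall w, Y w = k * J w} -> {ae P, forall w, Y' w = k * J' w} ->
  [/\ sqintegrable P Y, sqintegrable P Y' & dotL2 P Y Y' = k ^+ 2 * dotL2 P J J'].
Proof.
move=> LJ LJ' YJ YJ'.
have LkJ := sqintegrableZ P k _ LJ; have LkJ' := sqintegrableZ P k _ LJ'.
have LY : sqintegrable P Y.
  apply: (ae_sqintegrable _ _ _ LkJ) => //.
  by apply: filterS YJ => w ->.
have LY' : sqintegrable P Y'.
  apply: (ae_sqintegrable _ _ _ LkJ') => //.
  by apply: filterS YJ' => w ->.
split => //; rewrite (ae_dotL2 P Y (fun w => k * J w) Y' (fun w => k * J' w))//.
by rewrite dotL2Zl// (dotL2C P J) dotL2Zl// (dotL2C P J') mulrA.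
Qed.

Lemma rosenblatt_integral_sqintegrable (g : R -> R) (t : R) (Y : {RV P >-> R}) :
  is_rosenblatt_integral B H c dH g t Y -> sqintegrable P Y.
Proof.
move=> [J [fJ YJ]]; have [_ LJ] := double_wiener_ito_sqintegrable hB _ _ fJ.
by have [] := ae_scale_dotL2 _ _ _ _ _ LJ LJ YJ YJ.
Qed.

Lemma rosenblatt_integral_dotL2_le (g : R -> R) (t M : R) (Y : {RV P >-> R}) :
  0 <= t -> measurable_fun setT g -> (forall u, 0 < u <= t -> `|g u| <= M) ->
  is_rosenblatt_integral B H c dH g t Y -> dotL2 P Y Y <= M ^+ 2 * t `^ (2 * H).
Proof.
move=> t0 mg gM [J [fJ YJ]]; have [_ LJ] := double_wiener_ito_sqintegrable hB _ _ fJ.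
have [J1 [fJ1 ZJ1]] := rp_chaos hZ t0; have [_ LJ1] := double_wiener_ito_sqintegrable hB _ _ fJ1.
have [_ _ ->] := ae_scale_dotL2 _ _ _ _ _ LJ LJ YJ YJ.
have [LZ _ EZ] := ae_scale_dotL2 _ _ _ _ _ LJ1 LJ1 ZJ1 ZJ1.
(* The normalisation of [Z] rewrites [t ^ (2 H)] as [dH ^+ 2] times the second moment of [J1], so
   [dH ^+ 2] is a common factor of both sides. *)
have := rp_norm hZ t0; rewrite unlock (dotL2_sq P _ LZ) EZ => -[<-].
rewrite mulrCA; apply: ler_wpM2l; first exact: sqr_ge0.
apply: (le_double_wiener_ito hB M _ _ J J1 fJ fJ1).
- exact: rosenblatt_kernel_swap.
- exact: rosenblatt_kernel_swap.
- exact: (rosenblatt_kernel_bound H c hH0 hH1 hc).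
Qed.

Lemma rosenblatt_integral_dotL2_ge0 (g g' : R -> R) (t t' : R) (Y Y' : {RV P >-> R}) :
  (forall u, 0 <= g u) -> (forall u, 0 <= g' u) ->
  is_rosenblatt_integral B H c dH g t Y -> is_rosenblatt_integral B H c dH g' t' Y' ->
  0 <= dotL2 P Y Y'.
Proof.
move=> g0 g0' [J [fJ YJ]] [J' [fJ' YJ']].
have [_ LJ] := double_wiener_ito_sqintegrable hB _ _ fJ.
have [_ LJ'] := double_wiener_ito_sqintegrable hB _ _ fJ'.
have [_ _ ->] := ae_scale_dotL2 _ _ _ _ _ LJ LJ' YJ YJ'.
rewrite mulr_ge0 ?sqr_ge0//.
apply: (double_wiener_ito_dotL2_ge0 hB _ _ J J' fJ fJ').
- exact: rosenblatt_kernel_swap.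
- exact: (rosenblatt_kernel_ge0 H c hH0 hc).
- exact: (rosenblatt_kernel_ge0 H c hH0 hc).
Qed.

Lemma rosenblatt_process_dotL2 (t : R) : 0 <= t ->
  sqintegrable P (Z t) /\ dotL2 P (Z t) (Z t) = t `^ (2 * H).
Proof.
move=> t0; have LZ := rosenblatt_integral_sqintegrable _ _ _ (rp_chaos hZ t0).
by split => //; have := rp_norm hZ t0; rewrite unlock (dotL2_sq P _ LZ) => -[].
Qed.

End rosenblatt_integral.

(** * Second moments of the deviation from the mean *)

Section ou_variance.
Context {d : measure_display} {T : measurableType d} {R : realType}.
Context {P : probability T R} {B : R -> {RV P >-> R}} (hB : brownian_motion B).
Context {H c dH : R} (hH0 : 2^-1 < H) (hH1 : H < 1) (hc : 0 < c).
Context {Z : R -> {RV P >-> R}} (hZ : rosenblatt_process B H c dH Z).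
Context {alpha : R} (alpha0 : 0 < alpha).
Context {L : R -> R} (mL : measurable_fun setT L) (ML : R) (LM : forall x, `|L x| <= ML).
Context {X : R -> {RV P >-> R}} (hX : rosenblatt_OU B H c dH Z alpha L X).
Local Notation mu := (@lebesgue_measure R).
Local Notation m := (ou_mean alpha L).

Let U (t : R) (w : T) : R := X t w - m t.

Let UE (t : R) : 0 <= t -> exists Y : {RV P >-> R},
  is_rosenblatt_integral B H c dH (fun s => expR (alpha * s)) t Y /\
  {ae P, forall w, expR (- alpha * t) * Y w = U t w}.
Proof.
move=> t0; have [Y [hY XY]] := rou_explicit hX t0; exists Y; split => //.
by apply: filterS XY => w XY; rewrite /U XY mulrDr /ou_mean addrC addKr.
Qed.

Let mU t : measurable_fun setT (U t).
Proof. exact: measurable_funB. Qed.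

(** On [[0, t]] the integrand exp (alpha s) is at most exp (alpha t), and the factor exp (- alpha t)
    in front compensates exactly. So the deviation has no larger second moment than [Z t]. *)
Let sqU (t : R) : 0 <= t -> sqintegrable P (U t) /\ dotL2 P (U t) (U t) <= t `^ (2 * H).
Proof.
move=> t0; have [Y [hY UY]] := UE t t0.
have LY := rosenblatt_integral_sqintegrable hB _ _ _ hY.
have LeY := sqintegrableZ P (expR (- alpha * t)) _ LY.
have LU := ae_sqintegrable P _ _ LeY (mU t) UY; split => //.
have YU : {ae P, forall w, U t w = expR (- alpha * t) * Y w} by apply: filterS UY => w ->.
rewrite (ae_dotL2 P (U t) _ (U t) _ LU LeY LU LeY YU YU).
rewrite dotL2Zl// dotL2C dotL2Zl// mulrA -expr2.
have hb := rosenblatt_integral_dotL2_le hB hH0 hH1 hc hZ (fun s => expR (alpha * s)) t (expR (alpha * t)) Y t0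
  (measurable_expRM alpha setT).
apply: (@le_trans _ _ (expR (- alpha * t) ^+ 2 * (expR (alpha * t) ^+ 2 * t `^ (2 * H)))).
  apply: ler_wpM2l; first exact: sqr_ge0.
  apply: hb => // u /andP[u0 ut]; rewrite ger0_norm ?expR_ge0// ler_expR.
  by rewrite ler_pM2l.
by rewrite mulrA -exprMn -expRD mulNr addNr expR0 expr1n mul1r.
Qed.

Let covU (s t : R) : 0 <= s -> 0 <= t -> 0 <= dotL2 P (U s) (U t).
Proof.
move=> s0 t0; have [Y [hY UY]] := UE s s0; have [Y' [hY' UY']] := UE t t0.
have LY := rosenblatt_integral_sqintegrable hB _ _ _ hY.
have LY' := rosenblatt_integral_sqintegrable hB _ _ _ hY'.
have LeY := sqintegrableZ P (expR (- alpha * s)) _ LY.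
have LeY' := sqintegrableZ P (expR (- alpha * t)) _ LY'.
have LU := ae_sqintegrable P _ _ LeY (mU s) UY; have LU' := ae_sqintegrable P _ _ LeY' (mU t) UY'.
rewrite -(ae_dotL2 P _ (U s) _ (U t) LeY LU LeY' LU' UY UY').
rewrite dotL2Zl// dotL2C dotL2Zl// dotL2C !mulr_ge0 ?expR_ge0//.
by apply: (rosenblatt_integral_dotL2_ge0 hB hH0 hc _ _ _ _ _ _ _ _ hY hY') => u; exact: expR_ge0.
Qed.

Section horizon.
Context (N : R) (N0 : 0 <= N).

(** Joint measurability of [X] and the moment bounds concern times [t >= 0]. The cut-off yields a
    field on all of [R * T], with zero sections outside [[0, N]], so that the covariances are
    nonnegative for all pairs of times. *)
Let XN : R * T -> R := (fun z => X z.1 z.2) \_ (`[0, N] `*` [set: T]).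
Let mN (z : R * T) : R := (m \_ `[0, N]) z.1.
Let UN (z : R * T) : R := XN z - mN z.

Let mXN : measurable_fun setT XN.
Proof.
apply/(measurable_restrictT _ _).1; first exact: measurableX.
apply: measurable_funS (rou_measurable hX).
  apply: measurableX => //; rewrite (_ : [set t : R | 0 <= t] = `[0, +oo[%classic)//.
  by apply/seteqP; split => t /=; rewrite in_itv/= andbT.
by move=> [t w] /= []; rewrite in_itv/= => /andP[].
Qed.

Let mmN : measurable_fun setT mN.
Proof.
exact: measurableT_comp (measurable_ou_mean alpha alpha0 L mL ML LM N) measurable_fst.
Qed.

Let UNE (t : R) : (fun w => UN (t, w)) = if t \in `[0, N]%classic then U t else (fun=> 0).
Proof.
apply/funext => w; rewrite /UN /XN /mN !patchE in_setX /= in_setT andbT.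
by case: ifP => // _; rewrite subrr.
Qed.

Let sqUNs (t : R) : sqintegrable P (fun w => UN (t, w)).
Proof.
rewrite UNE; case: ifP => [|_]; last exact: sqintegrable0.
by rewrite mem_setE in_itv/= => /andP[t0 _]; have [] := sqU t t0.
Qed.

Let covUN (s t : R) : 0 <= dotL2 P (fun w => UN (s, w)) (fun w => UN (t, w)).
Proof.
rewrite !UNE; case: ifP => [|_]; last first.
  by apply: Rintegral_ge0 => w _; rewrite mul0r.
rewrite mem_setE in_itv/= => /andP[s0 _]; case: ifP => [|_]; last first.
  by apply: Rintegral_ge0 => w _; rewrite mulr0.
by rewrite in_itv/= => /andP[t0 _]; exact: covU.
Qed.

Local Notation nu := ((@lebesgue_measure R \x P)%E).

Let sqUN : sqintegrable nu UN.
Proof.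
have mUN : measurable_fun setT UN by exact: measurable_funB.
apply: sqintegrable_lty => //.
rewrite (@fubini_tonelli1 _ _ _ _ R lebesgue_measure P (EFin \o (fun z => UN z ^+ 2)))//; last 2 first.
- by apply/measurable_EFinP; exact: measurable_funX.
- by move=> z; rewrite /= lee_fin sqr_ge0.
pose C := N `^ (2 * H); pose h : R -> R := cst C \_ `[0, N].
have hlt : (\int[mu]_t (h t)%:E < +oo)%E.
  have hi : mu.-integrable setT (EFin \o h).
    apply: (integrable_restrict_bounded _ _ (N `^ (2 * H)) (cst C)) => //.
    by move=> x _; rewrite /= ger0_norm ?powR_ge0.
  exact: (integrable_lty _ hi).
have h0 t : 0 <= h t by rewrite /h patchE; case: ifP => //= _; exact: powR_ge0.
apply: le_lt_trans hlt; apply: ge0_le_integral => //.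
- by move=> t _; apply: integral_ge0 => w _; rewrite lee_fin sqr_ge0.
- apply: (@measurable_fun_fubini_tonelli_F _ _ _ _ R P (EFin \o (fun z => UN z ^+ 2))).
    by apply/measurable_EFinP; exact: measurable_funX.
  by move=> z; rewrite /= lee_fin sqr_ge0.
- by apply/measurable_EFinP/(measurable_restrictT _ _).1.
move=> t _; rewrite /fubini_F /= (dotL2_sq P _ (sqUNs t)) lee_fin UNE /h patchE.
case: ifP => [|_].
  rewrite mem_setE in_itv/= => /andP[t0 tN].
  apply: (le_trans (sqU t t0).2); apply: ge0_ler_powR; rewrite ?nnegrE//.
  by have hH := hH0; lra.
by rewrite /dotL2 /Rintegral; under eq_integral do rewrite mul0r; rewrite integral0.
Qed.

Let sqmN : sqintegrable nu mN.
Proof.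
have Lm : sqintegrable mu (m \_ `[0, N]).
  apply: (sqintegrable_restrict_bounded _ _ (ML * N)).
    by have /measurable_int/measurable_EFinP := integrable_ou_mean alpha alpha0 L mL ML LM N.
  move=> t /andP[t0 tN]; apply: (le_trans (ou_mean_le alpha alpha0 L mL ML LM t t0)).
  by apply: ler_wpM2l => //; exact: le_trans (normr_ge0 _) (LM 0).
have := sqintegrable_tensor mu P _ (cst 1) Lm (sqintegrable_cst P 1).
by congr sqintegrable; apply/funext => z; rewrite mulr1.
Qed.

Let sqXN : sqintegrable nu XN.
Proof.
have := sqintegrableD nu _ _ sqUN sqmN.
by congr sqintegrable; apply/funext => z; rewrite /UN subrK.
Qed.

Let Lg (g : R -> R) (M : R) : measurable_fun setT g -> (forall x, `|g x| <= M) ->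
  sqintegrable mu (g \_ `[0, N]).
Proof.
by move=> mg gM; apply: (sqintegrable_restrict_bounded _ _ M) => //; exact: measurable_funTS.
Qed.

(** The pathwise integral is the section integral of a field integrable for the product measure,
    hence measurable at every [w] and not only after completion of [P]. *)
Lemma measurable_integral_ou (g : R -> R) (M : R) :
  measurable_fun setT g -> (forall x, `|g x| <= M) ->
  measurable_fun setT (fun w => \int[mu]_(t in `[0, N]) (g t * X t w)).
Proof.
move=> mg gM; have := measurable_time_integral mu P XN sqXN _ (Lg g M mg gM).
congr measurable_fun; apply/funext => w; rewrite /time_integral [RHS]Rintegral_mkcond.
congr Rintegral; apply/funext => t; rewrite /XN !patchE in_setX /= in_setT andbT.
by case: ifP => // _; rewrite mul0r.
Qed.

Let time_integral_fluctuation (g : R -> R) (M : R) :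
  measurable_fun setT g -> (forall x, `|g x| <= M) ->
  {ae P, forall w, time_integral mu UN (g \_ `[0, N]) w =
  \int[mu]_(t in `[0, N]) (g t * X t w) - \int[mu]_(t in `[0, N]) (g t * m t)}.
Proof.
move=> mg gM; apply: ae_filterS (rou_paths hX) => w cw.
have iX : mu.-integrable `[0, N] (EFin \o (fun t => X t w)).
  apply: continuous_compact_integrable; first exact: segment_compact.
  by apply: continuous_subspaceW cw => t /=; rewrite !in_itv/= andbT => /andP[].
have igX : mu.-integrable `[0, N] (EFin \o (fun t => g t * X t w)).
  by apply: (integrable_bounded_mul _ _ M g) => //; exact: measurable_funTS.
have igm : mu.-integrable `[0, N] (EFin \o (fun t => g t * m t)).
  by apply: (integrable_bounded_mul _ _ M g) => //; [exact: measurable_funTS|exact: integrable_ou_mean mL ML LM N].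
transitivity (\int[mu]_(t in `[0, N]) (g t * X t w - g t * m t)); last exact: RintegralB.
rewrite /time_integral [RHS]Rintegral_mkcond; congr Rintegral; apply/funext => t.
rewrite /UN /XN /mN !patchE in_setX /= in_setT andbT.
by case: ifP => _; [rewrite mulrBr|rewrite mul0r].
Qed.

Let L1 : sqintegrable mu ((cst 1 : R -> R) \_ `[0, N]).
Proof. by apply: (Lg _ 1) => // x; rewrite normr1. Qed.

(** The equation of [X] minus [ou_mean_ode] at the same time: the contributions of [L] cancel. *)
Let time_integral1E : {ae P, forall w, time_integral mu UN ((cst 1 : R -> R) \_ `[0, N]) w =
  alpha^-1 * (Z N w - U N w)}.
Proof.
have M1 (x : R) : `|cst 1 x| <= 1 :> R by rewrite /= normr1.
have h1 := time_integral_fluctuation (cst 1) 1 (measurable_cst _) M1.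
apply: ae_filterS (filterI h1 (filterI (rou_paths hX) (rou_sde hX))) => w [-> [cw sde]].
have iX : mu.-integrable `[0, N] (EFin \o (fun t => X t w)).
  apply: continuous_compact_integrable; first exact: segment_compact.
  by apply: continuous_subspaceW cw => t /=; rewrite !in_itv/= andbT => /andP[].
have iaX : mu.-integrable `[0, N] (fun t => (alpha%:E * (X t w)%:E)%E) by exact: integrableZl.
have iL := integrable_L L mL ML LM N.
have ->: \int[mu]_(t in `[0, N]) (cst 1 t * X t w) = \int[mu]_(t in `[0, N]) X t w.
  by apply: eq_Rintegral => t _; rewrite mul1r.
have ->: \int[mu]_(t in `[0, N]) (cst 1 t * m t) = \int[mu]_(t in `[0, N]) m t.
  by apply: eq_Rintegral => t _; rewrite mul1r.
have sL : \int[mu]_(t in `[0, N]) (L t - alpha * X t w) =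
    \int[mu]_(t in `[0, N]) L t - alpha * \int[mu]_(t in `[0, N]) X t w.
  transitivity (\int[mu]_(t in `[0, N]) L t - \int[mu]_(t in `[0, N]) (alpha * X t w)).
    exact: RintegralB.
  by congr (_ - _); exact: RintegralZl.
have ode := ou_mean_ode alpha alpha0 L mL ML LM N.
have := sde N N0; rewrite sL /U => XE.
apply: (mulfI (lt0r_neq0 alpha0)); rewrite mulrA mulfV ?gt_eqF// mul1r mulrBr ode XE.
ring.
Qed.

(** Both [Z N] and [U N] have second moment at most [N ^ (2 H)]; the factor 4 comes from
    [dotL2_sub_le]. *)
Let dotL2_time_integral1 :
  dotL2 P (time_integral mu UN ((cst 1 : R -> R) \_ `[0, N])) (time_integral mu UN ((cst 1 : R -> R) \_ `[0, N])) <=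
  4 * N `^ (2 * H) / alpha ^+ 2.
Proof.
have [LZ EZ] := rosenblatt_process_dotL2 hB hZ N N0.
have [LU EU] := sqU N N0.
have LB := sqintegrableB P _ _ LZ LU.
have LaB := sqintegrableZ P alpha^-1 _ LB.
have LV := sqintegrable_time_integral mu P UN sqUN _ L1.
have h := time_integral1E.
rewrite (ae_dotL2 P _ _ _ _ LV LaB LV LaB h h).
rewrite dotL2Zl// dotL2C dotL2Zl//.
have -> : alpha^-1 * (alpha^-1 * dotL2 P (fun w => Z N w - U N w) (fun w => Z N w - U N w)) =
   dotL2 P (fun w => Z N w - U N w) (fun w => Z N w - U N w) / alpha ^+ 2.
  by rewrite mulrA -expr2 exprVn mulrC.
apply: ler_wpM2r; first by rewrite invr_ge0 sqr_ge0.
have := dotL2_sub_le P _ _ LZ LU; move: EU; rewrite -EZ; lra.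
Qed.

Lemma ou_fluctuation (g : R -> R) (M : R) :
  measurable_fun setT g -> (forall x, `|g x| <= M) ->
  exists V : T -> R, [/\ sqintegrable P V,
    dotL2 P V V <= M ^+ 2 * (4 * N `^ (2 * H) / alpha ^+ 2) &
    {ae P, forall w, \int[mu]_(t in `[0, N]) (g t * X t w) =
      \int[mu]_(t in `[0, N]) (g t * m t) + V w}].
Proof.
move=> mg gM; exists (time_integral mu UN (g \_ `[0, N])).
have M0 : 0 <= M by exact: le_trans (normr_ge0 _) (gM 0).
have Lg' := Lg g M mg gM; split.
- exact: sqintegrable_time_integral.
- apply: le_trans (ler_wpM2l (sqr_ge0 M) dotL2_time_integral1).
  apply: le_dotL2_time_integral => // t; rewrite !patchE.
  by case: ifP => _; rewrite ?mulr1 ?gM// normr0 mulr0.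
- by apply: ae_filterS (time_integral_fluctuation g M mg gM) => w ->; rewrite addrC subrK.
Qed.

End horizon.
End ou_variance.

(** Written as [x * (x ^+ 2) ^ (-1)], the inverse is a product of measurable functions, with the
    right value 0 at 0. The estimators divide by a random variable that may vanish. *)
Lemma measurable_fun_inv {d : measure_display} {T : measurableType d} {R : realType}
    (D : set T) (f : T -> R) : measurable_fun D f -> measurable_fun D (fun x => (f x)^-1).
Proof.
move=> mf; rewrite (_ : (fun x => _) = (fun x => f x * (f x ^+ 2) `^ (-1))).
  apply: measurable_funM => //; apply: (measurableT_comp (measurable_powR (-1))).
  exact: measurable_funX.
apply/funext => x; rewrite powR_inv1 ?sqr_ge0// -exprVn expr2 mulrA.
by have [->|fx0] := eqVneq (f x) 0; rewrite ?invr0 ?mulr0// mulfV ?mul1r.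
Qed.

(** * Convergence in probability *)

Section cvg_in_proba.
Context {d : measure_display} {T : measurableType d} {R : realType} (P : probability T R).

(* Convergence in probability of possibly non-measurable [Y n]: the exceptional event
   [eps <= |Y n w - y|] is only required to be covered by a measurable set. *)
Definition cvg_in_proba (Y : nat -> T -> R) (y : R) : Prop :=
  forall eps delta : R, 0 < eps -> 0 < delta -> \forall n \near \oo,
    exists A : set T, [/\ measurable A, (P A <= delta%:E)%E &
      forall w, ~ A w -> `|Y n w - y| < eps].

Lemma cvg_in_proba_cst (u : nat -> R) (l : R) : u n @[n --> \oo] --> l ->
  cvg_in_proba (fun n _ => u n) l.
Proof.
move=> ul eps delta eps0 delta0; move/cvgrPdist_lt: ul => /(_ eps eps0).
apply: filterS => n un; exists set0; split => //.
  by rewrite measure0 lee_fin ltW.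
by move=> w _; rewrite distrC.
Qed.

Lemma cvg_in_proba_ae (Y Y' : nat -> T -> R) (y : R) :
  (\forall n \near \oo, {ae P, forall w, Y' n w = Y n w}) ->
  cvg_in_proba Y y -> cvg_in_proba Y' y.
Proof.
move=> YY' cY eps delta eps0 delta0; have := cY eps delta eps0 delta0.
apply: filterS2 YY' => n [N [mN N0 YN]] [A [mA PA YA]]; exists (A `|` N); split.
- exact: measurableU.
- by rewrite (measureU0 mA mN N0).
- move=> w /not_orP[nA nN]; have -> : Y' n w = Y n w by apply: contrapT => h; apply/nN/YN.
  exact: YA.
Qed.

(** Chebyshev's inequality, proved by integrating [eps ^+ 2] times the indicator of the exceptional
    event. *)
Lemma cvg_in_proba_dotL2 (V : nat -> T -> R) (b : nat -> R) :
  (\forall n \near \oo, sqintegrable P (V n) /\ dotL2 P (V n) (V n) <= b n) ->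
  b n @[n --> \oo] --> 0 -> cvg_in_proba V 0.
Proof.
move=> Vb b0 eps delta eps0 delta0.
have e2 : 0 < eps ^+ 2 by exact: exprn_gt0.
move/cvgrPdist_lt: b0 => /(_ (eps ^+ 2 * delta) (mulr_gt0 e2 delta0)).
apply: filterS2 Vb => n [LV Vb]; rewrite sub0r normrN => bn.
have mV := LV.1.
pose A : set T := [set w | eps <= `|V n w|]; exists A.
have mA : measurable A.
  have mnV : measurable_fun setT (fun w => `|V n w|) by exact: measurableT_comp.
  have := mnV measurableT `[eps, +oo[%classic (measurable_itv _).
  rewrite setTI; congr measurable; apply/seteqP.
  by split=> w /=; rewrite in_itv/= andbT.
split => //; last by move=> w /negP; rewrite -ltNge subr0.
have h : ((eps ^+ 2)%:E * P A <= (dotL2 P (V n) (V n))%:E)%E.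
  rewrite -(dotL2_sq P _ LV) -(setIT A) -(integral_indic P measurableT mA).
  have -> : ((eps ^+ 2)%:E * \int[P]_w (\1_A w)%:E = \int[P]_w ((eps ^+ 2)%:E * (\1_A w)%:E))%E.
    rewrite ge0_integralZl//; last by rewrite lee_fin sqr_ge0.
    by apply/measurable_EFinP; exact: measurable_indic.
  apply: ge0_le_integral => //.
  - by move=> w _; rewrite -EFinM lee_fin mulr_ge0// ltW.
  - by apply: measurable_funeM; apply/measurable_EFinP; exact: measurable_indic.
  - by apply/measurable_EFinP; exact: measurable_funX.
  move=> w _; rewrite -EFinM lee_fin indicE; case: (boolP (w \in A)) => [|_].
    rewrite inE /A /= mulr1 => eV; rewrite -[leRHS]real_normK ?num_real//.
    by apply: lerXn2r => //; rewrite nnegrE// ltW.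
  by rewrite mulr0 sqr_ge0.
rewrite -(@lee_pmul2l _ (eps ^+ 2)%:E)//.
by apply: (le_trans h); rewrite -EFinM lee_fin (le_trans Vb)// (le_trans (ler_norm _))// ltW.
Qed.

Lemma cvg_in_proba_comp2 (Y Y' : nat -> T -> R) (y y' : R) (f : R * R -> R) :
  {for (y, y'), continuous f} -> cvg_in_proba Y y -> cvg_in_proba Y' y' ->
  cvg_in_proba (fun n w => f (Y n w, Y' n w)) (f (y, y')).
Proof.
move=> cf cY cY' eps delta eps0 delta0.
move/cvgrPdist_lt: cf => /(_ eps eps0) /= /nbhs_ballP[r /= r0 rf].
have d2 : 0 < delta / 2 by rewrite divr_gt0.
have := cY' r _ r0 d2; have := cY r _ r0 d2; apply: filterS2 => n.
move=> [A [mA PA YA]] [A' [mA' PA' YA']]; exists (A `|` A'); split.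
- exact: measurableU.
- apply: (le_trans (measureU2 _ mA mA')).
  by rewrite [leRHS](_ : _ = (delta / 2)%:E + (delta / 2)%:E)%E ?leeD// -EFinD -splitr.
move=> w /not_orP[/YA h /YA' h']; rewrite distrC; apply: rf.
by split; rewrite -ball_normE/= distrC.
Qed.

Lemma cvg_in_probaD (Y Y' : nat -> T -> R) (y y' : R) :
  cvg_in_proba Y y -> cvg_in_proba Y' y' -> cvg_in_proba (fun n w => Y n w + Y' n w) (y + y').
Proof.
apply: (cvg_in_proba_comp2 _ _ _ _ (fun z => z.1 + z.2)).
by apply: cvgD; [exact: cvg_fst|exact: cvg_snd].
Qed.

Lemma cvg_in_probaM (Y Y' : nat -> T -> R) (y y' : R) :
  cvg_in_proba Y y -> cvg_in_proba Y' y' -> cvg_in_proba (fun n w => Y n w * Y' n w) (y * y').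
Proof.
apply: (cvg_in_proba_comp2 _ _ _ _ (fun z => z.1 * z.2)).
by apply: cvgM; [exact: cvg_fst|exact: cvg_snd].
Qed.

Lemma cvg_in_proba_div (Y Y' : nat -> T -> R) (y y' : R) : y' != 0 ->
  cvg_in_proba Y y -> cvg_in_proba Y' y' -> cvg_in_proba (fun n w => Y n w / Y' n w) (y / y').
Proof.
move=> y0; apply: (cvg_in_proba_comp2 _ _ _ _ (fun z => z.1 / z.2)).
by apply: cvgM; [exact: cvg_fst|apply: cvgV => //; exact: cvg_snd].
Qed.

(** The norm on row vectors is the maximum over the coordinates, so the exceptional event is a
    finite union. Each of the [k.+1] coordinates receives an equal share of [delta]. Measurability
    of the estimator lets the covering sets bound the probability of the event itself. *)
Lemma consistentP (k : nat) (est : nat -> T -> 'rV[R]_k.+1) (theta : 'rV[R]_k.+1) :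
  (forall n i, measurable_fun setT (fun w => est n w ord0 i)) ->
  (forall i, cvg_in_proba (fun n w => est n w ord0 i) (theta ord0 i)) ->
  consistent P est theta.
Proof.
move=> mest cest eps eps0.
have lt_norm n w : `|est n w - theta| < eps <-> forall i, `|est n w ord0 i - theta ord0 i| < eps.
  have hb : ball (est n w) eps theta <-> `|est n w - theta| < eps by rewrite -ball_normE.
  rewrite -hb; split=> [[_ h] i|h]; first by have := h ord0 i; rewrite -ball_normE.
  by split => // i j; rewrite ord1 -ball_normE; exact: h.
have ev n : [set w | eps <= `|est n w - theta|] =
    \bigcup_(i in [set: 'I_k.+1]) [set w | eps <= `|est n w ord0 i - theta ord0 i|].
  apply/seteqP; split => w /=.
    move=> h; apply: contrapT => nh; move: h; rewrite leNgt => /negP; apply.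
    apply/lt_norm => i; rewrite ltNge; apply/negP => h; apply: nh; by exists i.
  move=> [i _ h]; rewrite leNgt; apply/negP => /lt_norm/(_ i).
  by rewrite ltNge h.
have mev n i : measurable [set w | eps <= `|est n w ord0 i - theta ord0 i|].
  have mn : measurable_fun setT (fun w => `|est n w ord0 i - theta ord0 i|).
    by apply: measurableT_comp => //; exact: measurable_funB.
  have := mn measurableT `[eps, +oo[%classic (measurable_itv _).
  rewrite setTI; congr measurable; apply/seteqP.
  by split=> w /=; rewrite in_itv/= andbT.
have mE n : measurable [set w | eps <= `|est n w - theta|].
  by rewrite ev; apply: fin_bigcup_measurable => // i _; exact: mev.
apply/fine_cvgP; split; first by apply: nearW => n; exact: fin_num_measure.
apply/cvgrPdist_le => delta delta0.
have d1 : 0 < delta / k.+1%:R by rewrite divr_gt0.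
have : \forall n \near \oo, forall i, exists A : set T, [/\ measurable A,
    (P A <= (delta / k.+1%:R)%:E)%E & forall w, ~ A w -> `|est n w ord0 i - theta ord0 i| < eps].
  by apply: filter_forall => i; exact: cest.
apply: filterS => n /choice[A hA]; rewrite sub0r normrN ger0_norm ?fine_ge0//.
rewrite -lee_fin fineK ?fin_num_measure//.
have mA i : measurable (A i) by have [] := hA i.
have Ale (r : seq 'I_k.+1) : measurable (\big[setU/set0]_(i <- r) A i) /\
    (P (\big[setU/set0]_(i <- r) A i) <= ((size r)%:R * (delta / k.+1%:R))%:E)%E.
  elim: r => [|i r [mr ih]]; first by rewrite big_nil measure0 mul0r.
  rewrite big_cons; split; first exact: measurableU.
  apply: (le_trans (measureU2 _ (mA i) mr)).
  by rewrite /= -natr1 mulrDl mul1r addrC EFinD leeD//; have [] := hA i.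
have [mAs PAs] := Ale (index_enum 'I_k.+1).
have sz : size (index_enum 'I_k.+1) = k.+1 by rewrite -[RHS]card_ord cardT enumT.
rewrite sz mulrC mulfVK ?pnatr_eq0// in PAs; apply: le_trans PAs.
apply: le_measure; rewrite ?inE// => w.
rewrite ev => -[i _ /= h]; rewrite -bigcup_seq; exists i; first by rewrite /= mem_index_enum.
by apply: contrapT => nA; move: h; rewrite leNgt; have [_ _ ->] := hA i.
Qed.

End cvg_in_proba.

(** The expression equals [(n ^ -1) ^ (2 - 2 H)] with a positive exponent, and [n ^ -1] tends to 0
    from the right. *)
Lemma cvg_inv_sq_powR {R : realType} (H : R) : 2^-1 < H -> H < 1 ->
  n%:R^-1 ^+ 2 * n%:R `^ (2 * H) @[n --> \oo] --> (0 : R).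
Proof.
move=> H0 H1; have e0 : 0 < 2 - 2 * H by lra.
have c0 : n%:R^-1 @[n --> \oo] --> (0 : R).
  apply/cvgrPdist_lt => e ep; near=> n.
  have n0 : 0 < n%:R :> R by rewrite ltr0n; near: n; exact: nbhs_infty_gt.
  rewrite sub0r normrN gtr0_norm ?invr_gt0// invf_plt ?posrE//.
  by near: n; exact: nbhs_infty_gtr.
have cr : n%:R^-1 @[n --> \oo] --> (0 : R)^'+.
  move=> A /c0 hA.
  have pos : \forall n \near \oo, 0 < n%:R^-1 :> R.
    by near=> n; rewrite invr_gt0 ltr0n; near: n; exact: nbhs_infty_gt.
  by apply: filterS2 pos hA => n p; exact.
have cp := cvg_comp _ _ cr (powR_cvg0 e0).
apply: cvg_trans cp; apply: near_eq_cvg; near=> n.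
have n0 : 0 < n%:R :> R by rewrite ltr0n; near: n; exact: nbhs_infty_gt.
rewrite /= -[n%:R^-1]powR_inv1 ?ltW// -powRrM -powR_mulrn ?powR_ge0// -powRrM -powRD; last first.
  by rewrite (gt_eqF n0) implybT.
by congr (_ `^ _); ring.
Unshelve. all: by end_near. Qed.

(** * Laws of large numbers for the two kinds of integral *)

Section estimation.
Context {d : measure_display} {T : measurableType d} {R : realType}.
Context {P : probability T R} {B : R -> {RV P >-> R}} (hB : brownian_motion B).
Context {H c dH : R} (hH0 : 2^-1 < H) (hH1 : H < 1) (hc : 0 < c).
Context {Z : R -> {RV P >-> R}} (hZ : rosenblatt_process B H c dH Z).
Context {alpha : R} (alpha0 : 0 < alpha).
Context {L : R -> R} (mL : measurable_fun setT L) (ML : R) (LM : forall x, `|L x| <= ML).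
Context (Lper : periodic L 1).
Context {X : R -> {RV P >-> R}} (hX : rosenblatt_OU B H c dH Z alpha L X).
Context (g : R -> R) (mg : measurable_fun setT g) (M : R) (gM : forall x, `|g x| <= M).
Context (gper : periodic g 1).
Local Notation mu := (@lebesgue_measure R).
Local Notation h := (h_tilde alpha L).

Let G (n : nat) (w : T) : R := \int[mu]_(t in `[0, n%:R]) (g t * X t w).

Let mG n : measurable_fun setT (G n).
Proof. exact: (measurable_integral_ou hB hH0 hH1 hc hZ alpha0 mL ML LM hX n%:R (ler0n _ _) g M mg gM). Qed.

Let Gm (n : nat) : R := \int[mu]_(t in `[0, n%:R]) (g t * ou_mean alpha L t).

Lemma cvg_in_proba_mean_ou : cvg_in_proba P (fun n w => n%:R^-1 * G n w) (dot01 g h).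
Proof.
pose V n w := n%:R^-1 * (G n w - Gm n).
have V0 : cvg_in_proba P V 0.
  (* Constant and rate are [n ^ -2] times the bound of [ou_fluctuation] at horizon [n]. *)
  pose C := M ^+ 2 * (4 / alpha ^+ 2).
  apply: (cvg_in_proba_dotL2 _ _ (fun n => C * (n%:R^-1 ^+ 2 * n%:R `^ (2 * H)))); last first.
    by rewrite -[X in _ --> X](mulr0 C); apply: cvgM; [exact: cvg_cst|exact: cvg_inv_sq_powR].
  apply: nearW => n.
  have [W [LW Wle GW]] := ou_fluctuation hB hH0 hH1 hc hZ alpha0 mL ML LM hX n%:R (ler0n _ _) g M mg gM.
  have WV : {ae P, forall w, n%:R^-1 * W w = V n w}.
    by apply: ae_filterS GW => w GW; rewrite /V /G GW addrC addKr.
  have VW : {ae P, forall w, V n w = n%:R^-1 * W w} by apply: ae_filterS WV => w ->.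
  have LnW := sqintegrableZ P n%:R^-1 _ LW.
  have mV : measurable_fun setT (V n) by apply: measurable_funM => //; exact: measurable_funB.
  have LV := ae_sqintegrable P _ _ LnW mV WV; split => //.
  rewrite (ae_dotL2 P _ _ _ _ LV LnW LV LnW VW VW) dotL2Zl// dotL2C dotL2Zl// mulrA -expr2.
  apply: le_trans (ler_wpM2l (sqr_ge0 _) Wle) _; rewrite le_eqVlt; apply/orP; left; apply/eqP.
  by rewrite /C; ring.
have -> : dot01 g h = 0 + dot01 g h by rewrite add0r.
have := cvg_in_probaD P _ _ _ _ V0 (cvg_in_proba_cst P _ _ (cvg_mean_mul_ou_mean alpha alpha0 L mL ML LM Lper g mg M gM gper)).
by congr cvg_in_proba; apply/funext => n; apply/funext => w; rewrite -mulrDr subrK.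
Qed.

Lemma integral_periodic_dot01 (n : nat) :
  \int[mu]_(t in `[0, n%:R]) (g t * L t) = n%:R * dot01 g L.
Proof.
apply: Rintegral_periodic => [u|N]; first by rewrite gper Lper.
apply: (integrable_bounded_mul _ _ M g) => //; first exact: measurable_funTS.
exact: integrable_L mL ML LM _.
Qed.

(** Once the drift is subtracted, what remains is almost surely [n ^ -1] times the integral of [g]
    against [Z], with second moment at most [M ^ 2 * n ^ (2 H - 2)]. In the drift the average of
    [g * L] is exact by periodicity, and that of [g * X] is governed by [cvg_in_proba_mean_ou]. *)
Lemma cvg_in_proba_mean_dX (I : nat -> {RV P >-> R}) :
  (forall n, (1 <= n)%N -> is_dX_integral B H c dH alpha L X g n%:R (I n)) ->
  cvg_in_proba P (fun n w => n%:R^-1 * I n w) (dot01 g L - alpha * dot01 g h).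
Proof.
move=> hI; pose V n w := n%:R^-1 * (I n w - (n%:R * dot01 g L - alpha * G n w)).
have V0 : cvg_in_proba P V 0.
  pose C := M ^+ 2.
  apply: (cvg_in_proba_dotL2 _ _ (fun n => C * (n%:R^-1 ^+ 2 * n%:R `^ (2 * H)))); last first.
    by rewrite -[X in _ --> X](mulr0 C); apply: cvgM; [exact: cvg_cst|exact: cvg_inv_sq_powR].
  near=> n.
  have n1 : (1 <= n)%N by near: n; exact: nbhs_infty_ge.
  have [Y [hY IY]] := hI n n1.
  have LY := rosenblatt_integral_sqintegrable hB _ _ _ hY.
  have Yle := rosenblatt_integral_dotL2_le hB hH0 hH1 hc hZ g n%:R M Y (ler0n _ _) mg (fun u _ => gM u) hY.
  have YV : {ae P, forall w, n%:R^-1 * Y w = V n w}.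
    apply: ae_filterS (filterI IY (rou_paths hX)) => w [/= IYw cw]; rewrite /V IYw; congr (_ * _).
    have iX : mu.-integrable `[0, n%:R] (EFin \o (fun t => X t w)).
      apply: continuous_compact_integrable; first exact: segment_compact.
      by apply: continuous_subspaceW cw => t /=; rewrite !in_itv/= andbT => /andP[].
    have igX : mu.-integrable `[0, n%:R] (EFin \o (fun t => g t * X t w)).
      by apply: (integrable_bounded_mul _ _ M g) => //; exact: measurable_funTS.
    have iagX : mu.-integrable `[0, n%:R] (fun t => (alpha%:E * (g t * X t w)%:E)%E) by exact: integrableZl.
    have igL : mu.-integrable `[0, n%:R] (EFin \o (fun t => g t * L t)).
      apply: (integrable_bounded_mul _ _ M g) => //; first exact: measurable_funTS.
      exact: integrable_L mL ML LM _.
    have -> : \int[mu]_(t in `[0, n%:R]) (g t * (L t - alpha * X t w)) = n%:R * dot01 g L - alpha * G n w.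
      rewrite -integral_periodic_dot01.
      transitivity (\int[mu]_(t in `[0, n%:R]) (g t * L t - alpha * (g t * X t w))).
        by apply: eq_Rintegral => t _; ring.
      transitivity (\int[mu]_(t in `[0, n%:R]) (g t * L t) -
          \int[mu]_(t in `[0, n%:R]) (alpha * (g t * X t w))); first exact: RintegralB.
      by congr (_ - _); exact: RintegralZl.
    by rewrite addrAC subrr add0r.
  have VY : {ae P, forall w, V n w = n%:R^-1 * Y w} by apply: ae_filterS YV => w ->.
  have LnY := sqintegrableZ P n%:R^-1 _ LY.
  have mV : measurable_fun setT (V n).
    by apply: measurable_funM => //; do 2 (apply: measurable_funB => //); exact: measurable_funM.
  have LV := ae_sqintegrable P _ _ LnY mV YV; split => //.
  rewrite (ae_dotL2 P _ _ _ _ LV LnY LV LnY VY VY) dotL2Zl// dotL2C dotL2Zl// mulrA -expr2.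
  by rewrite [leRHS]mulrCA; apply: ler_wpM2l Yle; exact: sqr_ge0.
have cL : cvg_in_proba P (fun _ _ => dot01 g L) (dot01 g L).
  by apply: cvg_in_proba_cst; exact: cvg_cst.
have ca : cvg_in_proba P (fun _ _ => - alpha) (- alpha).
  by apply: cvg_in_proba_cst; exact: cvg_cst.
have := cvg_in_probaD P _ _ _ _ V0
  (cvg_in_probaD P _ _ _ _ cL (cvg_in_probaM P _ _ _ _ ca cvg_in_proba_mean_ou)).
rewrite add0r mulNr; apply: cvg_in_proba_ae; near=> n; apply: aeW => w.
have n0 : n%:R != 0 :> R by rewrite pnatr_eq0 -lt0n; near: n; exact: nbhs_infty_gt.
by rewrite /V; field.
Unshelve. all: by end_near. Qed.

End estimation.

(** * The mean function as a combination of periodic functions *)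

Section periodic_mean.
Context {R : realType}.
Local Notation mu := (@lebesgue_measure R).

Lemma bounded_fun_norm_le (f : R -> R) : bounded_fun f -> exists M, forall x, `|f x| <= M.
Proof.
(* [bounded_fun] provides bounds by the numbers strictly above [M], whence the [+ 1]. *)
by move=> [M [_ hM]]; exists (M + 1) => x; apply: (hM (M + 1) _ x I); rewrite ltrDl.
Qed.

(** Integrability is part of the conclusion because additivity of the integral requires it for the
    partial sum at each step of the induction. *)
Lemma dot01_sum (I : Type) (r : seq I) (a : I -> R) (g : R -> R) (f : I -> R -> R) :
  (forall i, mu.-integrable `[0, 1] (EFin \o (fun t => g t * f i t))) ->
  mu.-integrable `[0, 1] (EFin \o (fun t => g t * \sum_(i <- r) a i * f i t)) /\
  dot01 g (fun t => \sum_(i <- r) a i * f i t) = \sum_(i <- r) a i * dot01 g (f i).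
Proof.
move=> ig; elim: r => [|i r [ih IH]].
  have e t : g t * \sum_(i <- [::]) a i * f i t = 0 by rewrite big_nil mulr0.
  split; first by apply: (eq_integrable _ (cst 0%E)) (integrable0 _ _) => // t _; rewrite /= e.
  rewrite big_nil /dot01 /Rintegral; under eq_integral do rewrite e.
  by rewrite integral0.
have iai : mu.-integrable `[0, 1] (fun t => ((a i)%:E * (g t * f i t)%:E)%E).
  by apply: integrableZl => //; exact: ig.
have e t : g t * \sum_(j <- i :: r) a j * f j t =
    a i * (g t * f i t) + g t * \sum_(j <- r) a j * f j t.
  by rewrite big_cons mulrDr mulrCA.
split.
  have iD : mu.-integrable `[0, 1] (fun t => (a i)%:E * (g t * f i t)%:E +
      (g t * \sum_(j <- r) a j * f j t)%:E)%E by exact: integrableD.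
  by apply: eq_integrable iD => // t _; rewrite /= e.
rewrite big_cons -IH /dot01.
transitivity (\int[mu]_(t in `[0, 1]) (a i * (g t * f i t) + g t * \sum_(j <- r) a j * f j t)).
  by apply: eq_Rintegral => t _; exact: e.
transitivity (\int[mu]_(t in `[0, 1]) (a i * (g t * f i t)) +
    \int[mu]_(t in `[0, 1]) (g t * \sum_(j <- r) a j * f j t)); first exact: RintegralD.
by congr (_ + _); exact: RintegralZl.
Qed.

Context {p : nat} (a : 'I_p -> R) (phi : 'I_p -> R -> R).
Context (mphi : forall i, measurable_fun setT (phi i)).

Lemma measurable_periodic_mean : measurable_fun setT (periodic_mean a phi).
Proof. by apply: measurable_sum => i; exact: measurable_funM. Qed.

Lemma periodic_mean_periodic (t : R) : (forall i, periodic (phi i) t) ->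
  periodic (periodic_mean a phi) t.
Proof. by move=> h u; apply: eq_bigr => i _; rewrite h. Qed.

Context (M : 'I_p -> R) (phiM : forall i x, `|phi i x| <= M i).

Lemma periodic_mean_le (x : R) : `|periodic_mean a phi x| <= \sum_i `|a i| * M i.
Proof.
apply: (le_trans (ler_norm_sum _ _ _)); apply: ler_sum => i _.
by rewrite normrM ler_wpM2l.
Qed.

Lemma dot01_periodic_mean (g : R -> R) (Mg : R) :
  measurable_fun setT g -> (forall x, `|g x| <= Mg) ->
  dot01 g (periodic_mean a phi) = \sum_i a i * dot01 g (phi i).
Proof.
move=> mg gM; apply: (dot01_sum _ _ _ _ _ _).2 => i.
apply: (integrable_bounded_mul _ _ Mg g) => //; first exact: measurable_funTS.
by apply: (integrable_itv_bounded _ _ (M i)) => // ; exact: measurable_funTS.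
Qed.

End periodic_mean.

(** * Consistency of the estimators *)

Theorem proposition9 (R : realType) (d : measure_display)
    (T : measurableType d) (P : probability T R)
    (B : R -> {RV P >-> R}) (hB : brownian_motion B)
    (H : R) (hH0 : 2^-1 < H) (hH1 : H < 1)
    (c dH : R) (hc : 0 < c) (hdH : 0 < dH)
    (Z : R -> {RV P >-> R}) (hZ : rosenblatt_process B H c dH Z)
    (alpha : R) (halpha : 0 < alpha)
    (p : nat) (hp : (1 <= p)%N)
    (mu : 'I_p -> R) (phi : 'I_p -> R -> R)
    (phi_meas : forall i, measurable_fun setT (phi i))
    (phi_bdd : forall i, bounded_fun (phi i))
    (phi_per : forall i, periodic (phi i) 1)
    (phi_orthonormal : forall i j, dot01 (phi i) (phi j) = (i == j)%:R)
    (X : R -> {RV P >-> R})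
    (hX : rosenblatt_OU B H c dH Z alpha (periodic_mean mu phi) X)
    (h_notin : ~ in_span01 phi (h_tilde alpha (periodic_mean mu phi)))
    (psi : R -> R)
    (psi_meas : measurable_fun setT psi)
    (psi_bdd : bounded_fun psi)
    (psi_per : periodic psi 1)
    (psi_orth : forall i, dot01 psi (phi i) = 0)
    (psi_h : dot01 psi (h_tilde alpha (periodic_mean mu phi)) <> 0)
    (Iphi : 'I_p -> nat -> {RV P >-> R})
    (hIphi : forall i n, (1 <= n)%N ->
       is_dX_integral B H c dH alpha (periodic_mean mu phi) X
         (phi i) n%:R (Iphi i n))
    (Ipsi : nat -> {RV P >-> R})
    (hIpsi : forall n, (1 <= n)%N ->
       is_dX_integral B H c dH alpha (periodic_mean mu phi) X
         psi n%:R (Ipsi n)) :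
  consistent P
    (fun n w => param_vector
       (alpha_bar X psi Ipsi n w)
       (fun i => mu_bar X phi psi Iphi Ipsi i n w))
    (param_vector alpha mu).
Proof.
pose L := periodic_mean mu phi.
have [M phiM] := choice (fun i => bounded_fun_norm_le (phi i) (phi_bdd i)).
have [Mpsi psiM] := bounded_fun_norm_le psi psi_bdd.
have mL : measurable_fun setT L by exact: measurable_periodic_mean.
have LM := periodic_mean_le mu phi M phiM.
have Lper : periodic L 1 by exact: periodic_mean_periodic.
pose h := h_tilde alpha L.
have phiL i : dot01 (phi i) L = mu i.
  rewrite (dot01_periodic_mean mu phi phi_meas M phiM (phi i) (M i))//.
  rewrite (bigD1 i)//= big1 => [|j ji]; rewrite phi_orthonormal.
    by rewrite eqxx mulr1 addr0.
  by rewrite eq_sym (negbTE ji) mulr0.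
have psiL : dot01 psi L = 0.
  rewrite (dot01_periodic_mean mu phi phi_meas M phiM psi Mpsi)//.
  by rewrite big1 => // i _; rewrite psi_orth mulr0.
have mG g Mg (n : nat) := measurable_integral_ou hB hH0 hH1 hc hZ halpha mL _ LM hX n%:R (ler0n _ _) g Mg.
have malpha n : measurable_fun setT (alpha_bar X psi Ipsi n).
  apply: (measurableT_comp (@oppr_measurable R setT)).
  by apply: measurable_funM => //; apply: measurable_fun_inv; exact: (mG psi Mpsi).
have mmu i n : measurable_fun setT (mu_bar X phi psi Iphi Ipsi i n).
  apply: measurable_funM => //; apply: measurable_funD => //; apply: measurable_funM => //.
  exact: (mG (phi i) (M i)).
have cpsiX := cvg_in_proba_mean_ou hB hH0 hH1 hc hZ halpha mL _ LM Lper hX psi psi_meas _ psiM psi_per.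
have cpsi := cvg_in_proba_mean_dX hB hH0 hH1 hc hZ halpha mL _ LM Lper hX psi psi_meas _ psiM psi_per _ hIpsi.
have cminus : cvg_in_proba P (fun _ _ => -1) (-1) by apply: cvg_in_proba_cst; exact: cvg_cst.
have psih0 : dot01 psi h != 0 by apply/eqP.
have calpha : cvg_in_proba P (fun n w => alpha_bar X psi Ipsi n w) alpha.
  (* The factors [n ^ -1] of numerator and denominator cancel. The quotient tends to
     [- alpha <psi, h> / <psi, h> = - alpha], and the sign in front restores [alpha]. *)
  have := cvg_in_probaM P _ _ _ _ cminus (cvg_in_proba_div P _ _ _ _ psih0 cpsi cpsiX).
  have -> : -1 * ((dot01 psi L - alpha * dot01 psi h) / dot01 psi h) = alpha.
    by rewrite psiL; field.
  apply: cvg_in_proba_ae; near=> n; apply: aeW => w.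
  have n0 : n%:R != 0 :> R by rewrite pnatr_eq0 -lt0n; near: n; exact: nbhs_infty_gt.
  by rewrite /alpha_bar invfM invrK mulN1r; congr (- _); rewrite mulrACA mulVf// mul1r.
have cmu i : cvg_in_proba P (fun n w => mu_bar X phi psi Iphi Ipsi i n w) (mu i).
  have cX := cvg_in_proba_mean_ou hB hH0 hH1 hc hZ halpha mL _ LM Lper hX
    (phi i) (phi_meas i) _ (phiM i) (phi_per i).
  have cI := cvg_in_proba_mean_dX hB hH0 hH1 hc hZ halpha mL _ LM Lper hX
    (phi i) (phi_meas i) _ (phiM i) (phi_per i) _ (hIphi i).
  (* The limit is [(mu i - alpha <phi i, h>) + alpha <phi i, h>]: inserting a consistent estimate of
     [alpha] removes the bias due to the mean reversion. *)
  have := cvg_in_probaD P _ _ _ _ cI (cvg_in_probaM P _ _ _ _ calpha cX).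
  rewrite -/L phiL subrK; apply: cvg_in_proba_ae; apply: nearW => n; apply: aeW => w.
  by rewrite /mu_bar mulrDr mulrCA.
apply: consistentP => [n i|i].
  (* Coordinate 0 of the parameter vector carries [alpha]; the lifted ones carry the [mu j]. *)
  case: (unliftP ord0 i) => [j ->|->].
    by under eq_fun do rewrite mxE liftK; exact: mmu.
  by under eq_fun do rewrite mxE unlift_none; exact: malpha.
case: (unliftP ord0 i) => [j ->|->].
  by under eq_fun do under eq_fun do rewrite mxE liftK; rewrite mxE liftK; exact: cmu.
by under eq_fun do under eq_fun do rewrite mxE unlift_none; rewrite mxE unlift_none; exact: calpha.
Unshelve. all: by end_near. Qed.
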